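(* Let $\mathcal S$ be the set of ideals $I\in\mathcal F[3]$ (ideals of $K[X,Y,Z]$) with $\nu_e(I)=3$ and $\alpha(I)>2$. Let $\bar I\subset K[X,Y]$ be an ideal of $\mathcal F[2]$ with $\alpha=\alpha(\bar I)>2$, having $\alpha-1$ strongly inessential generators in any e-maximal basis. Then $\bar I$ has at least one lifting in $\mathcal S$; that is, there is an ideal $I\in\mathcal S$ such that $Z$ is a non-zero-divisor on $K[X,Y,Z]/I$ and the image of $I$ in $K[X,Y,Z]/(Z)=K[X,Y]$ is $\bar I$.
   Context: $K$ is an algebraically closed field. For $S=K[X_1,\dots,X_n]$, let $\mathfrak M=(X_1,\dots,X_n)$. A standard basis of a homogeneous ideal $I$ of $S$ is an ordered set of forms generating $I$ such that its elements of degree $d$ define a $K$-basis of $I_d/(I_{d-1}S_1)$ for every $d$; $\nu(I)$ is its number of elements and $\alpha(I)$ the smallest degree of its elements. $\mathcal F[n]$ is the set of homogeneous perfect height $2$ ideals $I$ of $K[X_1,\dots,X_n]$ (height $2$ and projective dimension of $S/I$ equal to $2$) with $\nu(I)=\alpha(I)+1$; here $n=2$ (variables $X,Y$) and $n=3$ (variables $X,Y,Z$). Given a standard basis $\mathcal B$ of $I$, $f\in\mathcal B$ is inessential with respect to $\mathcal B$ if there is $t\in\mathbb N$ with $f\,\mathfrak M^t\subseteq(\mathcal B\setminus\{f\})S$; otherwise it is essential. A form $f\in I_d$ is strongly inessential if $f\notin I_{d-1}S$ and $f$ is inessential with respect to every standard basis of $I$ containing it. A standard basis is e-maximal if for every $d$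 it has exactly $\nu_e(d)$ essential elements of degree $d$, where $\nu_e(d)$ is the greatest number of essential elements of degree $d$ appearing in a standard basis of $I$. $\nu_e(I)$ denotes the number of essential elements of any e-maximal basis of $I$. *)

(* Defs.v *)
From HB Require Import structures.
From mathcomp Require Import all_boot all_order all_algebra.
From mathcomp Require Import generic_quotient ring_quotient.
From mathcomp Require Import boolp.
From mathcomp Require Import mpoly.

Set Implicit Arguments.
Unset Strict Implicit.
Unset Printing Implicit Defensive.

Import GRing.Theory.
Local Open Scope ring_scope.
Local Open Scope quotient_scope.

Section Ideals.
Variable R : comNzRingType.

(* The span R-linearly generated by P; it is the zero ideal when P is empty. *)
Definition ideal_gen (P : R -> Prop) (f : R) : Prop :=
  exists2 s : seq (R * R), (forall u, u \in s -> P u.1)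
                         & f = \sum_(u <- s) u.1 * u.2.

Definition ideal_pow (P : R -> Prop) (t : nat) : R -> Prop :=
  ideal_gen (fun f => exists2 s : t.-tuple R,
    (forall u, u \in s -> P u) & f = \prod_(u <- s) u).

(* p 0, ..., p h is a strictly increasing chain; values p i with i > h are
   irrelevant. *)
Definition prime_chain (h : nat) (p : nat -> prime_idealr R) : Prop :=
  forall i, (i < h)%N ->
    {subset p i <= p i.+1} /\ (exists2 f, f \in p i.+1 & f \notin p i).

Definition prime_height (P : prime_idealr R) (h : nat) : Prop :=
  (exists2 p, prime_chain h p & p h =i P) /\
  (forall k p, prime_chain k p -> p k =i P -> (k <= h)%N).

(* Primes of infinite height do not affect the minimum. *)
Definition height (I : idealr R) (h : nat) : Prop :=
  (exists P : prime_idealr R, {subset I <= P} /\ prime_height P h) /\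
  (forall (P : prime_idealr R) k,
     {subset I <= P} -> prime_height P k -> (h <= k)%N).

End Ideals.

(* R / I as an R-module; the library only provides its ring structure. *)
Section QuotientModule.
Variables (R : comNzRingType) (I : idealr R).

Definition quot_mod : Type := {ideal_quot I}.

HB.instance Definition _ := GRing.Zmodule.copy quot_mod {ideal_quot I}.

Definition quot_scale (a : R) (x : quot_mod) : quot_mod :=
  (\pi_({ideal_quot I}) a : {ideal_quot I}) * (x : {ideal_quot I}).

Fact quot_scaleA a b x :
  quot_scale a (quot_scale b x) = quot_scale (a * b) x.
Proof. by rewrite /quot_scale rmorphM mulrA. Qed.

Fact quot_scale1 : left_id 1 quot_scale.
Proof. by move=> x; rewrite /quot_scale rmorph1 mul1r. Qed.

Fact quot_scaleDr : right_distributive quot_scale +%R.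
Proof. by move=> a x y; rewrite /quot_scale mulrDr. Qed.

Fact quot_scaleDl x : {morph quot_scale^~ x : a b / a + b}.
Proof. by move=> a b; rewrite /quot_scale rmorphD mulrDl. Qed.

HB.instance Definition _ := GRing.Zmodule_isLmodule.Build R quot_mod
  quot_scaleA quot_scale1 quot_scaleDr quot_scaleDl.

End QuotientModule.

Section ProjectiveDimension.
Variable R : comNzRingType.

Definition projective (P : lmodType R) : Prop :=
  forall (M N : lmodType R) (g : {linear M -> N}) (f : {linear P -> N}),
    (forall y, exists x, g x = y) ->
    exists h : {linear P -> M}, forall x, g (h x) = f x.

(* M has a projective resolution
   0 -> P n -> ... -> P 1 -> P 0 -> M -> 0. *)
Definition pdim_le (M : lmodType R) (n : nat) : Prop :=
  exists (P : nat -> lmodType R) (d : forall i, {linear P i.+1 -> P i})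
         (e : {linear P 0%N -> M}),
    [/\ forall i, projective (P i),
        forall y, exists x, e x = y,
        forall x, e x = 0 <-> exists y, d 0%N y = x,
        forall i x, d i x = 0 <-> exists y, d i.+1 y = x
      & forall i, (n < i)%N -> forall x : P i, x = 0].

Definition pdim (M : lmodType R) (n : nat) : Prop :=
  pdim_le M n /\ (forall m, pdim_le M m -> (n <= m)%N).

End ProjectiveDimension.

Section StandardBases.
Variables (K : closedFieldType) (n : nat).
Local Notation S := {mpoly K[n]}.
Implicit Types (I : idealr S) (B : seq S) (f g : S) (d m : nat).

Definition homogeneous I : Prop :=
  forall f d, f \in I -> pihomog mdeg d f \in I.

(* The maximal ideal (X_1, ..., X_n). *)
Definition irrelevant : S -> Prop :=
  ideal_gen (fun f => exists i : 'I_n, f = 'X_i).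

(* g is in I_(d-1), with no such g when d = 0: the sets generated by it below
   are then reduced to 0, as they should since I_(-1) = 0. *)
Definition prev_part I d g : Prop :=
  g \in I /\ (exists2 e, d = e.+1 & g \is e.-homog).

(* I_(d-1) S_1 *)
Definition prev_part_S1 I d f : Prop :=
  exists2 s : seq (S * S),
    (forall u, u \in s -> prev_part I d u.1 /\ u.2 \is 1.-homog)
    & f = \sum_(u <- s) u.1 * u.2.

(* As 0 is d-homogeneous for every d, independence excludes 0 from B, so that
   every element of B is d-homogeneous for exactly one d. *)
Definition standard_basis I B : Prop :=
  [/\ uniq B,
      forall f, f \in B -> exists d, f \is d.-homog,
      forall f, f \in I <-> ideal_gen (fun g => g \in B) f,
      forall d g, g \in I -> g \is d.-homog ->
        exists c : S -> K,
          prev_part_S1 I d (g - \sum_(f <- B | f \is d.-homog) c f *: f)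
    & forall d (c : S -> K),
        prev_part_S1 I d (\sum_(f <- B | f \is d.-homog) c f *: f) ->
        forall f, f \in B -> f \is d.-homog -> c f = 0].

Definition nu I m : Prop := exists2 B, standard_basis I B & size B = m.

Definition alpha I m : Prop :=
  exists2 B, standard_basis I B &
    (exists2 f, f \in B & f \is m.-homog) /\
    (forall f d, f \in B -> f \is d.-homog -> (m <= d)%N).

(* The class F[n] of the perfect homogeneous ideals of height 2 with the
   maximal number of generators allowed by alpha(I). *)
Definition calF I : Prop :=
  [/\ homogeneous I, height I 2, pdim (quot_mod I) 2
    & exists2 a, alpha I a & nu I a.+1].

Definition inessential B f : Prop :=
  exists t, forall g, ideal_pow irrelevant t g ->
    ideal_gen (fun b => b \in B /\ b <> f) (f * g).

Definition essential B f : Prop := ~ inessential B f.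

Definition strongly_inessential I f : Prop :=
  exists d, [/\ f \in I, f \is d.-homog, ~ ideal_gen (prev_part I d) f
    & forall B, standard_basis I B -> f \in B -> inessential B f].

Definition num_essential_deg B d : nat :=
  count (fun f => (f \is d.-homog) && `[< essential B f >]) B.

Definition num_essential B : nat := count (fun f => `[< essential B f >]) B.

Definition num_strongly_inessential I B : nat :=
  count (fun f => `[< strongly_inessential I f >]) B.

Definition nu_e_deg I d m : Prop :=
  (exists2 B, standard_basis I B & num_essential_deg B d = m) /\
  (forall B, standard_basis I B -> (num_essential_deg B d <= m)%N).

Definition e_maximal I B : Prop :=
  standard_basis I B /\ (forall d, nu_e_deg I d (num_essential_deg B d)).

(* All e-maximal bases have the same number of essential elements. *)
Definition nu_e I m : Prop := exists2 B, e_maximal I B & num_essential B = m.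

End StandardBases.

Section Lifting.
Variable K : closedFieldType.

Definition calS (I : idealr {mpoly K[3]}) : Prop :=
  [/\ calF I, nu_e I 3 & exists2 a, alpha I a & (2 < a)%N].

(* Substitution X -> X, Y -> Y, Z -> 0, which identifies K[X,Y,Z]/(Z) with
   K[X,Y]. *)
Definition mod_Z (f : {mpoly K[3]}) : {mpoly K[2]} :=
  f \mPo [tuple 'X_ord0; 'X_ord_max; 0].

Definition lifting (I : idealr {mpoly K[3]}) (J : idealr {mpoly K[2]}) : Prop :=
  GRing.lreg (\pi_({ideal_quot I}) ('X_ord_max : {mpoly K[3]})) /\
  (forall g, g \in J <-> exists2 f, f \in I & mod_Z f = g).

End Lifting.

(* Main.v *)
From HB Require Import structures.
Require Import Defs.
From mathcomp Require Import all_boot all_order all_algebra.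
From mathcomp Require Import generic_quotient ring_quotient.
From mathcomp Require Import boolp.
From mathcomp Require Import mpoly.
From mathcomp Require Import ring zify.

Set Implicit Arguments.
Unset Strict Implicit.
Unset Printing Implicit Defensive.

Import GRing.Theory.
Local Open Scope ring_scope.

(** Why the theorem holds.

    First, the hypotheses determine the binary ideal. Let I be the given ideal of
    K[X,Y], of initial degree a. The bound dim I_d S_1 >= dim I_d + 1, summed over
    the degrees d >= a, shows that an ideal of initial degree a has at most a + 1
    generators (deg_part_shift_full). Here this maximum is attained, so the bound is
    an equality in each degree, and Macaulay's description of that case
    (small_shift) says that I_d consists of all multiples of a single form phi_d,
    with phi_d constant for large d. By the Nullstellensatz for binary forms
    (binary_nullstellensatz), an element of a standard basis is essential exactly
    when the other elements have a common zero. Counting the points at which this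
    can happen, degree by degree, gives an upper bound for the number of essential
    elements, and an interpolation argument produces a basis reaching this bound in
    all degrees at once (adapted_basis). If a - 1 elements of such a basis are
    strongly inessential, at most two are essential. In degree a there are dim I_a of
    them, and each root of phi_a accounts for a further one, in the degree where the
    forms of I stop vanishing at it. So I_a is spanned by phi_a, which has a single
    root, of multiplicity a (initial_form, form_single_root). Hence
    phi_a = l^a for a linear form l, every phi_d is a power of l (single_line), and,
    m being a second linear form, I is generated by monomials l^(a-j) m^(C j),
    0 <= j <= a, with C strictly increasing, C 0 = 0 and C 1 > 1
    (monomial_exponents).

    Second, such an ideal is lifted explicitly. Its Hilbert-Burch matrix has two
    diagonals, with entries l and m^(c i), where c i = C i - C (i-1). Lifting l and m
    to x and y, put on a third diagonal the powers of z that homogeneity allows. The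
    maximal minors of the new matrix are g_j = x^(a-j) p_j, with p_j a continuant
    (contin), and they satisfy x g_i = y^(c i) g_(i-1) + z^(e i) g_(i-2). Everything
    about the ideal they generate follows from the fact that these relations generate
    all syzygies (gener_syzygy): the g_j form a standard basis (gens_standard), the
    projective dimension is 2 (lifted_pdim), and z is a nonzerodivisor
    (lifted_nzd). A prime containing the ideal contains x and y, and (x, y) has
    height 2 (lifted_height).

    Third, the essential elements of the lifted ideal are counted. An element of a
    standard basis is inessential as soon as the entries of its column of the
    Hilbert-Burch matrix have no common zero. A column with 1 <= j <= a - 2 contains
    x, a power of y and a power of z, and this survives any change of basis
    (middle_inessential), whereas the column 0 and the last two columns have common
    zeros (gens_essential). So any standard basis has in each degree at most as many
    essential elements as the basis of the g_j, which has three (lifted_nu_e). *)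

(** * Generated ideals *)

Section GeneratedIdeals.
Variable R : comNzRingType.
Implicit Types (P Q : R -> Prop) (f g a : R).

(** Ideals as Prop-valued predicates. Unlike idealr this includes the unit ideal,
    so that generated ideals and colon ideals are covered. *)
Definition ideal_like Q : Prop :=
  [/\ Q 0, forall f g, Q f -> Q g -> Q (f + g) & forall f a, Q f -> Q (f * a)].

Lemma ideal_gen_mem P f : P f -> ideal_gen P f.
Proof.
move=> Pf; exists [:: (f, 1)]; first by move=> u; rewrite inE => /eqP ->.
by rewrite big_seq1 mulr1.
Qed.

Lemma ideal_gen_ideal P : ideal_like (ideal_gen P).
Proof.
split.
- by exists [::]; rewrite ?big_nil.
- move=> _ _ [s Ps ->] [t Pt ->]; exists (s ++ t); last by rewrite big_cat.
  by move=> u; rewrite mem_cat => /orP [/Ps|/Pt].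
- move=> _ a [s Ps ->]; exists [seq (u.1, u.2 * a) | u <- s].
    by move=> u /mapP [v /Ps Pv ->].
  by rewrite big_map mulr_suml; apply: eq_bigr => u _; rewrite mulrA.
Qed.

Section IdealLike.
Variables (Q : R -> Prop) (hQ : ideal_like Q).

Lemma ideal_like0 : Q 0. Proof. by case: hQ. Qed.

Lemma ideal_likeD f g : Q f -> Q g -> Q (f + g).
Proof. by case: hQ => _ + _; apply. Qed.

Lemma ideal_likeMr f a : Q f -> Q (f * a).
Proof. by case: hQ => _ _; apply. Qed.

Lemma ideal_likeMl f a : Q f -> Q (a * f).
Proof. by rewrite mulrC; apply: ideal_likeMr. Qed.

Lemma ideal_likeN f : Q f -> Q (- f).
Proof. by rewrite -mulN1r; apply: ideal_likeMl. Qed.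

Lemma ideal_likeB f g : Q f -> Q g -> Q (f - g).
Proof. by move=> Qf Qg; apply/ideal_likeD/ideal_likeN. Qed.

Lemma ideal_likeBr f g : Q (f - g) -> Q g -> Q f.
Proof. by move=> Qfg Qg; rewrite -[f](subrK g); apply: ideal_likeD. Qed.

Lemma ideal_like_sum (T : Type) (s : seq T) (A : pred T) (F : T -> R) :
  (forall i, A i -> Q (F i)) -> Q (\sum_(i <- s | A i) F i).
Proof.
by move=> QF; elim/big_rec: _ => [|i f Ai Qf]; [apply: ideal_like0|apply: ideal_likeD; [apply: QF|]].
Qed.

Lemma ideal_like_sum_seq (T : eqType) (s : seq T) (A : pred T) (F : T -> R) :
  (forall i, i \in s -> A i -> Q (F i)) -> Q (\sum_(i <- s | A i) F i).
Proof.
move=> QF; rewrite big_seq_cond; apply: ideal_like_sum => i /andP [].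
exact: QF.
Qed.

Lemma ideal_gen_min P : (forall f, P f -> Q f) -> forall f, ideal_gen P f -> Q f.
Proof.
move=> PQ _ [s Ps ->]; apply: ideal_like_sum_seq => u /Ps /PQ Qu _.
exact: ideal_likeMr.
Qed.

(** f ^ k - g ^ k is a multiple of f - g. *)
Lemma ideal_like_expB f g k : Q (f - g) -> Q (g ^+ k) -> Q (f ^+ k).
Proof.
move=> Qfg Qg; rewrite -[f ^+ k](subrK (g ^+ k)); apply: ideal_likeD => //.
by rewrite subrXX; apply: ideal_likeMr.
Qed.

Lemma ideal_like_colon f : ideal_like (fun a => Q (f * a)).
Proof.
split=> [|a b|a b]; rewrite ?mulr0 ?mulrDr ?mulrA.
- exact: ideal_like0.
- exact: ideal_likeD.
- exact: ideal_likeMr.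
Qed.

Lemma ideal_like_exp_le f k m : (k <= m)%N -> Q (f ^+ k) -> Q (f ^+ m).
Proof. by move=> /subnK <-; rewrite exprD => ?; apply: ideal_likeMl. Qed.

Lemma ideal_like_idealr : ~ Q 1 -> exists I : idealr R, forall f, f \in I <-> Q f.
Proof.
move=> Q1; pose S : R -> bool := fun f => `[< Q f >].
have SP f : reflect (Q f) (f \in S) by apply: asboolP.
have hS : idealr_closed S.
  split; first exact/SP/ideal_like0.
    by apply/SP.
  by move=> a u v /SP Qu /SP Qv; apply/SP/ideal_likeD => //; apply: ideal_likeMl.
pose zS := GRing.isZmodClosed.Build R S (idealr_closedB hS).
pose pS := isProperIdeal.Build R S (idealr_closed_nontrivial hS).
pose SI := HB.pack_for (idealr R) S zS pS.
by exists SI => f; split=> /SP.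
Qed.

End IdealLike.

Lemma idealr_ideal_like (I : idealr R) : ideal_like (fun f => f \in I).
Proof.
split=> [|f g|f a]; [exact: rpred0|exact: rpredD|].
by rewrite mulrC; apply: idealMr.
Qed.

End GeneratedIdeals.

Lemma prime_idealr_ker (R : comNzRingType) (D : idomainType) (phi : {rmorphism R -> D}) :
  exists P : prime_idealr R, forall f, (f \in P) = (phi f == 0).
Proof.
pose P : R -> bool := fun f => phi f == 0.
have hP : idealr_closed P.
  split; rewrite ?unfold_in /P ?rmorph0 ?eqxx ?rmorph1 ?oner_eq0 //.
  move=> a u v; rewrite !unfold_in => /eqP phiu /eqP phiv.
  by rewrite rmorphD rmorphM phiu phiv mulr0 addr0.
have pP : prime_idealr_closed P.
  by move=> u v; rewrite !unfold_in /P rmorphM mulf_eq0.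
pose z := GRing.isZmodClosed.Build R P (idealr_closedB hP).
pose p := isProperIdeal.Build R P (idealr_closed_nontrivial hP).
pose q := isPrimeIdealrClosed.Build R P pP.
pose PI := HB.pack_for (prime_idealr R) P z p q.
by exists PI.
Qed.

(** * Forms *)

Section Forms.
Variables (n : nat) (K : fieldType).
Local Notation S := {mpoly K[n]}.
Implicit Types (f g p q : S) (d e k : nat).

Lemma pihomogMl p q e d : p \is e.-homog ->
  pihomog mdeg (e + d) (p * q) = p * pihomog mdeg d q.
Proof.
move=> hp; pose N := (maxn (msize q) d.+1).
rewrite {1}(pihomog_partitionE (leq_maxl (msize q) d.+1)) mulr_sumr linear_sum.
have dN : (d < N)%N by rewrite leq_max ltnSn orbT.
rewrite (bigD1 (Ordinal dN)) //= pihomog_dE ?dhomogM ?pihomogP //.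
rewrite big1 ?addr0 // => i /eqP ni; have hpi := dhomogM hp (pihomogP mdeg i q).
by apply: pihomog_ne0 hpi; rewrite eqn_add2l; apply/eqP => id; apply/ni/val_inj.
Qed.

Lemma pihomogMl_lt p q e d : p \is e.-homog -> (d < e)%N ->
  pihomog mdeg d (p * q) = 0.
Proof.
move=> hp de; rewrite {1}(pihomog_partitionE (leqnn (msize q))) mulr_sumr linear_sum.
apply: big1 => i _; have hpi := dhomogM hp (pihomogP mdeg i q).
by apply: pihomog_ne0 hpi; rewrite gtn_eqF // (leq_trans de (leq_addr _ _)).
Qed.

Lemma dhomogXU i : ('X_i : S) \is 1.-homog.
Proof. by rewrite dhomogX /= mdeg1. Qed.

Lemma dhomogMX f d i : f \is d.-homog -> 'X_i * f \is d.+1.-homog.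
Proof. by move=> hf; rewrite -add1n; apply: dhomogM => //; apply: dhomogXU. Qed.

Lemma dhomog1X f k : f \is 1.-homog -> f ^+ k \is k.-homog.
Proof. by move=> hf; rewrite -[X in X.-homog]mul1n; apply: dhomogMn. Qed.

(** Every monomial of positive degree is divisible by a variable. *)
Lemma dhomogS_split f d : f \is d.+1.-homog ->
  exists2 h : 'I_n -> S, (forall i, h i \is d.-homog) & f = \sum_i 'X_i * h i.
Proof.
move=> hf.
have [|F Fh] := @choice _ _ (fun (m : 'X_{1..n}) (F : 'I_n -> S) => m \in msupp f ->
    (forall i, F i \is d.-homog) /\ f@_m *: 'X_[m] = \sum_i 'X_i * F i).
  move=> m; case: (boolP (m \in msupp f)) => [mf|_]; last by exists (fun _ => 0).
  have dm := dhomog_mf hf mf.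
  have [i mi] : exists i, (0 < m i)%N.
    apply: contrapT => m0; have m00 : m = 0%MM.
      by apply/mnmP => i; rewrite mnm0E; case E: (m i) => [//|k]; case: m0; exists i; rewrite E.
    by move: dm; rewrite m00 /= mdeg0.
  have Um : (U_(i) <= m)%MM.
    by apply/mnm_lepP => j; rewrite mnm1E; case: eqP => // <-.
  exists (fun j => if j == i then f@_m *: 'X_[m - U_(i)] else 0) => _; split.
    move=> j; case: eqP => _; last exact: dhomog0.
    apply: dhomogZ; rewrite dhomogX /=.
    by move: dm; rewrite -{1}(submK Um) /= mdegD mdeg1 addn1 => -[->].
  rewrite (bigD1 i) //= eqxx big1 ?addr0 => [|j /negPf ->]; last by rewrite mulr0.
  by rewrite -scalerAr -mpolyXD addmC submK.
exists (fun i => \sum_(m <- msupp f) F m i).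
  by move=> i; rewrite big_seq; apply: rpred_sum => m /Fh [].
rewrite {1}[f]mpolyE big_seq.
under eq_bigr => m /Fh [_ ->] do over.
by rewrite -big_seq exchange_big /=; apply: eq_bigr => i _; rewrite mulr_sumr.
Qed.

Lemma dhomog0_const f : f \is 0.-homog -> exists c : K, f = c%:MP.
Proof.
move=> hf; exists f@_0; rewrite {1}[f]mpolyE.
have e (m : 'X_{1..n}) : m \in msupp f -> m = 0%MM.
  by move=> /(dhomog_mf hf) /eqP; rewrite mdeg_eq0 => /eqP.
case: (boolP (0%MM \in msupp f)) => [f0|f0].
  rewrite (bigD1_seq 0%MM) //= big_seq_cond big1 ?addr0.
    by rewrite mpolyX0 -mul_mpolyC mulr1.
  by move=> m /andP [/e ->]; rewrite eqxx.
rewrite big_seq big1; first by rewrite (memN_msupp_eq0 f0) mpolyC0.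
by move=> m /[dup] /e -> mf; rewrite mf in f0.
Qed.

Lemma dhomog1_linear f : f \is 1.-homog -> exists c : 'I_n -> K, f = \sum_i c i *: 'X_i.
Proof.
move=> /dhomogS_split [h hh ->].
have [c hc] := choice (fun i => dhomog0_const (hh i)).
by exists c; apply: eq_bigr => i _; rewrite hc mulrC mul_mpolyC.
Qed.

Lemma dhomog_eval0 f d : f \is d.+1.-homog -> f.@[fun=> 0] = 0.
Proof.
move=> /dhomogS_split [h _ ->]; rewrite raddf_sum big1 //= => i _.
by rewrite mevalM mevalXU mul0r.
Qed.

Lemma mmap_dhomog_scale (R : comNzRingType) (phi : {rmorphism K -> R}) (t : R)
    (v : 'I_n -> R) f d :
  f \is d.-homog ->
  mmap phi (fun i => t * v i) f = t ^+ d * mmap phi v f.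
Proof.
move=> hf; rewrite /mmap mulr_sumr big_seq [RHS]big_seq; apply: eq_bigr => m.
move=> /(dhomog_mf hf) /= <-; rewrite mulrCA; congr (_ * _).
rewrite /mmap1 mdegE expr_sum -big_split /=; apply: eq_bigr => i _.
by rewrite exprMn.
Qed.

(** When the substitution sends w to 0, this identifies its kernel with the ideal
    generated by w: divisibility by a linear form is always tested in this way. *)
Lemma comp_mpoly_congr (t : n.-tuple S) (w : S) :
  (forall i, exists s, 'X_i - tnth t i = w * s) ->
  forall f, exists s, f - (f \mPo t) = w * s.
Proof.
move=> hw; have hQ : ideal_like (fun f : S => exists s, f = w * s).
  split=> [|_ _ [s ->] [u ->]|_ a [s ->]]; first by exists 0; rewrite mulr0.
    by exists (s + u); rewrite mulrDr.
  by exists (s * a); rewrite mulrA.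
have sub f g : (exists s, f - (f \mPo t) = w * s) -> (exists s, g - (g \mPo t) = w * s) ->
    exists s, f * g - ((f * g) \mPo t) = w * s.
  move=> Qf Qg; rewrite rmorphM /=.
  have -> : f * g - (f \mPo t) * (g \mPo t) =
     (f - (f \mPo t)) * g + (g - (g \mPo t)) * (f \mPo t) by ring.
  by apply: (ideal_likeD hQ); apply: (ideal_likeMr hQ).
elim/mpolyind => [|c m f _ _ Qf]; first by rewrite rmorph0 subr0; apply: (ideal_like0 hQ).
rewrite rmorphD /= opprD addrACA; apply: (ideal_likeD hQ) Qf.
rewrite comp_mpolyZ -scalerBr -mul_mpolyC; apply: (ideal_likeMl hQ).
rewrite mpolyXE_id; elim/big_ind: _ => [||].
- by rewrite rmorph1 subrr; apply: (ideal_like0 hQ).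
- exact: sub.
move=> i _; elim: (m i) => [|k IH]; first by rewrite rmorph1 subrr; apply: (ideal_like0 hQ).
rewrite exprS; apply: sub => //; rewrite comp_mpolyXU -tnth_nth; exact: hw.
Qed.

End Forms.

(** * Standard bases and essential generators *)

Section StandardBasisTheory.
Variables (n : nat) (K : closedFieldType).
Local Notation S := {mpoly K[n]}.
Implicit Types (I : idealr S) (B : seq S) (f g u : S) (d e k : nat) (Q : S -> Prop).

Lemma prev_part_S1P Q I d f : ideal_like Q ->
  (forall u e, d = e.+1 -> u \in I -> u \is e.-homog -> Q u) ->
  prev_part_S1 I d f -> Q f.
Proof.
move=> hQ QI [s hs ->]; apply: ideal_like_sum_seq => // w /hs [[wI [e de we]] _] _.
by apply: ideal_likeMr => //; apply: QI de wI we.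
Qed.

Lemma prev_part_S1_mem I d f : prev_part_S1 I d f -> f \in I /\ f \is d.-homog.
Proof.
move=> If; split.
  by apply: (prev_part_S1P (idealr_ideal_like I)) If => u e _ uI _.
case: If => s hs ->; rewrite big_seq; apply: rpred_sum => w /hs [[_ [e -> we]] w1].
by rewrite -addn1; apply: dhomogM.
Qed.

Lemma prev_part_S1_0 I d : prev_part_S1 I d 0.
Proof. by exists [::]; rewrite ?big_nil. Qed.

Lemma prev_part_S1D I d f g :
  prev_part_S1 I d f -> prev_part_S1 I d g -> prev_part_S1 I d (f + g).
Proof.
move=> [s hs ->] [t ht ->]; exists (s ++ t); last by rewrite big_cat.
by move=> w; rewrite mem_cat => /orP [/hs|/ht].
Qed.

Lemma prev_part_S1Z I d c f : prev_part_S1 I d f -> prev_part_S1 I d (c *: f).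
Proof.
move=> [s hs ->]; exists [seq (w.1, c *: w.2) | w <- s].
  by move=> w /mapP [v /hs [v1 v2] ->]; split=> //; apply: dhomogZ.
by rewrite big_map scaler_sumr; apply: eq_bigr => w _; rewrite scalerAr.
Qed.

Lemma prev_part_S1_sum I d (T : eqType) (s : seq T) (A : pred T) (F : T -> S) :
  (forall i, i \in s -> A i -> prev_part_S1 I d (F i)) ->
  prev_part_S1 I d (\sum_(i <- s | A i) F i).
Proof.
move=> hF; rewrite big_seq_cond; elim/big_rec: _ => [|i x /andP [si Ai] hx].
  exact: prev_part_S1_0.
by apply: prev_part_S1D => //; apply: hF.
Qed.

Lemma prev_part_S1M I d e u h : u \in I -> u \is e.-homog -> h \is d.-homog ->
  (0 < d)%N -> prev_part_S1 I (e + d) (u * h).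
Proof.
case: d => // d uI hu /dhomogS_split [c hc ->] _.
rewrite mulr_sumr; apply: prev_part_S1_sum => i _ _.
exists [:: (u * c i, 'X_i)]; last by rewrite big_seq1 mulrCA mulrC.
move=> w; rewrite inE => /eqP ->; split; last exact: dhomogXU.
split; first by rewrite mulrC idealMr.
by exists (e + d)%N; [rewrite addnS | apply: dhomogM].
Qed.

Section OneBasis.
Variables (I : idealr S) (B : seq S) (hB : standard_basis I B).

Lemma std_uniq : uniq B. Proof. by case: hB. Qed.

Lemma std_mem f : f \in B -> f \in I.
Proof. by case: hB => _ _ h _ _ fB; apply/h; apply: ideal_gen_mem. Qed.

Lemma std_homog f : f \in B -> exists d, f \is d.-homog.
Proof. by case: hB => _ + _ _ _; apply. Qed.

Lemma std_neq0 f : f \in B -> f != 0.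
Proof.
move=> fB; apply/eqP => f0.
have h : prev_part_S1 I 0 (\sum_(g <- B | g \is 0.-homog) ((g == 0)%:R : K) *: g).
  rewrite big1; first exact: prev_part_S1_0.
  by move=> g _; case: eqP => [->|_]; rewrite ?scaler0 ?scale0r.
case: hB => _ _ _ _ /(_ _ _ h f fB); rewrite f0 eqxx => /(_ (dhomog0 _ _ _)) /eqP.
by rewrite oner_eq0.
Qed.

Lemma std_homog_uniq f d e : f \in B -> f \is d.-homog -> f \is e.-homog -> d = e.
Proof. by move=> /std_neq0; apply: dhomog_uniq. Qed.

Lemma std_expand d g : g \in I -> g \is d.-homog ->
  exists c : S -> K, prev_part_S1 I d (g - \sum_(f <- B | f \is d.-homog) c f *: f).
Proof. by case: hB => _ _ _ + _; apply. Qed.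

Lemma std_indep d (c : S -> K) :
  prev_part_S1 I d (\sum_(f <- B | f \is d.-homog) c f *: f) ->
  forall f, f \in B -> f \is d.-homog -> c f = 0.
Proof. by case: hB => _ _ _ _ +; apply. Qed.

(** Used with Q the ideal of the other basis elements, and with Q the vanishing at
    a point. *)
Lemma std_lower Q d : ideal_like Q ->
  (forall b e, b \in B -> b \is e.-homog -> (e < d)%N -> Q b) ->
  forall u e, (e < d)%N -> u \in I -> u \is e.-homog -> Q u.
Proof.
move=> hQ QB u e; elim/ltn_ind: e u => e IH u ed uI ue.
have [c hc] := std_expand uI ue; apply: (ideal_likeBr hQ).
  apply: (prev_part_S1P hQ _ hc) => w e' ee' wI we'.
  have e'e : (e' < e)%N by rewrite ee'.
  exact: IH e'e w (ltn_trans e'e ed) wI we'.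
apply: ideal_like_sum_seq => // b bB be; rewrite -mul_mpolyC.
by apply: ideal_likeMl => //; apply: QB bB be ed.
Qed.

Section OneGenerator.
Variables (f : S) (d : nat) (fB : f \in B) (hf : f \is d.-homog).
Local Notation J := (ideal_gen (fun b => b \in B /\ b <> f)).

Lemma others_lower u e : (e < d)%N -> u \in I -> u \is e.-homog -> J u.
Proof.
apply: std_lower; first exact: ideal_gen_ideal.
move=> b k bB bk kd; apply: ideal_gen_mem; split=> // bf.
by move: kd; rewrite bf in bk; rewrite (std_homog_uniq fB hf bk) ltnn.
Qed.

Lemma others_prev u : prev_part_S1 I d u -> J u.
Proof.
apply: prev_part_S1P; first exact: ideal_gen_ideal.
by move=> w e de; apply: others_lower; rewrite de.
Qed.

(** I / J is cyclic, generated by f: the class of a form of the same degree as f is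
    given by its coordinate on f. *)
Lemma others_coef (c : S -> K) g :
  prev_part_S1 I d (g - \sum_(b <- B | b \is d.-homog) c b *: b) -> J (g - c f *: f).
Proof.
have hJ := ideal_gen_ideal (fun b => b \in B /\ b <> f).
move=> /others_prev hg; rewrite -(subrKA (\sum_(b <- B | b \is d.-homog) c b *: b)).
apply: ideal_likeD => //; rewrite (big_rem f) //= hf addrAC subrr add0r.
apply: ideal_like_sum_seq => // b; rewrite mem_rem_uniq ?std_uniq // inE => /andP [/eqP bf bB] _.
by rewrite -mul_mpolyC; apply: ideal_likeMl => //; apply: ideal_gen_mem.
Qed.

Lemma others_gen g : g \in I -> exists h, J (g - h * f).
Proof.
have hJ := ideal_gen_ideal (fun b => b \in B /\ b <> f).
case: hB => _ _ hI _ _ /hI; apply: (@ideal_gen_min _ (fun g => exists h, J (g - h * f))).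
  split.
  - by exists 0; rewrite mul0r subr0; apply: ideal_like0.
  - move=> g1 g2 [h1 H1] [h2 H2]; exists (h1 + h2).
    by rewrite mulrDl opprD addrACA; apply: ideal_likeD.
  - move=> g1 a [h1 H1]; exists (h1 * a).
    by rewrite mulrAC -mulrBl; apply: ideal_likeMr.
move=> b bB; case: (eqVneq b f) => [->|/eqP bf].
  by exists 1; rewrite mul1r subrr; apply: ideal_like0.
by exists 0; rewrite mul0r subr0; apply: ideal_gen_mem.
Qed.

End OneGenerator.
End OneBasis.

Lemma count_by_degree I B (Q' : pred S) : standard_basis I B -> exists N0, forall N, (N0 <= N)%N ->
  count Q' B = \sum_(d < N) count (fun f => (f \is d.-homog) && Q' f) B.
Proof.
move=> hB.
have [N0 hN0] : exists N0, forall f, f \in B -> exists2 d, (d < N0)%N & f \is d.-homog.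
  have : forall f, f \in B -> exists d, f \is d.-homog by apply: std_homog hB.
  elim: (B) => [|f s IH] hs; first by exists 0%N.
  have [|N0 hN] := IH; first by move=> g gs; apply: hs; rewrite inE gs orbT.
  have [d hf] := hs f (mem_head _ _); exists (maxn N0 d.+1) => g.
  rewrite inE => /orP [/eqP ->|/hN [e eN ge]]; first by exists d; rewrite // leq_max ltnSn orbT.
  by exists e; rewrite // leq_max eN.
exists N0 => N N0N.
under eq_bigr => d _ do rewrite -sum1_count.
rewrite (exchange_big_dep Q') /= => [|d f _ /andP [] //].
rewrite -sum1_count big_seq_cond [RHS]big_seq_cond; apply: eq_bigr => f /andP [fB Qf].
have [d dN fd] := hN0 f fB; have dN' := leq_trans dN N0N.
rewrite (bigD1 (Ordinal dN')) /= ?fd ?Qf // big1 // => e /andP [/andP [fe _] /eqP ne].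
by case: ne; apply: val_inj; rewrite /= (std_homog_uniq hB fB fe fd).
Qed.

(** In a monomial of degree greater than n * N some exponent is at least N. *)
Lemma ideal_pow_irrelevant Q N : ideal_like Q -> (forall i, Q ('X_i ^+ N)) ->
  exists t, forall g, ideal_pow (@irrelevant K n) t g -> Q g.
Proof.
move=> hQ QX.
pose T t := ideal_gen (fun g : S => exists2 m, mdeg m = t & g = 'X_[m]).
have hT t : ideal_like (T t) by apply: ideal_gen_ideal.
have TM t f g : irrelevant f -> T t g -> T t.+1 (f * g).
  move=> hf hg; have hTf := ideal_like_colon (hT t.+1).
  have : ideal_like (fun f => T t.+1 (f * g)).
    by case: (hTf g) => h0 hD hM; split=> [|a b|a b];
      rewrite -?[_ * g]mulrC // ; [move/hD => h /h | move/hM].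
  move=> /ideal_gen_min; apply; last exact: hf.
  move=> _ [i ->]; apply: (ideal_gen_min (hTf 'X_i)) hg => _ [m mt ->].
  by apply: ideal_gen_mem; exists (U_(i) + m)%MM; rewrite ?mdegD ?mdeg1 ?mt // mpolyXD.
have Tprod (s : seq S) : (forall u, u \in s -> irrelevant u) -> T (size s) (\prod_(u <- s) u).
  elim: s => [|u s IH] hs.
    by rewrite big_nil; apply: ideal_gen_mem; exists 0%MM; rewrite ?mdeg0 ?mpolyX0.
  rewrite big_cons; apply: TM; first by apply: hs; rewrite mem_head.
  by apply: IH => v vs; apply: hs; rewrite inE vs orbT.
exists (n * N).+1 => g hg.
have {hg} : T (n * N).+1 g.
  apply: (ideal_gen_min (hT _)) hg => _ [s hs ->].
  by rewrite -{1}(size_tuple s); apply: Tprod.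
apply: ideal_gen_min => // _ [m mN ->].
have [i Ni] : exists i, (N <= m i)%N.
  apply: contrapT => H; have : (mdeg m <= n * N)%N; last by rewrite mN ltnn.
  rewrite mdegE -[X in (X * _)%N]card_ord -sum_nat_const; apply: leq_sum => i _.
  by case: leqP => // /ltnW Ni; case: H; exists i.
have -> : m = ((U_(i) *+ N) + (m - U_(i) *+ N))%MM.
  rewrite addmC submK //; apply/mnm_lepP => j; rewrite mulmnE mnm1E.
  by case: eqP => // <-; rewrite mul1n.
by rewrite mpolyXD -mpolyXn; apply: ideal_likeMr.
Qed.

Lemma inessentialI B f N :
  (forall i, ideal_gen (fun b => b \in B /\ b <> f) (f * 'X_i ^+ N)) -> inessential B f.
Proof.
have hJ := ideal_like_colon (ideal_gen_ideal (fun b => b \in B /\ b <> f)) f.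
exact: ideal_pow_irrelevant hJ.
Qed.

Lemma essentialI B f u : irrelevant u ->
  (forall t, ~ ideal_gen (fun b => b \in B /\ b <> f) (f * u ^+ t)) -> essential B f.
Proof.
move=> hu H [t ht]; apply: (H t); apply: ht; apply: ideal_gen_mem.
exists (nseq_tuple t u); first by move=> w /nseqP [-> _].
by rewrite big_nseq iter_mulr_1.
Qed.

(** No product of f by a power of a variable which is nonzero at v vanishes at v. *)
Lemma essential_point B f d (v : 'I_n -> K) : f \is d.+1.-homog -> f.@[v] != 0 ->
  (forall b, b \in B -> b != f -> b.@[v] = 0) -> essential B f.
Proof.
move=> hf fv Bv; have [i vi] : exists i, v i != 0.
  apply: contrapT => H; case/eqP: fv; rewrite -(dhomog_eval0 hf); apply: meval_eq => i.
  by apply/eqP/negPn/negP => vi; apply: H; exists i.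
apply: (@essentialI _ _ 'X_i); first by apply: ideal_gen_mem; exists i.
move=> t [s hs /(congr1 (meval v))]; rewrite rmorphM rmorphXn /= mevalXU => /eqP.
rewrite raddf_sum big_seq big1 ?mulf_eq0 ?expf_eq0 ?(negPf fv) ?(negPf vi) ?andbF //=.
by move=> w /hs [wB /eqP wf]; rewrite rmorphM /= Bv // mul0r.
Qed.

Lemma alpha_lt I a f d : alpha I a -> f \in I -> f \is d.-homog -> (d < a)%N -> f = 0.
Proof.
move=> [B hB [_ Ba]] fI fd da.
have h0 : ideal_like (fun f : S => f = 0).
  by split=> [|_ _ -> ->|_ b ->] //; rewrite ?addr0 ?mul0r.
apply: (std_lower hB h0 _ da fI fd) => b e bB be /(leq_trans).
by move=> /(_ _ (Ba b e bB be)); rewrite ltnn.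
Qed.

Lemma alpha_uniq I a b : alpha I a -> alpha I b -> a = b.
Proof.
suff H x y : alpha I x -> alpha I y -> (y <= x)%N.
  by move=> ha hb; apply/eqP; rewrite eqn_leq (H a b) ?(H b a).
move=> [B hB [[f fB fx] _]] hy; rewrite leqNgt; apply/negP => xy.
by have := std_neq0 hB fB; rewrite (alpha_lt hy (std_mem hB fB) fx xy) eqxx.
Qed.

End StandardBasisTheory.

(** * The lifted generators in three variables *)

Section LiftedGenerators.
Variables (K : closedFieldType) (a b a' b' : K) (c : nat -> nat).
Hypothesis (hab : a * a' + b * b' = 1) (c_gt0 : forall j, (0 < c j.+1)%N).
Local Notation S := {mpoly K[3]}.
Implicit Types (f : S) (h r : nat -> S).

Let i1 : 'I_3 := lift ord0 ord0.

(** The hypothesis a a' + b b' = 1 makes (x, y) a basis of the linear forms in the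
    first two variables. *)
Definition linx : S := a *: 'X_ord0 + b *: 'X_i1.
Definition liny : S := - b' *: 'X_ord0 + a' *: 'X_i1.
Definition linz : S := 'X_ord_max.
Local Notation x := linx.
Local Notation y := liny.
Local Notation z := linz.

Lemma ord3_cases (P : 'I_3 -> Prop) : P ord0 -> P i1 -> P ord_max -> forall i, P i.
Proof.
move=> P0 P1 P2 [[|[|[|//]]] hi].
- by rewrite (_ : Ordinal hi = ord0) //; apply: val_inj.
- by rewrite (_ : Ordinal hi = i1) //; apply: val_inj.
- by rewrite (_ : Ordinal hi = ord_max) //; apply: val_inj.
Qed.

Lemma X0E : 'X_ord0 = a' *: x - b *: y.
Proof.
rewrite /x /y !scalerDr !scalerA opprD addrACA -!scaleNr -!scalerDl mulrN opprK.
by rewrite [a' * a]mulrC hab mulrC subrr scale0r addr0 scale1r.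
Qed.

Lemma X1E : 'X_i1 = b' *: x + a *: y.
Proof.
rewrite /x /y !scalerDr !scalerA addrACA -!scalerDl mulrN.
by rewrite [b' * a]mulrC subrr scale0r add0r [b' * b]mulrC addrC hab scale1r.
Qed.

Lemma linx_homog : x \is 1.-homog.
Proof. by apply: dhomogD; apply: dhomogZ; apply: dhomogXU. Qed.

Lemma liny_homog : y \is 1.-homog.
Proof. by apply: dhomogD; apply: dhomogZ; apply: dhomogXU. Qed.

Lemma linz_homog : z \is 1.-homog. Proof. exact: dhomogXU. Qed.

Definition kill_x : S -> S := comp_mpoly [tuple - b *: y; a *: y; z].
Definition kill_z : S -> S := comp_mpoly [tuple 'X_ord0; 'X_i1; 0].
HB.instance Definition _ := GRing.RMorphism.on kill_x.
HB.instance Definition _ := GRing.RMorphism.on kill_z.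

Lemma kill_xZ (k : K) f : kill_x (k *: f) = k *: kill_x f.
Proof. exact: comp_mpolyZ. Qed.

Lemma kill_zZ (k : K) f : kill_z (k *: f) = k *: kill_z f.
Proof. exact: comp_mpolyZ. Qed.

Lemma kill_x_x : kill_x x = 0.
Proof.
rewrite rmorphD /= !kill_xZ /kill_x !comp_mpolyXU /= !scalerA -scalerDl.
by rewrite mulrN mulrC addNr scale0r.
Qed.

Lemma kill_x_y : kill_x y = y.
Proof.
rewrite {1}/y rmorphD /= !kill_xZ /kill_x !comp_mpolyXU /= !scalerA -scalerDl.
by rewrite mulrNN addrC [a' * a]mulrC [b' * b]mulrC hab scale1r.
Qed.

Lemma kill_x_z : kill_x z = z.
Proof. by rewrite {1}/z /kill_x comp_mpolyXU. Qed.

Lemma kill_z_z : kill_z z = 0.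
Proof. by rewrite /z /kill_z comp_mpolyXU. Qed.

Lemma kill_z_y : kill_z y = y.
Proof. by rewrite {1}/y rmorphD /= !kill_zZ /kill_z !comp_mpolyXU. Qed.

Lemma kill_x_congr f : exists s, f - kill_x f = x * s.
Proof.
apply: comp_mpoly_congr; apply: ord3_cases; rewrite (tnth_nth 0) /=.
- by exists a'%:MP; rewrite mulrC mul_mpolyC X0E scaleNr opprK subrK.
- by exists b'%:MP; rewrite mulrC mul_mpolyC X1E addrK.
- by exists 0; rewrite subrr mulr0.
Qed.

Lemma kill_x_eq0 f : kill_x f = 0 -> exists s, f = x * s.
Proof. by have [s] := kill_x_congr f => + e; rewrite e subr0; exists s. Qed.

Lemma kill_z_eq0 f : kill_z f = 0 -> exists s, f = z * s.
Proof.
suff [s] : exists s, f - kill_z f = z * s by move=> + e; rewrite e subr0; exists s.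
apply: comp_mpoly_congr; apply: ord3_cases; rewrite (tnth_nth 0) /=.
- by exists 0; rewrite subrr mulr0.
- by exists 0; rewrite subrr mulr0.
- by exists 1; rewrite subr0 mulr1.
Qed.

(** The three coordinate points of the system (x, y, z). *)
Definition point (u v w : K) : 'I_3 -> K := tnth [tuple u; v; w].
Definition pointx := point a' b' 0.
Definition pointy := point (- b) a 0.
Definition pointz := point 0 0 1.

Lemma eval_pointx : (x.@[pointx] = 1) * (y.@[pointx] = 0) * (z.@[pointx] = 0).
Proof.
split; first split.
- by rewrite mevalD !mevalZ !mevalXU /pointx /point !(tnth_nth 0) /= hab.
- by rewrite mevalD !mevalZ !mevalXU /pointx /point !(tnth_nth 0) /= mulNr mulrC addNr.
- by rewrite mevalXU /pointx /point (tnth_nth 0).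
Qed.

Lemma eval_pointy : (x.@[pointy] = 0) * (y.@[pointy] = 1) * (z.@[pointy] = 0).
Proof.
split; first split.
- by rewrite mevalD !mevalZ !mevalXU /pointy /point !(tnth_nth 0) /= mulrN mulrC addNr.
- by rewrite mevalD !mevalZ !mevalXU /pointy /point !(tnth_nth 0) /= mulrNN addrC [a' * a]mulrC [b' * b]mulrC hab.
- by rewrite mevalXU /pointy /point (tnth_nth 0).
Qed.

Lemma eval_pointz : (x.@[pointz] = 0) * (y.@[pointz] = 0) * (z.@[pointz] = 1).
Proof.
split; first split.
- by rewrite mevalD !mevalZ !mevalXU /pointz /point !(tnth_nth 0) /= !mulr0 addr0.
- by rewrite mevalD !mevalZ !mevalXU /pointz /point !(tnth_nth 0) /= !mulr0 addr0.
- by rewrite mevalXU /pointz /point (tnth_nth 0).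
Qed.

Lemma eval_0 : (x.@[fun=> 0] = 0) * (y.@[fun=> 0] = 0) * (z.@[fun=> 0] = 0).
Proof.
split; first split.
- exact: dhomog_eval0 linx_homog.
- exact: dhomog_eval0 liny_homog.
- exact: dhomog_eval0 linz_homog.
Qed.

Lemma linx_neq0 : x != 0.
Proof. by apply/eqP => /(congr1 (meval pointx)) /eqP; rewrite eval_pointx meval0 oner_eq0. Qed.

Lemma liny_neq0 : y != 0.
Proof. by apply/eqP => /(congr1 (meval pointy)) /eqP; rewrite eval_pointy meval0 oner_eq0. Qed.

Lemma linz_neq0 : z != 0.
Proof. by rewrite /z -msupp_eq0 msuppX. Qed.

(** The exponents of z are forced by homogeneity in the recursion below. *)
Definition zexp j : nat := (c j + c j.-1).-1.

(** Continuants: the polynomials x^(k-j) * contin j, for j <= k, are up to sign the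
    maximal minors of the k x (k+1) matrix with three diagonals whose i-th row
    consists of z^(zexp i), y^(c i) and x. *)
Fixpoint contin j : S :=
  match j with
  | 0 => 1
  | j1.+1 => match j1 with
            | 0 => y ^+ c 1
            | j2.+1 => y ^+ c j * contin j1 + x * z ^+ zexp j * contin j2
            end
  end.

Arguments contin : simpl never.

Lemma continSS j :
  contin j.+2 = y ^+ c j.+2 * contin j.+1 + x * z ^+ zexp j.+2 * contin j.
Proof. by []. Qed.

Definition csum j : nat := \sum_(i < j) c i.+1.

Lemma csumS j : csum j.+1 = (csum j + c j.+1)%N.
Proof. by rewrite /csum big_ord_recr. Qed.

Lemma csum0 : csum 0 = 0%N. Proof. exact: big_ord0. Qed.

Lemma zexp_gt0 j : (0 < zexp j.+2)%N.
Proof. by rewrite /zexp /=; have := c_gt0 j.+1; have := c_gt0 j; lia. Qed.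

Lemma nat_ind2 (P : nat -> Prop) :
  P 0 -> P 1 -> (forall j, P j -> P j.+1 -> P j.+2) -> forall j, P j.
Proof.
move=> P0 P1 PS j; suff [] : P j /\ P j.+1 by [].
by elim: j => [|j [Pj Pj1]]; split=> //; apply: PS.
Qed.

Lemma contin_homog j : contin j \is (csum j).-homog.
Proof.
elim/nat_ind2: j => [||j h0 h1].
- by rewrite csum0; apply: dhomog1.
- by rewrite csumS csum0 add0n; apply: dhomog1X liny_homog.
- rewrite continSS; apply: dhomogD.
    by rewrite csumS addnC; apply: dhomogM h1; apply: dhomog1X liny_homog.
  have -> : csum j.+2 = (1 + zexp j.+2 + csum j)%N.
    by rewrite !csumS /zexp /=; have := c_gt0 j.+1; lia.
  by apply: dhomogM h0; apply: dhomogM linx_homog _; apply: dhomog1X linz_homog.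
Qed.

Lemma kill_x_contin j : kill_x (contin j) = y ^+ csum j.
Proof.
elim/nat_ind2: j => [||j h0 h1].
- by rewrite rmorph1 csum0.
- by rewrite rmorphXn /= kill_x_y csumS csum0.
- rewrite continSS rmorphD !rmorphM !rmorphXn /= kill_x_x !mul0r addr0 kill_x_y h1.
  by rewrite -exprD addnC -csumS.
Qed.

Definition gener k j : S := x ^+ (k - j) * contin j.

Arguments gener : simpl never.

Lemma gener_homog k j : gener k j \is (k - j + csum j).-homog.
Proof. by apply: dhomogM (contin_homog j); apply: dhomog1X linx_homog. Qed.

Lemma generS k j : (j <= k)%N -> gener k.+1 j = x * gener k j.
Proof. by move=> jk; rewrite /gener subSn // exprS mulrA. Qed.

Lemma gener_last k : gener k k = contin k.
Proof. by rewrite /gener subnn mul1r. Qed.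

Lemma gener_rel1 k : (0 < k)%N -> x * gener k 1 = y ^+ c 1 * gener k 0.
Proof. by move=> k0; rewrite /gener mulrA -exprS subn1 prednK // subn0 mulr1 mulrC. Qed.

Lemma gener_rel k j : (j.+2 <= k)%N ->
  x * gener k j.+2 = y ^+ c j.+2 * gener k j.+1 + z ^+ zexp j.+2 * gener k j.
Proof.
move=> jk; rewrite /gener continSS.
have -> : (k - j.+1 = (k - j.+2).+1)%N by lia.
have -> : (k - j = (k - j.+2).+2)%N by lia.
by rewrite !exprS; ring.
Qed.

(** All syzygies come from the relations between three consecutive generators.
    Modulo x every generator but the last vanishes and the last one becomes a power
    of y, so the last coordinate of a syzygy is a multiple of x; subtracting this
    multiple of the last relation leaves a syzygy of the other generators, all of
    which are divisible by x. *)
Lemma gener_syzygy k h : \sum_(j < k.+1) h j * gener k j = 0 ->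
  exists r, [/\ r 0 = 0, forall j, (k < j)%N -> r j = 0 &
    forall j, (j <= k)%N ->
      h j = x * r j - y ^+ c j.+1 * r j.+1 - z ^+ zexp j.+2 * r j.+2].
Proof.
elim: k h => [|k IH] h.
  rewrite big_ord1 /gener mul1r mulr1 => h0; exists (fun=> 0); split=> // j.
  by rewrite leqn0 => /eqP ->; rewrite h0 !mulr0 !subr0.
rewrite big_ord_recr /= gener_last => E.
have [t ht] : exists t, h k.+1 = x * t.
  apply: kill_x_eq0; have := congr1 kill_x E; rewrite rmorphD raddf_sum /= big1.
    rewrite add0r rmorphM /= kill_x_contin rmorph0 => /eqP.
    by rewrite mulf_eq0 expf_eq0 (negPf liny_neq0) andbF orbF => /eqP.
  by move=> j _; rewrite (generS (leq_ord j)) !rmorphM /= kill_x_x mul0r mulr0.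
(* The coordinates left after eliminating the last generator. *)
pose h' j := h j + (if j == k then y ^+ c k.+1 * t else
  if j.+1 == k then z ^+ zexp k.+1 * t else 0).
have {}E : \sum_(j < k.+1) h' j * gener k j = 0.
  rewrite /h'.
  apply: (mulfI linx_neq0); rewrite mulr0 -[RHS]E mulr_sumr.
  under [LHS]eq_bigr => j _ do rewrite mulrCA -(generS (leq_ord j)) mulrDl.
  rewrite big_split /=; congr (_ + _).
  have -> : h k.+1 * contin k.+1 = t * (x * gener k.+1 k.+1).
    by rewrite ht gener_last; ring.
  case: k {IH E ht h h'} => [|k]; first by rewrite gener_rel1 // big_ord1 /=; ring.
  rewrite gener_rel // !big_ord_recr /= !eqxx ltn_eqF // big1 => [|i _]; first by ring.
  by rewrite eqSS !ltn_eqF ?mul0r // ltnW // ltnS ltn_ord.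
have [r [r0 rk hr]] := IH _ E.
exists (fun j => if j == k.+1 then t else r j); split=> //.
  by move=> j kj; rewrite gtn_eqF // rk // ltnW.
rewrite /h' in hr; move=> j; rewrite leq_eqVlt => /orP [/eqP ->|].
  rewrite eqxx ht; have -> : (k.+2 == k.+1) = false by lia.
  have -> : (k.+3 == k.+1) = false by lia.
  by rewrite !rk ?mulr0 ?subr0 //; lia.
rewrite ltnS => jk; have := hr j jk; rewrite [j == k.+1]ltn_eqF // !eqSS.
case: (ltngtP j k) jk => // [jk _|-> _]; last first.
  have -> : (k.+1 == k) = false by lia.
  rewrite (rk k.+1) // (rk k.+2) ?mulr0 ?subr0; last by lia.
  by move=> e; apply/eqP; rewrite -(inj_eq (addIr (y ^+ c k.+1 * t))) e; apply/eqP; ring.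
case: eqP => [jk1|_]; last by rewrite addr0.
rewrite -jk1 (rk j.+2) ?mulr0 ?subr0; last by lia.
by move=> e; rewrite -[h j](addrK (z ^+ zexp j.+2 * t)) e; ring.
Qed.

(** * The lifted ideal *)

Definition lifted k (f : S) : Prop := exists h : nat -> S, f = \sum_(j < k.+1) h j * gener k j.

Lemma lifted_ideal k : ideal_like (lifted k).
Proof.
split.
- by exists (fun=> 0); rewrite big1 // => j _; rewrite mul0r.
- move=> _ _ [h ->] [h' ->]; exists (fun j => h j + h' j).
  by rewrite -big_split /=; apply: eq_bigr => j _; rewrite mulrDl.
- move=> _ u [h ->]; exists (fun j => h j * u).
  by rewrite mulr_suml; apply: eq_bigr => j _; rewrite mulrAC.
Qed.

Lemma liftedS k (f : S) : lifted k.+1 f <->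
  exists u q : S, lifted k u /\ f = x * u + q * contin k.+1.
Proof.
split=> [[h ->]|[u [q [[h ->] ->]]]].
  exists (\sum_(j < k.+1) h j * gener k j), (h k.+1); split; first by exists h.
  rewrite big_ord_recr /= gener_last mulr_sumr; congr (_ + _); apply: eq_bigr => j _.
  by rewrite (generS (leq_ord j)) mulrCA.
exists (fun j => if j == k.+1 then q else h j).
rewrite [RHS]big_ord_recr /= eqxx gener_last mulr_sumr; congr (_ + _); apply: eq_bigr => j _.
by rewrite (ltn_eqF (ltn_ord j)) (generS (leq_ord j)) mulrCA.
Qed.

(** In an equation z f = x u + q p, with p the last generator, killing x and then z
    shows that q lies in (x, z); as x p lies in x times the ideal of the previous
    generators, f is a multiple of p plus x f' with z f' in that ideal. *)
Lemma lifted_nzd k (f : S) : lifted k (z * f) -> lifted k f.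
Proof.
elim: k f => [|k IH] f.
  by move=> _; exists (fun=> f); rewrite big_ord1 /gener /= mul1r mulr1.
move=> /liftedS [u [q [uI E]]].
have [q1 [q2 qE]] : exists q1 q2, q = z * q1 + x * q2.
  have /(kill_z_eq0) [q1 hq1] : kill_z (kill_x q) = 0.
    have := congr1 (kill_z \o kill_x) E.
    rewrite /= !rmorphD !rmorphM /= kill_x_z kill_x_x // kill_x_contin //.
    rewrite rmorph0 rmorphXn /= kill_z_z kill_z_y !mul0r add0r => /esym/eqP.
    by rewrite mulf_eq0 expf_eq0 (negPf liny_neq0) andbF orbF => /eqP.
  have [q2 hq2] := kill_x_congr q; exists q1, q2.
  by rewrite -hq1 -hq2 addrC subrK.
have [u' hu' E'] : exists2 u', lifted k u' & z * (f - q1 * contin k.+1) = x * u'.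
  have hJ := lifted_ideal k.
  exists (u + q2 * contin k.+1); last by rewrite mulrBr E qE; ring.
  apply: (ideal_likeD hJ) => //; apply: (ideal_likeMl hJ); case: k {IH E uI hJ} => [|k].
    by exists (fun=> y ^+ c 1); rewrite big_ord1 /gener /= mul1r mulr1.
  exists (fun j => if j == k.+1 then y ^+ c k.+2 else if j == k then z ^+ zexp k.+2 else 0).
  rewrite continSS !big_ord_recr /= !eqxx ltn_eqF // big1 => [|j _]; last first.
    by have := ltn_ord j; case: eqP => [->|_]; [lia | case: eqP => [->|_]; [lia | rewrite mul0r]].
  rewrite add0r gener_last addrC /gener subSn // subnn expr1; ring.
have [f' hf'] : exists f', f - q1 * contin k.+1 = x * f'.
  apply: kill_x_eq0; have := congr1 kill_x E'; rewrite !rmorphM /=.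
  rewrite kill_x_x kill_x_z mul0r => /eqP.
  by rewrite mulf_eq0 (negPf linz_neq0) => /eqP.
have /IH hf'' : lifted k (z * f').
  case: hu' => h hu'; exists h; rewrite -hu'; apply: (mulfI linx_neq0).
  by rewrite -E' hf' mulrCA.
by apply/liftedS; exists f', q1; rewrite -hf' subrK.
Qed.

End LiftedGenerators.

Arguments contin : simpl never.
Arguments gener : simpl never.

(** * The lifted ideal: generators and essential generators *)

Section LiftedIdeal.
Variables (K : closedFieldType) (a b a' b' : K) (c : nat -> nat) (k : nat).
Hypotheses (hab : a * a' + b * b' = 1) (c_gt0 : forall j, (0 < c j.+1)%N).
Hypotheses (c1_gt1 : (1 < c 1)%N) (k_gt2 : (2 < k)%N).
Local Notation S := {mpoly K[3]}.
Local Notation x := (linx a b).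
Local Notation y := (liny a' b').
Local Notation z := (linz K).
Local Notation zexp := (zexp c).
Local Notation gen := (gener a b a' b' c k).
Local Notation lifted := (lifted a b a' b' c k).
Implicit Types (f : S) (h r : nat -> S).

Lemma lifted_gen j : (j <= k)%N -> lifted (gen j).
Proof.
move=> jk; exists (fun i => (i == j)%:R); rewrite (bigD1 (inord j)) //= inordK ?ltnS //.
rewrite eqxx mul1r big1 ?addr0 // => i; rewrite -val_eqE /= inordK ?ltnS // => /negPf ->.
by rewrite mul0r.
Qed.

Definition gdeg j : nat := (k - j + csum c j)%N.

Lemma csum_le i j : (i <= j)%N -> (csum c i + (j - i) <= csum c j)%N.
Proof.
elim: j => [|j IH]; first by rewrite leqn0 => /eqP ->; lia.
rewrite leq_eqVlt => /orP [/eqP -> | ]; first by lia.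
by rewrite ltnS => /[dup] ij /IH; rewrite csumS; have := c_gt0 j; lia.
Qed.

Lemma gdeg_le i j : (i <= j)%N -> (j <= k)%N -> (gdeg i <= gdeg j)%N.
Proof. by move=> ij jk; rewrite /gdeg; have := csum_le ij; lia. Qed.

Lemma gdeg0 : gdeg 0 = k. Proof. by rewrite /gdeg csum0; lia. Qed.

Lemma gdeg_gt j : (0 < j <= k)%N -> (k < gdeg j)%N.
Proof.
move=> /andP [j0 jk]; rewrite /gdeg; have := csum_le j0.
by rewrite csumS csum0; lia.
Qed.

Lemma gen_homog j : gen j \is (gdeg j).-homog.
Proof. exact: gener_homog. Qed.

(** The entries of the syzygy matrix vanish at the origin; this is what makes the
    generators minimal. *)
Lemma syzygy_eval0 h : \sum_(j < k.+1) h j * gen j = 0 ->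
  forall j, (j <= k)%N -> (h j).@[fun=> 0] = 0.
Proof.
move=> /(gener_syzygy hab) [r [_ _ hr]] j /hr ->.
rewrite !rmorphB !rmorphM !rmorphXn /= !(eval_0 a b a' b') !expr0n /=.
by rewrite !gtn_eqF ?c_gt0 ?zexp_gt0 // !mul0r !subr0.
Qed.

Lemma gen_inj i j : (i <= k)%N -> (j <= k)%N -> gen i = gen j -> i = j.
Proof.
move=> ik jk e; apply/eqP; apply: contrapT => /negP /negPf ij.
have : \sum_(l < k.+1) ((l == i :> nat)%:R - (l == j :> nat)%:R) * gen l = 0.
  under eq_bigr => l _ do rewrite mulrBl.
  rewrite sumrB (bigD1 (inord i)) //= (bigD1 (inord j) (F := fun l : 'I_k.+1 => (l == j :> nat)%:R * _)) //=.
  rewrite !inordK ?ltnS // !eqxx !mul1r e !big1 ?addr0 ?subrr // => l.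
    by rewrite -val_eqE /= inordK ?ltnS // => /negPf ->; rewrite mul0r.
  by rewrite -val_eqE /= inordK ?ltnS // => /negPf ->; rewrite mul0r.
move=> /(@syzygy_eval0 (fun l => (l == i)%:R - (l == j)%:R)) /(_ i ik) /eqP.
by rewrite eqxx ij subr0 meval1 oner_eq0.
Qed.

Lemma gen_neq0 j : (j <= k)%N -> gen j != 0.
Proof.
move=> jk; apply/eqP => g0; have [h e] := lifted_gen jk.
have : \sum_(l < k.+1) (l == j :> nat)%:R * gen l = 0.
  rewrite (bigD1 (inord j)) //= inordK ?ltnS // g0 mulr0 add0r big1 // => l.
  by rewrite -val_eqE /= inordK ?ltnS // => /negPf ->; rewrite mul0r.
move=> /(@syzygy_eval0 (fun l => (l == j)%:R)) /(_ j jk) /eqP.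
by rewrite eqxx meval1 oner_eq0.
Qed.

Lemma gen_homogE j d : (j <= k)%N -> (gen j \is d.-homog) = (gdeg j == d).
Proof.
move=> jk; apply/idP/eqP => [|<-]; last exact: gen_homog.
exact: dhomog_uniq (gen_neq0 jk) (gen_homog j).
Qed.

Lemma lifted_N1 : ~ lifted 1.
Proof.
move=> [h /(congr1 (meval (fun=> 0)))]; rewrite rmorph1 raddf_sum big1 => [/eqP|j _].
  by rewrite oner_eq0.
rewrite /= rmorphM /=; have := gen_homog j; have := @gdeg_le 0 j isT; rewrite -ltnS ltn_ord gdeg0.
case: (gdeg j) => [/(_ isT)|d _]; first by rewrite leqNgt (ltnW (ltnW k_gt2)).
by move/dhomog_eval0 ->; rewrite mulr0.
Qed.

Section Ideal.
Variables (I : idealr S) (hI : forall f, f \in I <-> lifted f).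

Lemma gen_mem j : (j <= k)%N -> gen j \in I.
Proof. by move=> /lifted_gen /hI. Qed.

Definition gens : seq S := [seq gen j | j <- iota 0 k.+1].

Lemma gensP f : reflect (exists2 j, (j <= k)%N & f = gen j) (f \in gens).
Proof.
apply: (iffP mapP) => [[j]|[j jk ->]]; first by rewrite mem_iota ltnS => jk ->; exists j.
by exists j; rewrite ?mem_iota ?ltnS.
Qed.

Lemma big_gens (P : pred S) (F : S -> S) :
  \sum_(f <- gens | P f) F f = \sum_(j < k.+1 | P (gen j)) F (gen j).
Proof.
rewrite big_map; have -> : iota 0 k.+1 = index_iota 0 k.+1 by rewrite /index_iota subn0.
exact: big_mkord.
Qed.

Lemma gens_uniq : uniq gens.
Proof.
rewrite map_inj_in_uniq ?iota_uniq // => i j; rewrite !mem_iota !ltnS => ik jk.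
exact: gen_inj.
Qed.

Lemma pihomog_lifted h d :
  pihomog mdeg d (\sum_(j < k.+1) h j * gen j) =
  \sum_(j < k.+1 | (gdeg j <= d)%N) pihomog mdeg (d - gdeg j) (h j) * gen j.
Proof.
rewrite linear_sum [RHS]big_mkcond; apply: eq_bigr => j _.
case: leqP => jd; last by rewrite mulrC; apply: pihomogMl_lt jd; apply: gen_homog.
by rewrite mulrC [RHS]mulrC -{1}(subnKC jd); apply: pihomogMl; apply: gen_homog.
Qed.

Lemma lifted_homogeneous : homogeneous I.
Proof.
move=> f d /hI [h ->]; rewrite pihomog_lifted rpred_sum // => j _.
by rewrite idealMr // gen_mem // -ltnS.
Qed.

Lemma gens_index : exists ind : S -> nat, forall j, (j <= k)%N -> ind (gen j) = j.
Proof.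
exists (index^~ gens) => j jk.
have h : (j < size gens)%N by rewrite size_map size_iota ltnS.
have -> : gen j = nth 0 gens j by rewrite (nth_map 0%N) ?nth_iota // ?size_iota ltnS.
by rewrite index_uniq ?gens_uniq.
Qed.

Lemma gens_standard : standard_basis I gens.
Proof.
split.
- exact: gens_uniq.
- by move=> f /gensP [j _ ->]; exists (gdeg j); apply: gen_homog.
- move=> f; split=> [/hI [h ->]|].
    apply: (ideal_like_sum (ideal_gen_ideal _)) => j _.
    apply: (ideal_likeMl (ideal_gen_ideal _)).
    by apply: ideal_gen_mem; apply/gensP; exists j; rewrite // -ltnS.
  apply: (ideal_gen_min (idealr_ideal_like I)).
  by move=> g /gensP [j jk ->]; apply: gen_mem.
- move=> d g /hI [h gE] hg; have [ind indE] := gens_index.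
  exists (fun f => (pihomog mdeg 0 (h (ind f)))@_0).
  rewrite big_gens -(pihomog_dE hg) gE pihomog_lifted.
  rewrite (bigID (fun j : 'I_k.+1 => gen j \is d.-homog)) /= addrAC.
  apply: prev_part_S1D; last first.
    apply: prev_part_S1_sum => j _ /andP [jd]; rewrite (gen_homogE _ (leq_ord j)) => nj.
    rewrite mulrC -{1}(subnKC jd); apply: prev_part_S1M (gen_homog j) (pihomogP _ _ _) _.
      by rewrite gen_mem // -ltnS.
    by rewrite subn_gt0 ltn_neqAle nj.
  rewrite (eq_bigl (fun j : 'I_k.+1 => gen j \is d.-homog)) => [|j]; last first.
    by rewrite (gen_homogE _ (leq_ord j)); case: eqP => [->|]; rewrite ?leqnn ?andbF.
  rewrite -sumrB big1 => [|j hj]; first exact: prev_part_S1_0.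
  rewrite (indE _ (leq_ord j)); move: hj; rewrite (gen_homogE _ (leq_ord j)) => /eqP ->.
  rewrite subnn; have [e ->] := dhomog0_const (pihomogP mdeg 0 (h j)).
  by rewrite mcoeffC eqxx mulr1 mul_mpolyC subrr.
- move=> d e he f /gensP [j jk ->]; rewrite gen_homogE // => jd.
  have [h h0 {}he] : exists2 h, (forall i, (i <= k)%N -> (h i).@[fun=> 0] = 0) &
      \sum_(f <- gens | f \is d.-homog) e f *: f = \sum_(i < k.+1) h i * gen i.
    have hQ : ideal_like (fun f => exists2 h, (forall i, (i <= k)%N -> (h i).@[fun=> 0] = 0) &
      f = \sum_(i < k.+1) h i * gen i).
      split.
      - exists (fun=> 0); first by move=> i _; rewrite meval0.
        by rewrite big1 // => i _; rewrite mul0r.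
      - move=> _ _ [h h0 ->] [h' h0' ->]; exists (fun i => h i + h' i).
          by move=> i ik; rewrite mevalD h0 // h0' // addr0.
        by rewrite -big_split /=; apply: eq_bigr => i _; rewrite mulrDl.
      - move=> _ u [h h0 ->]; exists (fun i => h i * u).
          by move=> i ik; rewrite mevalM h0 // mul0r.
        by rewrite mulr_suml; apply: eq_bigr => i _; rewrite mulrAC.
    case: he => s hs ->; apply: (ideal_like_sum_seq hQ) => w /hs [[/hI [h ->] _] w1] _.
    exists (fun i => h i * w.2); first by move=> i _; rewrite mevalM (dhomog_eval0 w1) mulr0.
    by rewrite mulr_suml; apply: eq_bigr => i _; rewrite mulrAC.
  have : \sum_(i < k.+1) ((if gdeg i == d then (e (gen i))%:MP else 0) - h i) * gen i = 0.
    apply/eqP; under eq_bigr => i _ do rewrite mulrBl.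
    rewrite sumrB -he big_gens subr_eq0 [X in _ == X]big_mkcond /=; apply/eqP.
    apply: eq_bigr => i _; rewrite (gen_homogE _ (leq_ord i)); case: ifP => _; rewrite ?mul0r //.
    by rewrite mul_mpolyC.
  move=> /(@syzygy_eval0 (fun i => (if gdeg i == d then (e (gen i))%:MP else 0) - h i)).
  by move=> /(_ j jk); rewrite jd mevalB mevalC h0 // subr0.
Qed.

Lemma lifted_alpha : alpha I k.
Proof.
exists gens; first exact: gens_standard.
split; first by exists (gen 0); [apply/gensP; exists 0%N | rewrite gen_homogE // gdeg0].
move=> f d /gensP [j jk ->]; rewrite gen_homogE // => /eqP <-.
by rewrite -{1}gdeg0; apply: gdeg_le.
Qed.

Lemma lifted_nu : nu I k.+1.
Proof. by exists gens; [apply: gens_standard | rewrite size_map size_iota]. Qed.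

Lemma lifted_nzd_quot :
  GRing.lreg (\pi_({ideal_quot I})%qT ('X_ord_max : {mpoly K[3]})).
Proof.
move=> u v; rewrite -[u]reprK -[v]reprK -!rmorphM /= => /eqP.
rewrite -Quotient.idealrBE -mulrBr => /hI /(lifted_nzd hab) /hI.
by rewrite Quotient.idealrBE => /eqP.
Qed.

(** Let J be the ideal generated by the other basis elements, and g_j the first
    generator with a nonzero coordinate on f. Modulo J the previous generators
    vanish and the next ones are multiples of f, so the three relations involving
    g_j show that x, a power of y, and then a power of z send f into J. The third
    relation exists because g_j is not one of the last two generators, and the
    first one reads x g_j = 0 because g_j is not the first generator. *)
Lemma middle_inessential B f d (kappa : nat -> K) :
  standard_basis I B -> f \in B -> f \is d.-homog ->
  (forall i, (i <= k)%N -> gdeg i = d ->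
     ideal_gen (fun w => w \in B /\ w <> f) (gen i - kappa i *: f)) ->
  (exists j, [/\ (0 < j)%N, (j.+2 <= k)%N, gdeg j = d & kappa j != 0]) ->
  inessential B f.
Proof.
move=> hB fB hf hkappa [j0 hj0].
pose P j := [&& (0 < j)%N, (j.+2 <= k)%N, gdeg j == d & kappa j != 0].
have exP : exists j, P j by exists j0; rewrite /P; case: hj0 => -> -> -> ->; rewrite eqxx.
case: (ex_minnP exP) => j /and4P [j_gt0 jk /eqP jd kj] jmin.
set J := ideal_gen _ in hkappa; have hJ : ideal_like J by apply: ideal_gen_ideal.
have genJ i : (i < j)%N -> J (gen i).
  move=> ij; have ik : (i <= k)%N by lia.
  case: (ltngtP (gdeg i) d) => id.
  - exact: (others_lower hB fB hf id (gen_mem ik) (gen_homog i)).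
  - by have := gdeg_le (ltnW ij) (ltnW (ltnW jk)); rewrite jd leqNgt id.
  - case: i ij ik id => [|i] ij ik id.
      by have := @gdeg_gt j ltac:(lia); rewrite jd -id gdeg0 ltnn.
    have /eqP ki : kappa i.+1 == 0.
      apply: contraT => ki; have := jmin i.+1; rewrite /P id eqxx ki andbT.
      by rewrite (ltac:(lia) : (i.+3 <= k)%N) => /(_ isT); lia.
    by have := hkappa _ ik id; rewrite ki scale0r subr0.
have kk : (kappa j)^-1%:MP * (kappa j)%:MP = 1 :> S by rewrite -rmorphM /= mulVf // rmorph1.
have Jf u : J (u * gen j) -> J (f * u).
  have := hkappa j ltac:(lia) jd => /(ideal_likeMr hJ u) H0 H1.
  have : J ((kappa j)%:MP * (f * u)).
    have -> : (kappa j)%:MP * (f * u) = u * gen j - (gen j - kappa j *: f) * u.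
      by rewrite -mul_mpolyC; ring.
    exact: ideal_likeB.
  move=> /(ideal_likeMl hJ (kappa j)^-1%:MP).
  by rewrite [X in J X]mulrA kk mul1r.
have Jx : J (f * x).
  apply: Jf; case: j {jd kj jmin kk} j_gt0 jk genJ => // -[|j] _ jk genJ.
    by rewrite gener_rel1 ?(ltnW (ltnW k_gt2)) //; apply: ideal_likeMl => //; apply: genJ.
  rewrite gener_rel; last by lia.
  by apply: ideal_likeD => //; apply: ideal_likeMl => //; apply: genJ; lia.
have [h1 H1] := others_gen hB f (gen_mem (ltac:(lia) : (j.+1 <= k)%N)).
have [h2 H2] := others_gen hB f (gen_mem jk).
have Jxg i w : J (gen i - w * f) -> J (x * gen i).
  move=> H; apply: (ideal_likeBr hJ (g := x * (w * f))).
    by rewrite -mulrBr; apply: ideal_likeMl.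
  by rewrite (_ : x * (w * f) = (f * x) * w); [apply: ideal_likeMr | ring].
have Jy : J (f * y ^+ c j.+1).
  apply: Jf; have := Jxg _ _ H1; case: j {jd kj jmin kk H1 H2 Jx} j_gt0 jk genJ => // j _ jk genJ.
  rewrite gener_rel; last by lia.
  move=> H; rewrite -[X in J X](addrK (z ^+ zexp j.+2 * gen j)).
  by apply: ideal_likeB => //; apply: ideal_likeMl => //; apply: genJ.
(* A power of z sends f into (y) f + J. *)
have [w Jz] : exists w, J (f * (z ^+ zexp j.+2 - y * w)).
  exists (- (y ^+ (c j.+2).-1 * h1 * (kappa j)^-1%:MP)).
  rewrite mulrN opprK mulrDr; have := Jxg _ _ H2; rewrite gener_rel //.
  have cj : y ^+ c j.+2 = y * y ^+ (c j.+2).-1 by rewrite -exprS prednK.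
  have H3 := ideal_likeMl hJ (z ^+ zexp j.+2) (hkappa j ltac:(lia) jd).
  have H4 := ideal_likeMl hJ (y ^+ c j.+2) H1.
  move=> /(ideal_likeB hJ)/(_ H3)/(ideal_likeB hJ)/(_ H4).
  move=> /(ideal_likeMl hJ (kappa j)^-1%:MP); rewrite -mul_mpolyC.
  set w := f * _ + _; suff -> : w = (kappa j)^-1%:MP * (y ^+ c j.+2 * gen j.+1 +
     z ^+ zexp j.+2 * gen j - z ^+ zexp j.+2 * (gen j - (kappa j)%:MP * f) -
     y ^+ c j.+2 * (gen j.+1 - h1 * f)) by [].
  transitivity ((kappa j)^-1%:MP * (kappa j)%:MP * z ^+ zexp j.+2 * f +
     (kappa j)^-1%:MP * y ^+ c j.+2 * h1 * f); last by ring.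
  by rewrite kk /w cj; ring.
have hC := ideal_like_colon hJ f.
have Jz' : J (f * z ^+ (zexp j.+2 * c j.+1)).
  rewrite exprM; apply: (ideal_like_expB hC (g := y * w) Jz).
  by rewrite exprMn mulrA; apply: ideal_likeMr.
have JX0 : J (f * 'X_ord0 ^+ c j.+1).
  apply: (ideal_like_expB hC (g := - (b *: y))).
    rewrite (X0E hab) opprK subrK -mul_mpolyC mulrCA; exact: ideal_likeMl.
  rewrite -scaleNr -mul_mpolyC exprMn mulrCA; exact: ideal_likeMl.
have JX1 : J (f * 'X_(lift ord0 ord0) ^+ c j.+1).
  apply: (ideal_like_expB hC (g := a *: y)).
    rewrite (X1E hab) addrK -mul_mpolyC mulrCA; exact: ideal_likeMl.
  rewrite -mul_mpolyC exprMn mulrCA; exact: ideal_likeMl.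
apply: (@inessentialI _ _ _ _ (c j.+1 + zexp j.+2 * c j.+1)); apply: ord3_cases.
- by apply: (ideal_like_exp_le hC _ JX0); rewrite leq_addr.
- by apply: (ideal_like_exp_le hC _ JX1); rewrite leq_addr.
- by apply: (ideal_like_exp_le hC _ Jz'); rewrite leq_addl.
Qed.

(** The columns of the syzygy matrix whose entries have a common zero in the
    projective plane: the first one and the last two. *)
Definition special : seq nat := [:: 0; k.-1; k].

Lemma special_uniq : uniq special.
Proof. by rewrite /= !inE; lia. Qed.

Lemma specialP j : (j <= k)%N -> j \notin special -> (0 < j)%N /\ (j.+2 <= k)%N.
Proof. by rewrite !inE; lia. Qed.

(** The rows of coordinates of the generators on the essential elements of degree d
    are linearly independent, and by the previous lemma they are supported on the
    special generators of degree d. *)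
Lemma num_essential_deg_le B d : standard_basis I B ->
  (num_essential_deg B d <= count (fun j => gdeg j == d) special)%N.
Proof.
move=> hB; rewrite /num_essential_deg -size_filter -[X in (_ <= X)%N]size_filter.
set E := [seq _ <- B | _]; set Q := [seq _ <- special | _].
have EP f : f \in E -> [/\ f \in B, f \is d.-homog & essential B f].
  by rewrite mem_filter => /andP [/andP [hf /asboolP ef] fB].
have QP j : j \in Q -> (j <= k)%N /\ gdeg j = d.
  by rewrite mem_filter !inE => /andP [/eqP -> /or3P [] /eqP ->]; split=> //; lia.
have [|C hC] := @choice _ _ (fun j (e : S -> K) => (j <= k)%N -> gdeg j = d ->
    prev_part_S1 I d (gen j - \sum_(f <- B | f \is d.-homog) e f *: f)).
  move=> j; case: (boolP ((j <= k)%N && (gdeg j == d))) => [/andP [jk /eqP jd]|nj].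
    have hj := gen_homog j; rewrite jd in hj.
    by have [e he] := std_expand hB (gen_mem jk) hj; exists e.
  by exists (fun=> 0) => jk jd; rewrite jk jd eqxx in nj.
have CE f j : f \in E -> (j <= k)%N -> gdeg j = d -> j \notin special -> C j f = 0.
  move=> /EP [fB hf ef] jk jd /(specialP jk) [j0 j2]; apply/eqP; apply: contrapT => /negP cj.
  apply: ef; apply: (middle_inessential (d := d) (kappa := fun i => C i f)) => //; last by exists j.
  by move=> i ik id; apply: (others_coef hB fB hf); apply: hC.
rewrite leqNgt; apply/negP => QE.
pose A := \matrix_(i < size E, j < size Q) C (nth 0%N Q j) (nth 0 E i).
(* With too many essential elements some combination of their coordinates vanishes
   on all generators, hence on each essential element. *)
have [v vA v0] : exists2 v : 'rV_(size E), v *m A = 0 & v != 0.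
  have /rowV0Pn [v vk v0] : kermx A != 0.
    by rewrite kermx_eq0 /row_free ltn_eqF // (leq_ltn_trans (rank_leq_col A)).
  by exists v; rewrite // (sub_kermxP vk).
have [i0 vi0] : exists i, v 0 i != 0.
  by apply/existsP; apply: contraR v0 => /existsPn H; apply/eqP/rowP => i; rewrite mxE; apply/eqP/negPn/H.
set f0 := nth 0 E i0.
have f0E : f0 \in E by rewrite mem_nth.
have [f0B hf0 _] := EP _ f0E.
have [e he] := std_expand gens_standard (std_mem hB f0B) hf0.
have key f : f \in B -> f \is d.-homog ->
    (f == f0)%:R = \sum_(j < k.+1 | gdeg j == d) e (gen j) * C j f.
  move=> fB hf; apply/eqP; rewrite -subr_eq0; apply/eqP; move: f fB hf.
  apply: (std_indep hB).
  have -> : \sum_(f <- B | f \is d.-homog)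
      ((f == f0)%:R - \sum_(j < k.+1 | gdeg j == d) e (gen j) * C j f) *: f =
    (f0 - \sum_(f <- gens | f \is d.-homog) e f *: f) + \sum_(j < k.+1 | gdeg j == d)
      e (gen j) *: (gen j - \sum_(f <- B | f \is d.-homog) C j f *: f).
    under eq_bigr => f _ do rewrite scalerBl.
    rewrite sumrB.
    have -> : \sum_(f <- B | f \is d.-homog) ((f == f0)%:R : K) *: f = f0.
      rewrite big_mkcond (bigD1_seq f0) ?(std_uniq hB) //= hf0 eqxx scale1r.
      by rewrite big1 ?addr0 // => f /negPf ->; rewrite scale0r if_same.
    have -> : \sum_(f <- gens | f \is d.-homog) e f *: f =
        \sum_(j < k.+1 | gdeg j == d) e (gen j) *: gen j.
      by rewrite big_gens; apply: eq_bigl => j; rewrite (gen_homogE _ (leq_ord j)).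
    under [X in _ = _ + X]eq_bigr => j _ do rewrite scalerBr.
    rewrite sumrB subrKA; congr (_ - _).
    under eq_bigr => f _ do rewrite scaler_suml.
    rewrite exchange_big; apply: eq_bigr => j _ /=; rewrite scaler_sumr.
    by apply: eq_bigr => f _; rewrite scalerA.
  apply: prev_part_S1D => //; apply: prev_part_S1_sum => j _ /eqP jd.
  by apply: prev_part_S1Z; apply: hC => //; rewrite -ltnS.
case/eqP: vi0.
transitivity (\sum_(i < size E) v 0 i * (nth 0 E i == f0)%:R).
  rewrite (bigD1 i0) //= eqxx mulr1 big1 ?addr0 // => i.
  rewrite nth_uniq ?filter_uniq ?(std_uniq hB) //.
  by rewrite -val_eqE /= => /negPf ->; rewrite mulr0.
under eq_bigr => i _ do
  (have [fB hf _] := EP _ (mem_nth 0 (ltn_ord i)); rewrite (key _ fB hf) mulr_sumr).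
rewrite exchange_big big1 //= => j /eqP jd.
have jk : (j <= k)%N by rewrite -ltnS.
case: (boolP ((j : nat) \in Q)) => [/(nthP 0%N) [l lQ lj]|jQ].
  have := congr1 (fun M : 'rV_(size Q) => M 0 (Ordinal lQ)) vA; rewrite !mxE => vl.
  transitivity (e (gen j) * \sum_i v 0 i * A i (Ordinal lQ)); last by rewrite vl mulr0.
  by rewrite mulr_sumr; apply: eq_bigr => i _; rewrite mxE lj mulrCA.
apply: big1 => i _; rewrite CE ?mulr0 ?mem_nth //.
by move: jQ; rewrite mem_filter jd eqxx.
Qed.

Lemma gens_others_syzygy j u : (j <= k)%N ->
  ideal_gen (fun w => w \in gens /\ w <> gen j) (gen j * u) ->
  exists r, [/\ r 0 = 0, forall i, (k < i)%N -> r i = 0 &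
    - u = x * r j - y ^+ c j.+1 * r j.+1 - z ^+ zexp j.+2 * r j.+2].
Proof.
move=> jk hu.
have [h h0 E] : exists2 h, h j = 0 & gen j * u = \sum_(i < k.+1) h i * gen i.
  move: (gen j * u) hu; apply: ideal_gen_min.
    split.
    - by exists (fun=> 0); rewrite // big1 // => i _; rewrite mul0r.
    - move=> _ _ [h h0 ->] [h' h0' ->]; exists (fun i => h i + h' i).
        by rewrite h0 h0' addr0.
      by rewrite -big_split /=; apply: eq_bigr => i _; rewrite mulrDl.
    - move=> _ v [h h0 ->]; exists (fun i => h i * v); first by rewrite h0 mul0r.
      by rewrite mulr_suml; apply: eq_bigr => i _; rewrite mulrAC.
  move=> _ [/gensP [i ik ->] ij]; have {}ij : j != i by apply/eqP => e; apply: ij; rewrite e.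
  exists (fun l => (l == i)%:R); first by rewrite (negPf ij).
  rewrite (bigD1 (inord i)) //= inordK ?ltnS // eqxx mul1r big1 ?addr0 // => l.
  by rewrite -val_eqE /= inordK ?ltnS // => /negPf ->; rewrite mul0r.
have : \sum_(i < k.+1) (h i - (if i == j :> nat then u else 0)) * gen i = 0.
  under eq_bigr => i _ do rewrite mulrBl.
  rewrite sumrB -E (bigD1 (inord j)) //= inordK ?ltnS // eqxx big1 ?addr0 => [|i].
    by rewrite mulrC subrr.
  by rewrite -val_eqE /= inordK ?ltnS // => /negPf ->; rewrite mul0r.
move=> /(@gener_syzygy _ _ _ _ _ c hab k (fun i => h i - (if i == j :> nat then u else 0))).
move=> [r [r0 rk /(_ j jk)]]; rewrite h0 eqxx sub0r => Er.
by exists r.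
Qed.

Lemma linx_irrelevant : irrelevant x.
Proof.
rewrite /linx -!mul_mpolyC; apply: (ideal_likeD (ideal_gen_ideal _));
  apply: (ideal_likeMl (ideal_gen_ideal _)); apply: ideal_gen_mem; by eexists.
Qed.

Lemma liny_irrelevant : irrelevant y.
Proof.
rewrite /liny -!mul_mpolyC; apply: (ideal_likeD (ideal_gen_ideal _));
  apply: (ideal_likeMl (ideal_gen_ideal _)); apply: ideal_gen_mem; by eexists.
Qed.

Lemma linz_irrelevant : irrelevant z.
Proof. by apply: ideal_gen_mem; eexists. Qed.

(** The j-th coordinate of a syzygy lies in the ideal of the entries of the j-th
    column. For a special j one of the three coordinate points is a zero of these
    entries, so no power of the coordinate which is 1 there is such a coordinate. *)
Lemma gens_essential j : (j <= k)%N -> essential gens (gen j) <-> j \in special.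
Proof.
move=> jk; split=> [ess|].
  apply: contrapT => /negP jN; have [j0 j2] := specialP jk jN; apply: ess.
  have gB : gen j \in gens by apply/gensP; exists j.
  apply: (middle_inessential (kappa := fun i => (i == j)%:R) gens_standard gB (gen_homog j)).
    move=> i ik id; case: (eqVneq i j) => [->|ij].
      by rewrite scale1r subrr; apply: (ideal_like0 (ideal_gen_ideal _)).
    rewrite scale0r subr0; apply: ideal_gen_mem; split; first by apply/gensP; exists i.
    by move=> /(gen_inj ik jk) /eqP; rewrite (negPf ij).
  by exists j; split=> //; rewrite eqxx oner_neq0.
rewrite !inE => /or3P [] /eqP jE.
- apply: (essentialI linx_irrelevant) => t /(gens_others_syzygy jk) [r [r0 _]].
  move=> /(congr1 (meval (pointx a' b'))) /eqP; rewrite jE r0 mulr0 sub0r.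
  rewrite !(rmorphB, rmorphN, rmorphM, rmorphXn) /= !(eval_pointx hab) !expr0n.
  by rewrite !gtn_eqF ?zexp_gt0 ?c_gt0 //= !mul0r expr1n subr0 oppr0 oppr_eq0 oner_eq0.
- apply: (essentialI linz_irrelevant) => t /(gens_others_syzygy jk) [r [_ rk]].
  rewrite (rk j.+2); last by rewrite jE; lia.
  move=> /(congr1 (meval (pointz K))) /eqP; rewrite mulr0 subr0.
  rewrite !(rmorphB, rmorphN, rmorphM, rmorphXn) /= !(eval_pointz a b a' b') !expr0n.
  by rewrite !gtn_eqF ?c_gt0 //= !mul0r expr1n subr0 oppr_eq0 oner_eq0.
- apply: (essentialI liny_irrelevant) => t /(gens_others_syzygy jk) [r [_ rk]].
  rewrite (rk j.+1) ?(rk j.+2) ?jE //.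
  move=> /(congr1 (meval (pointy a b))) /eqP; rewrite !mulr0 !subr0.
  rewrite !(rmorphN, rmorphM, rmorphXn) /= !(eval_pointy hab).
  by rewrite mul0r expr1n oppr_eq0 oner_eq0.
Qed.

Lemma gens_count (P : pred nat) :
  count (fun f => `[< exists2 j, (j <= k)%N & f = gen j /\ P j >] && `[< essential gens f >]) gens =
  count P special.
Proof.
rewrite /gens count_map -/gens.
rewrite (eq_in_count (a2 := fun j => P j && (j \in special))) => [|j].
  have /seq.permP <- : perm_eq [seq j <- iota 0 k.+1 | j \in special] special.
    apply: uniq_perm; rewrite ?filter_uniq ?iota_uniq ?special_uniq // => j.
    by rewrite mem_filter mem_iota !inE ltnS; lia.
  by rewrite count_filter.
rewrite mem_iota ltnS /= => jk; congr (_ && _).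
  apply/asboolP/idP => [[i ik [/(gen_inj jk ik) -> //]]|Pj]; by exists j.
by apply/asboolP/idP => /gens_essential; apply.
Qed.

Lemma gens_num_deg d :
  num_essential_deg gens d = count (fun j => gdeg j == d) special.
Proof.
rewrite -gens_count; apply: eq_in_count => f /gensP [j jk ->]; congr (_ && _).
rewrite gen_homogE //; apply/idP/asboolP => [jd|[i ik [/(gen_inj jk ik) ->]] //].
by exists j.
Qed.

Lemma lifted_nu_e : nu_e I 3.
Proof.
exists gens.
  split; first exact: gens_standard.
  move=> d; split; first by exists gens; first exact: gens_standard.
  by move=> B hB; rewrite gens_num_deg; apply: num_essential_deg_le.
transitivity (count predT special); last by rewrite count_predT.
rewrite -gens_count; apply: eq_in_count => f /gensP [j jk ->].
rewrite (_ : `[< exists2 _, _ & _ >] = true) //.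
by apply/asboolP; exists j.
Qed.

End Ideal.
End LiftedIdeal.

(** * Projective dimension *)

Section FreeModules.
Variable R : comNzRingType.

Lemma projective_row n : projective 'rV[R]_n.
Proof.
move=> M N g f gsurj.
have [t ht] := choice (fun j : 'I_n => gsurj (f (delta_mx 0 j))).
pose h (v : 'rV[R]_n) : M := \sum_j v 0 j *: t j.
have hlin : linear h.
  move=> a u v; rewrite /h scaler_sumr -big_split /=; apply: eq_bigr => j _.
  by rewrite !mxE scalerDl scalerA.
pose hL := HB.pack_for {linear 'rV[R]_n -> M} h (GRing.isLinear.Build R _ _ _ h hlin).
exists hL => v; rewrite [in RHS](row_sum_delta v) !linear_sum /=.
by apply: eq_bigr => j _; rewrite !linearZ /= ht.
Qed.

Variable I : idealr R.

Definition quot_proj (v : 'rV[R]_1) : quot_mod I := \pi_({ideal_quot I})%qT (v 0 0).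

Lemma quot_proj_linear : linear quot_proj.
Proof.
by move=> a u v; rewrite /quot_proj !mxE rmorphD rmorphM.
Qed.

HB.instance Definition _ := GRing.isLinear.Build R 'rV[R]_1 (quot_mod I) _ quot_proj quot_proj_linear.

Lemma quot_proj_surj y : exists v, quot_proj v = y.
Proof. by exists (const_mx (repr (y : {ideal_quot I}))); rewrite /quot_proj mxE reprK. Qed.

Lemma quot_proj_eq u v : quot_proj u = quot_proj v <-> u 0 0 - v 0 0 \in I.
Proof.
rewrite /quot_proj; split=> [/eqP|]; first by rewrite -Quotient.idealrBE.
by rewrite Quotient.idealrBE => /eqP.
Qed.

Lemma quot_proj_eq0 v : quot_proj v = 0 <-> v 0 0 \in I.
Proof.
have -> : 0 = quot_proj 0 by rewrite linear0.
by rewrite quot_proj_eq mxE subr0.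
Qed.

(** The ideal as a module: the lifting property of projective modules is applied to
    its free cover. *)
Definition in_ideal : {pred R^o} := fun f => (f : R) \in I.

Lemma in_ideal_submod : submod_closed in_ideal.
Proof.
split=> [|a u v]; first exact: (rpred0 I).
by move=> uI vI; apply: (rpredD (S := I) (idealMr a uI) vI).
Qed.

HB.instance Definition _ := GRing.isSubmodClosed.Build R R^o in_ideal in_ideal_submod.

Record ideal_mod := IdealMod { ideal_val : R^o; _ : ideal_val \in in_ideal }.

HB.instance Definition _ := [isSub for ideal_val].
HB.instance Definition _ := [Choice of ideal_mod by <:].
HB.instance Definition _ := [SubChoice_isSubLmodule of ideal_mod by <:].

End FreeModules.

Section LiftedResolution.
Variables (K : closedFieldType) (a b a' b' : K) (c : nat -> nat) (k : nat).
Hypotheses (hab : a * a' + b * b' = 1) (c_gt0 : forall j, (0 < c j.+1)%N).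
Hypotheses (c1_gt1 : (1 < c 1)%N) (k_gt2 : (2 < k)%N).
Local Notation S := {mpoly K[3]}.
Local Notation x := (linx a b).
Local Notation y := (liny a' b').
Local Notation z := (linz K).
Local Notation zexp := (zexp c).
Local Notation gen := (gener a b a' b' c k).
Variables (I : idealr S) (hI : forall f, f \in I <-> lifted a b a' b' c k f).

Definition res_rank i : nat :=
  match i with 0 => 1 | 1 => k.+1 | 2 => k | _ => 0 end.

Definition res_mx i : 'M[S]_(res_rank i.+1, res_rank i) :=
  match i return 'M[S]_(res_rank i.+1, res_rank i) with
  | 0 => \col_j gen j
  | 1 => \matrix_(i, j) ((i.+1 == j :> nat)%:R * x - (i == j :> nat)%:R * y ^+ c j.+1
                         - (i == j.+1 :> nat)%:R * z ^+ zexp j.+2)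
  | _ => 0
  end.

Definition res_diff i (v : 'rV[S]_(res_rank i.+1)) : 'rV[S]_(res_rank i) := v *m res_mx i.

Definition shifted_row (w : 'rV[S]_k) (m : nat) : S :=
  if m is m'.+1 then (if insub m' is Some i then w 0 i else 0) else 0.

Lemma shifted_rowS w (i : 'I_k) : shifted_row w i.+1 = w 0 i.
Proof. by rewrite /= valK. Qed.

Lemma shifted_row_gt w m : (k < m)%N -> shifted_row w m = 0.
Proof. by case: m => // m; rewrite ltnS leqNgt /= => /negPf km; rewrite insubF. Qed.

Lemma sum_delta_row (w : 'rV[S]_k) (m : nat) (F : 'I_k -> S) (u : S) :
  (forall i : 'I_k, F i = (i.+1 == m)%:R * u) -> \sum_i w 0 i * F i = shifted_row w m * u.
Proof.
move=> FE; case: m FE => [|m] FE.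
  by rewrite mul0r big1 // => i _; rewrite FE mul0r mulr0.
case: (ltnP m k) => mk; last first.
  rewrite shifted_row_gt // mul0r big1 // => i _; rewrite FE eqSS.
  by rewrite ltn_eqF ?mul0r ?mulr0 // (leq_trans (ltn_ord i)).
rewrite (bigD1 (Ordinal mk)) //= FE eqxx mul1r big1 ?addr0 => [|i].
  by rewrite -(shifted_rowS w (Ordinal mk)).
by rewrite FE -val_eqE /= eqSS => /negPf ->; rewrite mul0r mulr0.
Qed.

Lemma res_diff1E (w : 'rV[S]_k) (j : 'I_k.+1) : (res_diff (i := 1) w) 0 j =
  x * shifted_row w j - y ^+ c j.+1 * shifted_row w j.+1 - z ^+ zexp j.+2 * shifted_row w j.+2.
Proof.
rewrite /res_diff mxE.
under eq_bigr => i _ do rewrite mxE !mulrBr.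
rewrite !sumrB ![_ * shifted_row _ _]mulrC; congr (_ - _ - _); apply: sum_delta_row => i //.
Qed.

Lemma res_diff0E (v : 'rV[S]_k.+1) : (res_diff (i := 0) v) 0 0 = \sum_(j < k.+1) v 0 j * gen j.
Proof. by rewrite /res_diff mxE; apply: eq_bigr => j _; rewrite mxE. Qed.

Lemma shifted_row_row (r : nat -> S) m : r 0 = 0 -> (forall j, (k < j)%N -> r j = 0) ->
  shifted_row (\row_i r i.+1) m = r m.
Proof.
move=> r0 rk; case: (ltnP k m) => mk; first by rewrite shifted_row_gt // rk.
by case: m mk => // m mk; rewrite (shifted_rowS _ (Ordinal mk)) mxE.
Qed.

Lemma res_diff_comp (w : 'rV[S]_k) : res_diff (i := 0) (res_diff (i := 1) w) = 0.
Proof.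
rewrite /res_diff -mulmxA [X in _ *m X](_ : _ = 0) ?mulmx0 //.
apply/matrixP => i l; rewrite !mxE; under eq_bigr => j _ do rewrite !mxE !mulrBl.
have delta m (u : S) (F : 'I_k.+1 -> S) (mk : (m < k.+1)%N) :
    (forall j : 'I_k.+1, F j = (m == j :> nat)%:R * u * gen j) -> \sum_j F j = u * gen m.
  move=> FE; rewrite (bigD1 (Ordinal mk)) //= FE eqxx mul1r big1 ?addr0 // => j.
  by rewrite FE -val_eqE /= eq_sym => /negPf ->; rewrite !mul0r.
rewrite !sumrB (delta i.+1 x) //; last by rewrite ltnS.
rewrite (delta i (y ^+ c i.+1)) //; first last.
- by move=> j; case: eqP => [->|_]; rewrite ?mul0r.
- by rewrite ltnS ltnW.
case: i => -[|m] mk /=.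
  rewrite big1 ?subr0 => [|j _]; last by rewrite !mul0r.
  by rewrite gener_rel1 ?subrr // (leq_trans _ k_gt2).
rewrite (delta m (z ^+ zexp m.+2)); first by rewrite gener_rel //; ring.
  by rewrite ltnS ltnW // ltnW.
by move=> j; rewrite eqSS; case: eqP => [->|_]; rewrite ?mul0r.
Qed.

Lemma lifted_pdim_le : pdim_le (quot_mod I) 2.
Proof.
have dlin i : linear (@res_diff i) by move=> u v w; rewrite /res_diff mulmxDl scalemxAl.
exists (fun i => 'rV[S]_(res_rank i)).
exists (fun i => HB.pack_for {linear 'rV[S]_(res_rank i.+1) -> 'rV[S]_(res_rank i)} (@res_diff i)
  (GRing.isLinear.Build S _ _ _ (@res_diff i) (dlin i))).
exists (@quot_proj S I); split => /=.
- by move=> i; apply: projective_row.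
- exact: quot_proj_surj.
- move=> v; rewrite quot_proj_eq0; split=> [/hI [h hv]|[u <-]].
    exists (\row_j h j); apply/rowP => i; rewrite ord1 res_diff0E hv.
    by apply: eq_bigr => j _; rewrite mxE.
  by apply/hI; rewrite res_diff0E; exists (fun j => u 0 (inord j)); apply: eq_bigr => j _; rewrite inord_val.
- case=> [|[|i]] v.
  + split=> [/rowP /(_ 0)|[w <-]]; last exact: res_diff_comp.
    rewrite res_diff0E mxE.
    under eq_bigr => j _ do rewrite -[j in v 0 j]inord_val.
    move=> /(@gener_syzygy _ _ _ _ _ c hab k (fun j => v 0 (inord j))) [r [r0 rk hr]].
    exists (\row_i r i.+1); apply/rowP => j.
    by rewrite res_diff1E !shifted_row_row // -hr ?inord_val // leq_ord.
  + split=> [v0|[w <-]]; last by rewrite [w]thinmx0 /res_diff !mul0mx.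
    exists 0; rewrite /res_diff mul0mx; apply/esym.
    have r0 m j : (k < j + m)%N -> shifted_row v j = 0.
      elim: m j => [|m IH] j; first by rewrite addn0 => /shifted_row_gt.
      rewrite addnS ltnS leq_eqVlt => /orP [/eqP kj|]; last exact: IH.
      have jk : (j < k.+1)%N by lia.
      have /rowP /(_ (Ordinal jk)) := v0; rewrite res_diff1E mxE [Ordinal _ : nat]/= (IH j.+1 ltac:(lia)) (IH j.+2 ltac:(lia)).
      rewrite !mulr0 !subr0 => /eqP; rewrite mulf_eq0 (negPf (linx_neq0 hab)).
      by move=> /eqP.
    by apply/rowP => i; rewrite mxE -shifted_rowS (r0 k) //; lia.
  + split=> _; last by rewrite [v]thinmx0 /res_diff mul0mx.
    by exists 0; rewrite [v]thinmx0; apply: thinmx0.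
- by case=> [|[|[|i]]] // _ v; apply: thinmx0.
Qed.

Lemma contin_coprime_linx m j (q t : S) : contin a b a' b' c j * q = x ^+ m * t ->
  exists s, q = x ^+ m * s.
Proof.
elim: m q t => [|m IH] q t E; first by exists q; rewrite mul1r.
have [q1 qE] : exists q1, q = x * q1.
  apply: (kill_x_eq0 hab); have := congr1 (kill_x a b a' b') E.
  rewrite exprS !rmorphM /= (kill_x_contin c hab) kill_x_x !mul0r => /eqP.
  by rewrite mulf_eq0 expf_eq0 (negPf (liny_neq0 hab)) andbF => /eqP.
have /IH [s q1E] : contin a b a' b' c j * q1 = x ^+ m * t.
  by apply: (mulfI (linx_neq0 hab)); rewrite mulrCA -qE E exprS mulrA.
by exists s; rewrite qE q1E exprS mulrA.
Qed.

Definition ideal_cover (v : 'rV[S]_k.+1) : ideal_mod I :=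
  insubd (0 : ideal_mod I) ((res_diff (i := 0) v) 0 0 : S^o).

Lemma res_diff0_in (v : 'rV[S]_k.+1) : (res_diff (i := 0) v) 0 0 \in I.
Proof.
apply/hI; rewrite res_diff0E; exists (fun j => v 0 (inord j)).
by apply: eq_bigr => j _; rewrite inord_val.
Qed.

Lemma ideal_coverE v : ideal_val (ideal_cover v) = (res_diff (i := 0) v) 0 0.
Proof. by rewrite -[ideal_val _]/(val _) val_insubd res_diff0_in. Qed.

Lemma ideal_cover_linear : linear ideal_cover.
Proof.
move=> u v w; apply: val_inj.
rewrite -[val (ideal_cover _)]/(ideal_val _) ideal_coverE.
rewrite linearP /= -![val (ideal_cover _)]/(ideal_val _) !ideal_coverE.
by rewrite /res_diff mulmxDl -scalemxAl !mxE.
Qed.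

HB.instance Definition _ := GRing.isLinear.Build S 'rV[S]_k.+1 (ideal_mod I) _
  ideal_cover ideal_cover_linear.

Lemma ideal_cover_surj f : exists v, ideal_cover v = f.
Proof.
case: f => f fI; have /hI [h hf] := fI.
exists (\row_j h j); apply: val_inj; rewrite -[LHS]/(ideal_val _) ideal_coverE /= hf res_diff0E.
by apply: eq_bigr => j _; rewrite mxE.
Qed.

(** In a resolution of length at most one the first differential is injective.
    Lifting the projections of P0 and of S onto S / I along each other, the
    generators x^k and p, the last one, come from elements u1 and u2 of P1 with
    p u1 = x^k u2. Lift P1 to the free cover of I: since p is prime to x, the
    coordinates of u1 are multiples of x^k, and dividing by x^k shows that an
    element congruent to 1 modulo I belongs to I. *)
Lemma lifted_pdim_ge m : pdim_le (quot_mod I) m -> (2 <= m)%N.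
Proof.
move=> [P [d [e [projP esurj ker0 kerd P0]]]]; rewrite leqNgt; apply/negP => m2.
have d0_inj u v : d 0%N u = d 0%N v -> u = v.
  move=> uv; apply/eqP; rewrite -subr_eq0; apply/eqP.
  have /(kerd 0%N) [w <-] : d 0%N (u - v) = 0 by rewrite linearB /= uv subrr.
  by rewrite (P0 2 m2 w) linear0.
have [u hu] := projective_row (@quot_proj S I) esurj.
have [v hv] := projP 0%N _ _ (@quot_proj S I) e (@quot_proj_surj S I).
pose one : 'rV[S]_1 := const_mx 1.
have vu1 : (v (u one)) 0 0 - 1 \in I.
  have /quot_proj_eq : quot_proj I (v (u one)) = quot_proj I one by rewrite hv hu.
  by rewrite [one 0 0]mxE.
have lift f : f \in I -> exists w, d 0%N w = u (f *: one).
  by move=> fI; apply/ker0; rewrite hu; apply/quot_proj_eq0; rewrite !mxE mulr1.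
have [u1 hu1] := lift _ (gen_mem hI (leq0n k)).
have [u2 hu2] := lift _ (gen_mem hI (leqnn k)).
have u12 : gen k *: u1 = gen 0 *: u2.
  by apply: d0_inj; rewrite !linearZ /= hu1 hu2 -!linearZ /= !scalerA mulrC.
have fI w : ((v (d 0%N w)) 0 0 : S^o) \in in_ideal I.
  by apply/quot_proj_eq0; rewrite hv; apply/ker0; exists w.
pose f1 w : ideal_mod I := IdealMod (fI w).
have f1lin : linear f1.
  by move=> r w w'; apply: val_inj; rewrite /= !linearP /= !mxE.
pose f1L := HB.pack_for {linear P 1%N -> ideal_mod I} f1
  (GRing.isLinear.Build S _ _ _ f1 f1lin).
have [w hw] := projP 1%N _ _ ideal_cover f1L ideal_cover_surj.
have wu j : exists s, (w u1) 0 j = x ^+ k * s.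
  have := congr1 (fun t => (w t) 0 j) u12; rewrite !linearZ !mxE /= gener_last.
  by rewrite /gener subn0 mulr1; apply: contin_coprime_linx.
have [s hs] := choice wu.
have E : x ^+ k * (\sum_(j < k.+1) s j * gen j) = x ^+ k * (v (u one)) 0 0.
  have := congr1 (@ideal_val S I) (hw u1); rewrite ideal_coverE /= hu1 res_diff0E.
  rewrite linearZ /= linearZ /= mxE [in RHS]/gener subn0 mulr1 => <-.
  by rewrite mulr_sumr; apply: eq_bigr => j _; rewrite hs mulrA.
move/(mulfI (expf_neq0 k (linx_neq0 hab))): E => E.
have vu : (v (u one)) 0 0 \in I.
  by rewrite -E; apply: rpred_sum => j _; apply: idealMr; apply: gen_mem => //; apply: leq_ord.
have := rpredB vu vu1; rewrite opprB addrC subrK; exact/negP/negbT/idealr1.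
Qed.

Lemma lifted_pdim : pdim (quot_mod I) 2.
Proof. by split; [apply: lifted_pdim_le | apply: lifted_pdim_ge]. Qed.

End LiftedResolution.

(** * Height *)

Section IndependenceModuloPrimes.
Variables (n : nat) (K : fieldType).
Local Notation S := {mpoly K[n]}.
Implicit Types (p q : prime_idealr S) (f : S) (N D e m : nat).

(** A counting substitute for the transcendence degree modulo p: such families with
    N of the order of D^r, for all D, play the role of r algebraically independent
    elements. *)
Definition indep_mod p N D : Prop :=
  exists u : 'I_N -> S, (forall i, (msize (u i) <= D.+1)%N) /\
    forall c : 'I_N -> K, \sum_i c i *: u i \in p -> forall i, c i = 0.

Lemma msizeM_bound f g D e : (msize f <= D.+1)%N -> (msize g <= e.+1)%N ->
  (msize (f * g) <= (D + e).+1)%N.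
Proof.
move=> hf hg; have [->|f0] := eqVneq f 0; first by rewrite mul0r msize0.
have [->|g0] := eqVneq g 0; first by rewrite mulr0 msize0.
rewrite msizeM //; move: (mmeasure _ f) (mmeasure _ g) hf hg => s t; lia.
Qed.

(** A relation modulo p between the products of the given family with powers of f
    becomes, modulo q, a relation between the terms without f; once these are gone,
    f can be cancelled. *)
Lemma indep_mod_step p q f N D e m : {subset p <= q} -> f \in q -> f \notin p ->
  (msize f <= e.+1)%N -> indep_mod q N D -> indep_mod p (m.+1 * N) (D + e * m).
Proof.
move=> pq fq fp fe [u [uD uind]]; elim: m => [|m [w [wD wind]]].
  rewrite mul1n muln0 addn0; exists u; split=> // c /pq; exact: uind.
rewrite mulSn; exists (fun i => match split i with inl i => u i | inr j => f * w j end).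
split=> [i|c].
  case: (split i) => j; first by apply: leq_trans (uD j) _; rewrite ltnS leq_addr.
  by rewrite mulnS addnCA; apply: msizeM_bound.
rewrite big_split_ord /=.
under eq_bigr => i _ do rewrite (unsplitK (inl i)).
under [X in _ + X]eq_bigr => i _ do rewrite (unsplitK (inr i)) scalerAr.
rewrite -mulr_sumr => cp.
have cu : \sum_i c (lshift (m.+1 * N) i) *: u i \in q.
  have fw : f * \sum_i c (rshift N i) *: w i \in q by rewrite mulrC idealMr.
  by rewrite -[X in X \in q](addrK (f * \sum_i c (rshift N i) *: w i)); apply: rpredB fw; apply: pq.
have c0 := uind _ cu; move: cp; rewrite big1 => [|i _]; last by rewrite c0 scale0r.
rewrite add0r prime_idealrM (negPf fp) /= => /wind c1 i.
by case: (split_ordP i) => j ->.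
Qed.

Lemma indep_mod_card p N D : indep_mod p N D -> (N <= D.+1 ^ n)%N.
Proof.
move=> [u [uD uind]]; rewrite leqNgt; apply/negP => DN.
pose M := {ffun 'I_n -> 'I_D.+1}; pose mon (g : M) : 'X_{1..n} := [multinom val (g i) | i < n].
pose A := \matrix_(i < N, j < #|M|) (u i)@_(mon (enum_val j)).
have [v vA v0] : exists2 v : 'rV_N, v *m A = 0 & v != 0.
  have /rowV0Pn [v vk v0] : kermx A != 0.
    rewrite kermx_eq0 /row_free ltn_eqF // (leq_ltn_trans (rank_leq_col A)) //.
    by rewrite card_ffun !card_ord.
  by exists v; rewrite // (sub_kermxP vk).
have E : \sum_i v 0 i *: u i = 0.
  apply/mpolyP => k; rewrite mcoeff0 raddf_sum /=.
  case: (ltnP (mdeg k) D.+1) => kD; last first.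
    apply: big1 => i _; rewrite mcoeffZ memN_msupp_eq0 ?mulr0 //.
    by apply: msize_mdeg_ge; apply: leq_trans (uD i) kD.
  have kd i : (k i < D.+1)%N.
    by apply: leq_ltn_trans kD; rewrite mdegE (bigD1 i) //= leq_addr.
  have -> : k = mon [ffun i => Ordinal (kd i)].
    by apply/mnmP => i; rewrite mnmE ffunE.
  set g := [ffun _ => _]; have := congr1 (fun B : 'rV_ _ => B 0 (enum_rank g)) vA.
  rewrite !mxE => vg; rewrite -[RHS]vg; apply: eq_bigr => i _.
  by rewrite mcoeffZ mxE enum_rankK.
case/eqP: v0; apply/rowP => i; rewrite mxE; apply: (uind (fun i => v 0 i)).
by rewrite E rpred0.
Qed.

Lemma msize_bound f : exists e, (msize f <= e.+1)%N.
Proof. by exists (msize f). Qed.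

End IndependenceModuloPrimes.

Section LiftedHeight.
Variables (K : closedFieldType) (a b a' b' : K) (c : nat -> nat) (k : nat).
Hypotheses (hab : a * a' + b * b' = 1) (c_gt0 : forall j, (0 < c j.+1)%N).
Hypothesis (k_gt2 : (2 < k)%N).
Local Notation S := {mpoly K[3]}.
Local Notation x := (linx a b).
Local Notation y := (liny a' b').
Local Notation z := (linz K).
Local Notation gen := (gener a b a' b' c k).
Variables (I : idealr S) (hI : forall f, f \in I <-> lifted a b a' b' c k f).

Definition kill_xy : S -> S := comp_mpoly [tuple 0; 0; z].
HB.instance Definition _ := GRing.RMorphism.on kill_xy.

Lemma kill_xyZ (u : K) f : kill_xy (u *: f) = u *: kill_xy f.
Proof. exact: comp_mpolyZ. Qed.

Lemma kill_xy_x : kill_xy x = 0.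
Proof. by rewrite rmorphD /= !kill_xyZ /kill_xy !comp_mpolyXU /= !scaler0 addr0. Qed.

Lemma kill_xy_y : kill_xy y = 0.
Proof. by rewrite rmorphD /= !kill_xyZ /kill_xy !comp_mpolyXU /= !scaler0 addr0. Qed.

Lemma kill_xy_z : kill_xy z = z.
Proof. by rewrite {1}/linz /kill_xy comp_mpolyXU. Qed.

Lemma two_step_chain (P : prime_idealr S) : x \in P -> y \in P ->
  exists2 p, prime_chain 2 p & p 2 =i P.
Proof.
move=> xP yP.
have [p0 hp0] := prime_idealr_ker (GRing.RMorphism.clone _ _ (@idfun S) _).
have [p1 hp1] := prime_idealr_ker (GRing.RMorphism.clone _ _ (kill_x a b a' b') _).
exists (fun i => if i == 0%N then p0 else if i == 1%N then p1 else P) => //.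
move=> [|[|//]] _ /=; split.
- by move=> f; rewrite hp0 hp1 /= => /eqP ->; rewrite rmorph0.
- by exists x; rewrite ?hp0 ?hp1 /= ?kill_x_x ?(linx_neq0 hab).
- by move=> f; rewrite hp1 /= => /eqP /(kill_x_eq0 hab) [s ->]; rewrite mulrC idealMr.
- by exists y => //; rewrite hp1 /= kill_x_y // (liny_neq0 hab).
Qed.

Lemma prime_mem_exp (P : prime_idealr S) f m : f ^+ m \in P -> f \in P.
Proof.
elim: m => [|m IH]; first by rewrite idealr1.
by rewrite exprS prime_idealrM => /orP [|/IH].
Qed.

Lemma lifted_prime (P : prime_idealr S) : {subset I <= P} -> x \in P /\ y \in P.
Proof.
move=> IP; have xP : x \in P.
  have := IP _ (gen_mem hI (leq0n k)); rewrite /gener subn0 mulr1; exact: prime_mem_exp.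
split=> //; have := IP _ (gen_mem hI (leqnn k)); rewrite gener_last.
have [s hs] := kill_x_congr hab (contin a b a' b' c k).
rewrite -[contin _ _ _ _ _ _](subrK (kill_x a b a' b' (contin a b a' b' c k))) hs.
rewrite rpredDl; last by rewrite mulrC idealMr.
by rewrite (kill_x_contin c hab); apply: prime_mem_exp.
Qed.

(** Modulo (x, y) the powers of z are independent; each prime below adds one
    more independent direction, and polynomials in three variables leave room
    for three directions only. *)
Lemma chain_below_xy (P : prime_idealr S) h p : (forall f, (f \in P) = (kill_xy f == 0)) ->
  prime_chain h p -> p h =i P -> (h <= 2)%N.
Proof.
move=> hP hp phP; rewrite leqNgt; apply/negP => h2.
have indP m : indep_mod P m.+1 m.
  exists (fun i : 'I_m.+1 => z ^+ i); split=> [i|e].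
    by rewrite /linz mpolyXn msizeX mdegMn mdeg1 mul1n.
  rewrite hP => /eqP E i; move: E; rewrite raddf_sum /= => E.
  have {}E : \sum_(j < m.+1) e j *: z ^+ j = 0.
    by rewrite -[RHS]E; apply: eq_bigr => j _; rewrite kill_xyZ rmorphXn /= kill_xy_z.
  have := congr1 (mcoeff (U_(ord_max) *+ i)) E; rewrite mcoeff0 raddf_sum /= (bigD1 i) //=.
  rewrite mcoeffZ /linz mpolyXn mcoeffX eqxx mulr1 big1 ?addr0 // => j ji.
  rewrite mcoeffZ mpolyXn mcoeffX; case: eqP => [/mnmP /(_ ord_max)|_]; last by rewrite mulr0.
  by rewrite !mulmnE mnm1E eqxx !mul1n => /val_inj jiE; rewrite jiE eqxx in ji.
case: h hp phP h2 => [|[|[|h]]] // hp phP _.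
have [s3 [f3 f3q f3p]] := hp h.+2 (ltnSn _).
have [s2 [f2 f2q f2p]] := hp h.+1 (ltnW (ltnSn _)).
have [s1 [f1 f1q f1p]] := hp h (ltnW (ltnW (ltnSn _))).
have [e1 he1] := msize_bound f1; have [e2 he2] := msize_bound f2.
have [e3 he3] := msize_bound f3.
(* With this m the (m + 1)^4 independent products exceed the (C (m + 1))^3
   monomials available to them. *)
pose C := (1 + e1 + e2 + e3)%N; pose m := (C ^ 3)%N.
have i3 : indep_mod (p h.+3) m.+1 m.
  by have [u [uD ui]] := indP m; exists u; split=> // d; rewrite phP; apply: ui.
have := indep_mod_card (indep_mod_step m s1 f1q f1p he1 (indep_mod_step m s2 f2q f2p he2
  (indep_mod_step m s3 f3q f3p he3 i3))).
rewrite leqNgt => /negP; apply.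
have -> : (m.+1 * (m.+1 * (m.+1 * m.+1)) = m.+1 * m.+1 ^ 3)%N by rewrite !expnS expn0; lia.
apply: (@leq_ltn_trans (C ^ 3 * m.+1 ^ 3)).
  by rewrite -expnMn leq_exp2r // /C; nia.
by rewrite ltn_pmul2r // expn_gt0.
Qed.

Lemma lifted_height : height I 2.
Proof.
split; last first.
  move=> P m /lifted_prime [xP yP] [_ hmax].
  by have [p hp p2] := two_step_chain xP yP; apply: hmax p2.
have [P hP] := prime_idealr_ker (GRing.RMorphism.clone _ _ kill_xy _).
have xP : x \in P by rewrite hP /= kill_xy_x.
have yP : y \in P by rewrite hP /= kill_xy_y.
exists P; split.
  move=> f /hI [h ->]; apply: rpred_sum => j _; apply: idealMr; rewrite /gener.
  have := leq_ord j; rewrite leq_eqVlt => /orP [/eqP ->|jk].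
    rewrite subnn mul1r hP /=.
    have [s hs] := kill_x_congr hab (contin a b a' b' c k).
    rewrite -[contin _ _ _ _ _ _](subrK (kill_x a b a' b' (contin a b a' b' c k))) hs.
    rewrite rmorphD rmorphM (kill_x_contin c hab) rmorphXn /= kill_xy_x kill_xy_y mul0r add0r.
    rewrite expr0n; case: k k_gt2 => // k' _; rewrite csumS.
    by rewrite addn_eq0 (gtn_eqF (c_gt0 k')) andbF.
  by rewrite mulrC; apply: idealMr; rewrite -subnSK // exprS mulrC; apply: idealMr.
split; first exact: two_step_chain.
by move=> m p; apply: chain_below_xy.
Qed.

End LiftedHeight.

(** * Spaces of binary forms *)

Section BinaryForms.
Variable K : closedFieldType.
Local Notation S := {mpoly K[2]}.
Local Notation D := (dhomog 2 K).
Implicit Types (p f g : S) (d e k : nat).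

Lemma dim_dhomog d : \dim {: D d} = d.+1.
Proof. by rewrite dimvf /dim /= addn1 binSn. Qed.

Lemma sum_ord2 (R : nmodType) (F : 'I_2 -> R) : \sum_i F i = F ord0 + F ord_max.
Proof. by rewrite big_ord_recl big_ord1; congr (_ + F _); apply: val_inj. Qed.

(** Projecting onto degree e makes multiplication by p linear without any condition
    on p. *)
Definition hmul p d e (u : D d) : D e := DHomog (pihomogP mdeg e (p * mpoly_of_dhomog u)).

Lemma hmul_linear p d e : linear (@hmul p d e).
Proof.
move=> a u v; apply: val_inj; rewrite /= mulrDr -scalerAr.
by rewrite linearP.
Qed.

HB.instance Definition _ p d e := GRing.isLinear.Build K (D d) (D e) _ (@hmul p d e)
  (@hmul_linear p d e).

Lemma hmulE p k d e (u : D d) : p \is k.-homog -> (k + d)%N = e ->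
  mpoly_of_dhomog (linfun (@hmul p d e) u) = p * u.
Proof.
move=> hp <-; rewrite lfunE /=; apply: pihomog_dE; apply: dhomogM => //.
exact: dhomog_is_dhomog.
Qed.

Lemma hmulXE i d (u : D d) : mpoly_of_dhomog (linfun (@hmul 'X_i d d.+1) u) = 'X_i * u.
Proof. exact: hmulE (dhomogXU _ i) _. Qed.

Lemma dhomog_inj d (u v : D d) : u = v :> S -> u = v.
Proof. exact: val_inj. Qed.

Lemma dhomog_of f d : f \is d.-homog -> exists u : D d, u = f :> S.
Proof. by move=> hf; exists (DHomog hf). Qed.

Definition shift d (U : {vspace D d}) : {vspace D d.+1} :=
  (linfun (@hmul 'X_ord0 d d.+1) @: U + linfun (@hmul 'X_ord_max d d.+1) @: U)%VS.

Definition multiples p e d : {vspace D d} := limg (linfun (@hmul p e d)).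

Lemma shiftP d (U : {vspace D d}) (w : D d.+1) :
  reflect (exists u v : D d, [/\ u \in U, v \in U & w = 'X_ord0 * u + 'X_ord_max * v :> S])
          (w \in shift U).
Proof.
apply: (iffP memv_addP) => [[_ /memv_imgP [u uU ->] [_ /memv_imgP [v vU ->] ->]]|].
  by exists u, v; rewrite linearD /= !hmulXE.
move=> [u [v [uU vU wE]]]; exists (linfun (@hmul 'X_ord0 d d.+1) u); first exact: memv_img.
exists (linfun (@hmul 'X_ord_max d d.+1) v); first exact: memv_img.
by apply: dhomog_inj; rewrite wE linearD /= !hmulXE.
Qed.

Lemma multiplesP p k e d (w : D d) : p \is k.-homog -> (k + e)%N = d ->
  reflect (exists u : D e, w = p * u :> S) (w \in multiples p e d).
Proof.
move=> hp hd; apply: (iffP memv_imgP) => [[u _ ->]|[u wE]]; first by exists u; rewrite (hmulE _ hp).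
by exists u; rewrite ?memvf //; apply: dhomog_inj; rewrite (hmulE _ hp).
Qed.

Lemma dim_hmul p k d e (U : {vspace D d}) : p \is k.-homog -> (k + d)%N = e -> p != 0 ->
  \dim (linfun (@hmul p d e) @: U) = \dim U.
Proof.
move=> hp hd p0; apply: limg_dim_eq; apply/eqP; rewrite -subv0; apply/subvP => u.
rewrite memv_cap memv_ker memv0 => /andP [_ /eqP /(congr1 (@mpoly_of_dhomog _ _ _))].
rewrite (hmulE _ hp) //= => /eqP; rewrite mulf_eq0 (negPf p0) /= => /eqP u0.
by apply/eqP/dhomog_inj.
Qed.

Lemma dim_multiples p k e d : p \is k.-homog -> (k + e)%N = d -> p != 0 ->
  \dim (multiples p e d) = e.+1.
Proof. by move=> hp hd p0; rewrite /multiples (dim_hmul _ hp) // dim_dhomog. Qed.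

Lemma mpolyX_neq0 i : ('X_i : S) != 0.
Proof. by rewrite -msupp_eq0 msuppX. Qed.

Lemma shift_multiples p k e d : p \is k.-homog -> (k + e)%N = d ->
  shift (multiples p e d) = multiples p e.+1 d.+1.
Proof.
move=> hp hd; have hd' : (k + e.+1)%N = d.+1 by rewrite addnS hd.
apply/vspaceP => w; apply/shiftP/(multiplesP _ hp hd').
  move=> [u1 [v1 [/(multiplesP _ hp hd) [u uE] /(multiplesP _ hp hd) [v vE] wE]]].
  have [t tE] : exists t : D e.+1, t = 'X_ord0 * u + 'X_ord_max * v :> S.
    by apply: dhomog_of; apply: dhomogD; apply: dhomogMX; apply: dhomog_is_dhomog.
  by exists t; rewrite wE uE vE tE; ring.
move=> [t wE]; have [h hh tE] := dhomogS_split (dhomog_is_dhomog t).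
have hM i : p * h i \is d.-homog by rewrite -hd; apply: dhomogM.
have [u uE] := dhomog_of (hM ord0); have [v vE] := dhomog_of (hM ord_max).
have [u0 u0E] := dhomog_of (hh ord0); have [v0 v0E] := dhomog_of (hh ord_max).
exists u, v; split.
- by apply/(multiplesP _ hp hd); exists u0; rewrite uE u0E.
- by apply/(multiplesP _ hp hd); exists v0; rewrite vE v0E.
- by rewrite wE [mpoly_of_dhomog t]tE sum_ord2 uE vE; ring.
Qed.

Lemma X_coprime f g : 'X_ord0 * f = 'X_ord_max * g -> exists h, f = 'X_ord_max * h.
Proof.
pose t : 2.-tuple S := [tuple 'X_ord0; 0].
have ht : forall i, exists s, 'X_i - tnth t i = 'X_ord_max * s :> S.
  move=> i; rewrite (tnth_nth 0); case: i => -[|[|//]] hi /=.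
    by exists 0; rewrite mulr0 (_ : Ordinal hi = ord0) ?subrr //; apply: val_inj.
  by exists 1; rewrite mulr1 (_ : Ordinal hi = ord_max) ?subr0 //; apply: val_inj.
have [s hs] := comp_mpoly_congr ht f.
move=> /(congr1 (comp_mpoly t)) /eqP; rewrite !rmorphM /= !comp_mpolyXU /= mul0r.
by rewrite mulf_eq0 (negPf (mpolyX_neq0 _)) => /eqP f0; exists s; rewrite -hs f0 subr0.
Qed.

Lemma dhomog_factor p k e d f : p \is k.-homog -> (k + e)%N = d ->
  p * f \is d.-homog -> exists2 g, g \is e.-homog & p * f = p * g.
Proof.
move=> hp hd hpf; exists (pihomog mdeg e f); first exact: pihomogP.
by rewrite -(pihomogMl _ _ hp) hd pihomog_dE.
Qed.

(** The equality case of Macaulay's growth bound in two variables. The spaces X U and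
    Y U meet in X Y V, where V is the space of w with X w and Y w in U, so that
    dim V >= dim U - 1. As X V + Y V lies in U, the space V inherits the hypothesis
    and by induction consists of all multiples of some form p, unless it is zero;
    counting dimensions, U consists of all multiples of p as well. *)
Lemma small_shift d (U : {vspace D d}) : U != 0%VS -> (\dim (shift U) <= (\dim U).+1)%N ->
  exists e k p, [/\ (k + e)%N = d, p \is k.-homog, p != 0 & U = multiples p e d].
Proof.
elim: d U => [|d IH] U U0 hU.
  exists 0%N, 0%N, 1; split; rewrite ?dhomog1 ?oner_neq0 //.
  apply/eqP; rewrite eqEdim (dim_multiples (k := 0)) ?dhomog1 ?oner_neq0 // lt0n dimv_eq0 U0 andbT.
  apply/subvP => w _; apply/(multiplesP (k := 0)); rewrite ?dhomog1 //.
  by exists w; rewrite mul1r.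
pose V := ((linfun (@hmul 'X_ord0 d d.+1) @^-1: U) :&: (linfun (@hmul 'X_ord_max d d.+1) @^-1: U))%VS.
have VP w : w \in V = (linfun (@hmul 'X_ord0 d d.+1) w \in U) && (linfun (@hmul 'X_ord_max d d.+1) w \in U).
  by rewrite memv_cap !memv_preim.
have sV : (shift V <= U)%VS.
  apply/subvP => w /shiftP [u [v [+ + wE]]]; rewrite !VP => /andP [hu _] /andP [_ hv].
  suff -> : w = linfun (@hmul 'X_ord0 d d.+1) u + linfun (@hmul 'X_ord_max d d.+1) v.
    exact: rpredD.
  by apply: dhomog_inj; rewrite wE linearD /= !hmulXE.
have dimV : (\dim U <= (\dim V).+1)%N.
  pose U1 := (linfun (@hmul 'X_ord0 d.+1 d.+2) @: U)%VS.
  pose U2 := (linfun (@hmul 'X_ord_max d.+1 d.+2) @: U)%VS.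
  have capV : (\dim (U1 :&: U2) <= \dim V)%N.
    have h2 : ('X_ord0 * 'X_ord_max : S) \is 2.-homog by exact: (dhomogM (dhomogXU _ _) (dhomogXU _ _)).
    rewrite -(dim_hmul V h2 (erefl _)) ?mulf_neq0 ?mpolyX_neq0 //; apply: dimvS.
    apply/subvP => w; rewrite memv_cap => /andP [/memv_imgP [u uU wu] /memv_imgP [v vU wv]].
    have E : 'X_ord0 * u = 'X_ord_max * v :> S by rewrite -!hmulXE -wu -wv.
    have [f uf] := X_coprime E.
    have [g hg ug] : exists2 g, g \is d.-homog & u = 'X_ord_max * g :> S.
      rewrite uf; apply: (dhomog_factor (dhomogXU _ _)) => //; rewrite -uf; exact: dhomog_is_dhomog.
    have vg : v = 'X_ord0 * g :> S.
      by apply: (mulfI (mpolyX_neq0 ord_max)); rewrite -E ug; ring.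
    have [t tg] := dhomog_of hg; apply/memv_imgP; exists t.
      rewrite VP; apply/andP; split.
        by rewrite (_ : linfun _ t = v) //; apply: dhomog_inj; rewrite hmulXE vg tg.
      by rewrite (_ : linfun _ t = u) //; apply: dhomog_inj; rewrite hmulXE ug tg.
    by apply: dhomog_inj; rewrite wu hmulXE (hmulE _ h2) // ug tg; ring.
  have dU1 : \dim U1 = \dim U by apply: (dim_hmul _ (dhomogXU _ _)); rewrite ?mpolyX_neq0.
  have dU2 : \dim U2 = \dim U by apply: (dim_hmul _ (dhomogXU _ _)); rewrite ?mpolyX_neq0.
  have := dimv_sum_cap U1 U2; rewrite dU1 dU2 => dU; move: hU.
  move: capV dU; rewrite -[shift U]/(U1 + U2)%VS.
  move: (\dim (U1 + U2)%VS) (\dim (U1 :&: U2)%VS) (\dim V) (\dim U) => s t v u; lia.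
have [V0|V0] := eqVneq V 0%VS.
  have U1 : \dim U = 1%N.
    by move: U0 dimV; rewrite -dimv_eq0 V0 dimv0; case: (\dim U) => [|[|]].
  exists 0%N, d.+1, (mpoly_of_dhomog (vpick U)).
  have vp0 : mpoly_of_dhomog (vpick U) != 0.
    by apply: contra U0 => /eqP v0; rewrite -vpick0; apply/eqP/dhomog_inj.
  have hvp := dhomog_is_dhomog (vpick U).
  split; rewrite ?addn0 //; apply/eqP; rewrite eq_sym eqEdim.
  rewrite (dim_multiples hvp) ?addn0 // U1 leqnn andbT.
  apply/subvP => w /(multiplesP _ hvp (addn0 _)) [u wE].
  have [c uc] := dhomog0_const (dhomog_is_dhomog u).
  suff -> : w = c *: vpick U by apply: rpredZ; apply: memv_pick.
  by apply: dhomog_inj; rewrite wE [mpoly_of_dhomog u]uc linearZ /= mulrC mul_mpolyC.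
have [|e [k [p [ked hp p0 VE]]]] := IH V V0.
  by apply: leq_trans (dimvS sV) _.
exists e.+1, k, p; split; rewrite ?addnS ?ked //.
apply/eqP; rewrite eq_sym eqEdim -(shift_multiples hp ked) -VE sV /=.
rewrite [X in shift X]VE (shift_multiples hp ked) (dim_multiples hp) ?addnS ?ked //.
by move: dimV; rewrite VE (dim_multiples hp).
Qed.

Lemma dim_shift_gt d (U : {vspace D d}) : U != 0%VS -> (\dim U < \dim (shift U))%N.
Proof.
move=> U0; rewrite ltnNge; apply/negP => hU.
have [e [k [p [ked hp p0 UE]]]] := small_shift U0 (leq_trans hU (leqnSn _)).
move: hU; rewrite UE (shift_multiples hp ked) !(dim_multiples hp) ?addnS ?ked //.
by rewrite ltnn.
Qed.

End BinaryForms.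

(** * Zeros of binary forms *)

Section BinaryZeros.
Variable K : closedFieldType.
Local Notation S := {mpoly K[2]}.
Implicit Types (f g : S) (d e : nat) (i : 'I_2) (v w : 'I_2 -> K).

(** Dehomogenization with respect to the i-th variable. *)
Definition deh i : S -> {poly K} := mmap polyC (fun j => if j == i then 1 else 'X).

Lemma deh_is_monoid_morphism i : monoid_morphism (deh i).
Proof. split; [exact: rmorph1 | exact: rmorphM]. Qed.

HB.instance Definition _ i := GRing.isZmodMorphism.Build S {poly K} (deh i) (raddfB _).
HB.instance Definition _ i := GRing.isMonoidMorphism.Build S {poly K} (deh i)
  (deh_is_monoid_morphism i).

Lemma dehC i c : deh i c%:MP = c%:P. Proof. exact: mmapC. Qed.

Lemma dehX i j : deh i 'X_j = if j == i then 1 else 'X.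
Proof. by rewrite /deh mmapX mmap1U. Qed.

Lemma dehZ i c f : deh i (c *: f) = c%:P * deh i f.
Proof. by rewrite -mul_mpolyC rmorphM /= dehC. Qed.

Lemma deh_horner i f r : (deh i f).[r] = f.@[fun j => if j == i then 1 else r].
Proof.
rewrite mevalE /deh /mmap horner_sum; apply: eq_bigr => m _.
rewrite hornerM hornerC /mmap1 horner_prod; congr (_ * _); apply: eq_bigr => j _.
by rewrite horner_exp; case: eqP; rewrite ?hornerC ?hornerX.
Qed.

(** A binary monomial of given degree is determined by its exponent in 'X_i. *)
Lemma deh_eq0 i f d : f \is d.-homog -> deh i f = 0 -> f = 0.
Proof.
move=> hf /eqP; apply: contraTeq => f0; set m0 := mlead f.
have m0f : m0 \in msupp f by apply: mlead_supp.
have mm1 m : mmap1 (fun j => if j == i then 1 else 'X) m = 'X^(mdeg m - m i) :> {poly K}.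
  rewrite /mmap1 mdegE (bigD1 i) //= eqxx expr1n mul1r [X in (X - _)%N](bigD1 i) //= addKn.
  by rewrite expr_sum; apply: eq_bigr => j /negPf ->.
suff : (deh i f)`_(d - m0 i) != 0 by apply: contraNneq => ->; rewrite coef0.
rewrite /deh /mmap coef_sum (bigD1_seq m0) //= big_seq_cond big1 ?addr0 => [|m /andP [mf mm0]].
  by rewrite mm1 coefCM (dhomog_mf hf m0f) coefXn eqxx mulr1 -mcoeff_msupp.
rewrite mm1 coefCM coefXn (dhomog_mf hf mf) /=; case: eqP => [E|_]; last by rewrite mulr0.
case/eqP: mm0; have dm : mdeg m = mdeg m0.
  by rewrite -[LHS]/((mdeg : measure 2) m) (dhomog_mf hf mf) (dhomog_mf hf m0f).
have {}E : m i = m0 i.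
  have m_le (k : 'X_{1..2}) : (k i <= mdeg k)%N by rewrite mdegE (bigD1 i) //= leq_addr.
  have := m_le m; have := m_le m0; have /= := dhomog_mf hf mf.
  by have /= := dhomog_mf hf m0f; lia.
apply/mnmP; move: dm; rewrite !mdegE !sum_ord2 => dm j.
have ord2 (l : 'I_2) : l = ord0 \/ l = ord_max.
  by case: l => -[|[|//]] hl; [left|right]; apply: val_inj.
by case: (ord2 i) E dm => ->; case: (ord2 j) => -> // E; rewrite E; lia.
Qed.

Lemma other_index i : exists j, j != i.
Proof. by case: (eqVneq i ord0) => [->|ni]; [exists ord_max|exists ord0; rewrite eq_sym]. Qed.

Lemma deh_const i f d c : f \is d.-homog -> deh i f = c%:P -> f = c *: 'X_i ^+ d.
Proof.
move=> hf fc; apply/eqP; rewrite -subr_eq0; apply/eqP; apply: (deh_eq0 (d := d) (i := i)).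
  by apply: rpredB hf _; apply: dhomogZ; apply/dhomog1X/dhomogXU.
by rewrite rmorphB /= fc dehZ rmorphXn /= dehX eqxx expr1n mulr1 subrr.
Qed.

Lemma ord2_cases (P : 'I_2 -> Prop) : P ord0 -> P ord_max -> forall i, P i.
Proof.
move=> P0 P1 [[|[|//]] hi]; first by rewrite (_ : Ordinal hi = ord0) //; apply: val_inj.
by rewrite (_ : Ordinal hi = ord_max) //; apply: val_inj.
Qed.

Definition nonzero v : Prop := exists i, v i != 0.

Lemma binary_root f d : f \is d.+1.-homog -> exists2 v, nonzero v & f.@[v] = 0.
Proof.
move=> hf; case: (eqVneq (size (deh ord0 f)) 1%N) => [/eqP /size_poly1P [c _ fc]|].
  exists (fun j => (j != ord0)%:R); first by exists ord_max; rewrite oner_neq0.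
  by rewrite (deh_const hf fc) mevalZ rmorphXn /= mevalXU eqxx expr0n mulr0.
move=> /closed_rootP [r /rootP fr].
exists (fun j => if j == ord0 then 1 else r); last by rewrite -deh_horner.
by exists ord0; rewrite eqxx oner_neq0.
Qed.

Lemma binary_nonroot f d : f \is d.-homog -> f != 0 -> exists v, f.@[v] != 0.
Proof.
move=> hf f0; have : deh ord0 f != 0 by apply: contra_neq f0; apply: deh_eq0 hf.
move=> /closed_nonrootP [r fr].
by exists (fun j => if j == ord0 then 1 else r); rewrite -deh_horner.
Qed.

(** Dehomogenizing the ideal generated by the given forms yields an ideal of K[t];
    its generator has no root, as a root would be a common zero of the forms, so it
    is constant, and a constant comes from a power of 'X_i. *)
Lemma binary_nullstellensatz (P : S -> Prop) :
  (forall f, P f -> exists d, f \is d.-homog) ->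
  (forall v, nonzero v -> exists2 f, P f & f.@[v] != 0) ->
  forall i, exists N, ideal_gen P ('X_i ^+ N).
Proof.
move=> hP noroot i; set J := ideal_gen P; have hJ : ideal_like J := ideal_gen_ideal P.
pose A (u : {poly K}) := exists f d, [/\ J f, f \is d.-homog & deh i f = u].
have Xi1 d : deh i ('X_i ^+ d) = 1 by rewrite rmorphXn /= dehX eqxx expr1n.
have AD u t : A u -> A t -> A (u + t).
  move=> [f [d [Jf hf <-]]] [g [e [Jg hg <-]]].
  exists ('X_i ^+ e * f + 'X_i ^+ d * g), (e + d)%N; split.
  - by apply: (ideal_likeD hJ); apply: (ideal_likeMl hJ).
  - apply: dhomogD; first by apply: dhomogM hf; apply/dhomog1X/dhomogXU.
    by rewrite addnC; apply: dhomogM hg; apply/dhomog1X/dhomogXU.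
  - by rewrite rmorphD !rmorphM /= !Xi1 !mul1r.
have AC c u : A u -> A (c%:P * u).
  move=> [f [d [Jf hf <-]]]; exists (c *: f), d; split; rewrite ?dehZ ?dhomogZ //.
  by rewrite -mul_mpolyC; apply: (ideal_likeMl hJ).
have AM q u : A u -> A (q * u).
  move=> Au; elim/poly_ind: q => [|q c IH]; first by rewrite -polyC0; apply: AC.
  rewrite mulrDl; apply: AD (AC _ _ Au); rewrite mulrAC.
  case: IH => [f [d [Jf hf <-]]]; have [j ji] := other_index i.
  exists ('X_j * f), d.+1; split; rewrite ?dhomogMX //; first exact: (ideal_likeMl hJ).
  by rewrite rmorphM /= dehX (negPf ji) mulrC.
have [f0 Pf0 f0v] : exists2 f, P f & f.@[fun=> 1] != 0.
  by apply: noroot; exists ord0; rewrite oner_neq0.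
have Adeh f : P f -> A (deh i f).
  by move=> Pf; have [d hf] := hP f Pf; exists f, d; split=> //; apply: ideal_gen_mem.
have exA : exists n, `[< exists u, [/\ A u, u != 0 & size u = n] >].
  exists (size (deh i f0)); apply/asboolP; exists (deh i f0); split=> //; first exact: Adeh.
  have [d hf0] := hP _ Pf0; apply: contraNneq f0v => /(deh_eq0 hf0) ->.
  by rewrite meval0.
case: (ex_minnP exA) => n /asboolP [u [Au u0 <-]] umin.
have udvd f : P f -> u %| deh i f.
  move=> /Adeh Af; rewrite /dvdp; apply: contraT => r0.
  have := umin (size (deh i f %% u)); rewrite leqNgt ltn_modp u0.
  apply; apply/asboolP; exists (deh i f %% u); split=> //.
  have -> : deh i f %% u = deh i f + (- (deh i f %/ u)) * u.
    by rewrite {2}(divp_eq (deh i f) u) mulNr addrAC subrr add0r.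
  by apply: AD Af _; apply: AM.
have [/eqP /size_poly1P [c c0 uc]|] := eqVneq (size u) 1%N.
  case: Au => f [d [Jf hf fu]]; exists d.
  have fE := deh_const hf (etrans fu uc).
  rewrite -[_ ^+ d]scale1r -(mulVf c0) -scalerA -fE -mul_mpolyC.
  exact: (ideal_likeMl hJ).
move=> /closed_rootP [r ur].
have [|f Pf] := noroot (fun j => if j == i then 1 else r).
  by exists i; rewrite eqxx oner_neq0.
rewrite -deh_horner; have /dvdpP [q ->] := udvd f Pf.
by rewrite hornerM (rootP ur) mulr0 eqxx.
Qed.

Lemma mmap_const v f : mmap (@mpolyC 2 K) (fun i => (v i)%:MP) f = (f.@[v])%:MP.
Proof.
rewrite mevalE raddf_sum /mmap; apply: eq_bigr => m _ /=.
rewrite rmorphM /= /mmap1 rmorph_prod; congr (_ * _).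
by apply: eq_bigr => i _; rewrite rmorphXn.
Qed.

(** The linear form vanishing on the line through v. *)
Definition line v : S := v ord_max *: 'X_ord0 - v ord0 *: 'X_ord_max.

Lemma line_homog v : line v \is 1.-homog.
Proof. by apply: rpredB; apply: dhomogZ; apply: dhomogXU. Qed.

Lemma line_eval v w : (line v).@[w] = v ord_max * w ord0 - v ord0 * w ord_max.
Proof. by rewrite mevalB !mevalZ !mevalXU. Qed.

Lemma line_neq0 v : nonzero v -> line v != 0.
Proof.
move=> [i vi]; apply/eqP => l0; case/negP: vi.
have := line_eval v (fun j => (j == ord0)%:R); have := line_eval v (fun j => (j != ord0)%:R).
rewrite l0 !meval0 /= !(mulr0, mulr1, subr0, sub0r) => /esym /eqP.
by rewrite oppr_eq0 => v0 /esym /eqP v1; elim/ord2_cases: i.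
Qed.

Lemma nonzero_bezout v : nonzero v ->
  exists a' b', v ord_max * a' + (- v ord0) * b' = 1.
Proof.
move=> [i vi]; case: (eqVneq (v ord_max) 0) => v1.
  have v0 : v ord0 != 0.
    by elim/ord2_cases: i vi; rewrite // v1 eqxx.
  by exists 0, (- (v ord0)^-1); rewrite mulr0 add0r mulrNN divff.
by exists (v ord_max)^-1, 0; rewrite mulr0 addr0 divff.
Qed.

(** Projecting onto the line through v along m turns f into a multiple of f.@[v]. *)
Lemma line_factor v f d : nonzero v -> f \is d.+1.-homog -> f.@[v] = 0 ->
  exists2 g, g \is d.-homog & f = line v * g.
Proof.
move=> hv hf fv; have [a' [b' hab]] := nonzero_bezout hv.
pose m : S := - b' *: 'X_ord0 + a' *: 'X_ord_max.
pose t : 2.-tuple S := [tuple m * (v ord0)%:MP; m * (v ord_max)%:MP].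
have habS : (v ord_max)%:MP * a'%:MP - (v ord0)%:MP * b'%:MP = 1 :> S.
  by rewrite -!rmorphM -rmorphB /= -mulNr hab mpolyC1.
have mE : m = - b'%:MP * 'X_ord0 + a'%:MP * 'X_ord_max by rewrite -rmorphN /= !mul_mpolyC.
have lE : line v = (v ord_max)%:MP * 'X_ord0 - (v ord0)%:MP * 'X_ord_max.
  by rewrite !mul_mpolyC.
have ht : forall i, exists s, 'X_i - tnth t i = line v * s :> S.
  move=> i; rewrite (tnth_nth 0); case: i => -[|[|//]] hi /=.
    rewrite (_ : Ordinal hi = ord0); last exact: val_inj.
    by exists a'%:MP; rewrite -{1}['X_ord0]mul1r -habS mE lE; ring.
  rewrite (_ : Ordinal hi = ord_max); last exact: val_inj.
  by exists b'%:MP; rewrite -{1}['X_ord_max]mul1r -habS mE lE; ring.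
have [s hs] := comp_mpoly_congr ht f.
have f0 : f \mPo t = 0.
  have -> : f \mPo t = mmap (@mpolyC 2 K) (fun i => m * (v i)%:MP) f.
    rewrite /comp_mpoly /mmap; apply: eq_bigr => k _; congr (_ * _); apply: mmap1_eq => i.
    rewrite (tnth_nth 0); case: i => -[|[|//]] hi /=; congr (_ * (v _)%:MP); exact: val_inj.
  by rewrite (mmap_dhomog_scale _ _ _ hf) mmap_const fv mpolyC0 mulr0.
move: hs; rewrite f0 subr0 => fE; rewrite fE.
by apply: (dhomog_factor (line_homog v) (add1n d)); rewrite -fE.
Qed.

End BinaryZeros.

(** * Degree parts of an ideal of binary forms *)

Section Subspaces.
Variables (K : fieldType) (V : vectType K).
Implicit Types (s : seq V) (U W : {vspace V}).

Lemma vspace_of_closed (P : V -> Prop) : P 0 -> (forall c u v, P u -> P v -> P (c *: u + v)) ->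
  exists U : {vspace V}, forall v, v \in U <-> P v.
Proof.
move=> P0 PZ; pose Q n := `[< exists2 U : {vspace V}, (forall v, v \in U -> P v) & \dim U = n >].
have exQ : exists n, Q n.
  exists 0%N; apply/asboolP; exists 0%VS; rewrite ?dimv0 // => v.
  by rewrite memv0 => /eqP ->.
have Qmax n : Q n -> (n <= \dim {: V})%N.
  by move=> /asboolP [U _ <-]; apply/dimvS/subvf.
case: (ex_maxnP exQ Qmax) => n /asboolP [U UP <-] Umax; exists U => v; split; first exact: UP.
move=> Pv; have UvP w : w \in (U + <[v]>)%VS -> P w.
  move=> /memv_addP [u uU [_ /vlineP [c ->] ->]].
  by rewrite addrC; apply: PZ => //; apply: UP.
have := Umax (\dim (U + <[v]>)); rewrite asboolE => /(_ (ex_intro2 _ _ _ UvP erefl)) Uv.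
have /eqP -> : U == (U + <[v]>)%VS by rewrite eqEdim addvSl.
by rewrite memvE addvSr.
Qed.

Lemma span_seqP s v : uniq s -> v \in <<s>>%VS -> exists c : V -> K, v = \sum_(x <- s) c x *: x.
Proof.
elim: s v => [|x s IH] v; first by rewrite span_nil memv0 => _ /eqP ->; exists (fun=> 0); rewrite big_nil.
rewrite /= => /andP [xs us]; rewrite span_cons => /memv_addP [_ /vlineP [k ->] [w /(IH _ us) [c ->] ->]].
exists (fun y => if y == x then k else c y); rewrite big_cons eqxx; congr (_ + _).
by apply: eq_big_seq => y ys; case: eqP ys xs => [-> ->|].
Qed.

Lemma free_seqP s (c : V -> K) : free s -> \sum_(x <- s) c x *: x = 0 ->
  forall x, x \in s -> c x = 0.
Proof.
move=> fs; rewrite (big_nth 0) big_mkord => E x xs.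
have /freeP /(_ (fun i => c s`_i) E) H : free (in_tuple s) by [].
have hx : (index x s < size s)%N by rewrite index_mem.
by have := H (Ordinal hx); rewrite /= nth_index.
Qed.

Lemma complement_size s U W : {subset s <= U} -> (W <= U)%VS -> uniq s ->
  (forall u, u \in U -> exists c : V -> K, u - \sum_(x <- s) c x *: x \in W) ->
  (forall c : V -> K, \sum_(x <- s) c x *: x \in W -> forall x, x \in s -> c x = 0) ->
  (size s + \dim W)%N = \dim U.
Proof.
move=> sU WU us gen ind.
have cap : (<<s>> :&: W = 0)%VS.
  apply/eqP; rewrite -subv0; apply/subvP => v; rewrite memv_cap => /andP [/(span_seqP us) [c ->]].
  by move=> /ind c0; rewrite memv0 big_seq big1 // => x /c0 ->; rewrite scale0r.
have fs : free s.
  have {}ind (c : V -> K) : \sum_(x <- s) c x *: x = 0 -> forall x, x \in s -> c x = 0.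
    by move=> E; apply: ind; rewrite E mem0v.
  elim: s us ind {sU gen cap} => [|x s IH] /=; first by rewrite nil_free.
  move=> /andP [xs us] ind; rewrite free_cons; apply/andP; split.
    apply/negP => /(span_seqP us) [c xE].
    have := ind (fun y => if y == x then 1 else - c y); rewrite big_cons eqxx scale1r.
    rewrite {1}xE -big_split big_seq big1 /= => [/(_ erefl x (mem_head _ _))|y ys].
      by rewrite eqxx => /eqP; rewrite oner_eq0.
    case: eqP ys xs => [-> ->//|_ _ _]; by rewrite scaleNr subrr.
  apply: (IH us) => c E y ys; have := ind (fun y => if y == x then 0 else c y).
  rewrite big_cons eqxx scale0r add0r.
  have ne t : t \in s -> (t == x) = false by move=> ts; apply: contraNF xs => /eqP <-.
  rewrite (eq_big_seq (fun y => c y *: y)) => [/(_ E y)|t ts]; last by rewrite ne.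
  by rewrite ne // inE ys orbT => ->.
rewrite -(eqP fs) -dimv_disjoint_sum //; congr (\dim _); apply/vspaceP => u.
apply/idP/idP => [/memv_addP [v vs [w wW ->]]|/gen [c uc]].
  apply: rpredD; last exact: (subvP WU).
  by move: v vs; apply/subvP/span_subvP.
rewrite -[u](subrKC (\sum_(x <- s) c x *: x)); apply: memv_add => //.
by rewrite big_seq; apply: rpred_sum => x xs; apply/rpredZ/memv_span.
Qed.

End Subspaces.

Section DegreeParts.
Variables (K : closedFieldType) (I : idealr {mpoly K[2]}).
Local Notation S := {mpoly K[2]}.
Local Notation D := (dhomog 2 K).
Implicit Types (B : seq S) (f g : S) (d e k : nat).

Lemma deg_part_exists d : exists U : {vspace D d}, forall u, u \in U <-> mpoly_of_dhomog u \in I.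
Proof.
apply: vspace_of_closed => [|c u v uI vI]; first exact: rpred0.
by rewrite linearP /= -mul_mpolyC; apply: rpredD => //; apply: idealMr.
Qed.

Definition to_dhomog d f : D d := DHomog (pihomogP mdeg d f).

Lemma to_dhomogE d f : f \is d.-homog -> mpoly_of_dhomog (to_dhomog d f) = f.
Proof. exact: pihomog_dE. Qed.

Definition deg_part d : {vspace D d} := sval (cid (deg_part_exists d)).

Lemma deg_partP d (u : D d) : (u \in deg_part d) = (mpoly_of_dhomog u \in I).
Proof. by rewrite /deg_part; case: cid => U /= h; apply/idP/idP => /h. Qed.

Definition prev_space d : {vspace D d} :=
  match d with 0 => 0%VS | e.+1 => shift (deg_part e) end.

Lemma prev_spaceP d (w : D d) : w \in prev_space d <-> prev_part_S1 I d w.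
Proof.
case: d w => [|d] w /=.
  rewrite memv0; split=> [/eqP -> | [s hs wE]]; first exact: prev_part_S1_0.
  apply/eqP/dhomog_inj; rewrite wE big_seq big1 //= => u /hs [[_ [e //]]].
split=> [/shiftP [u [v [uI vI ->]]]|[s hs wE]].
  have hX i (t : D d) : t \in deg_part d -> prev_part_S1 I d.+1 (mpoly_of_dhomog t * 'X_i).
    rewrite deg_partP => tI.
    by have := prev_part_S1M tI (dhomog_is_dhomog t) (dhomogXU _ i) isT; rewrite addn1.
  by rewrite ![_ * mpoly_of_dhomog _]mulrC; apply: prev_part_S1D; apply: hX.
suff [t th tE] : exists2 t, t \in shift (deg_part d) & t = \sum_(u <- s) u.1 * u.2 :> S.
  by rewrite (_ : w = t) //; apply: dhomog_inj; rewrite wE tE.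
elim: s hs {wE w} => [|u s IH] hs.
  by exists 0; rewrite ?mem0v // big_nil.
have [|t th tE] := IH; first by move=> v vs; apply: hs; rewrite inE vs orbT.
have [[uI [e [ed] ue]] u2] := hs u (mem_head _ _); have [c hc] := dhomog1_linear u2.
rewrite -ed in ue; have [v0 v0E] := dhomog_of (dhomogZ (c ord0) ue).
have [v1 v1E] := dhomog_of (dhomogZ (c ord_max) ue).
have [r rE] : exists r : D d.+1, r = u.1 * u.2 :> S.
  by apply: dhomog_of; have := dhomogM ue u2; rewrite addn1.
exists (r + t); last by rewrite linearD /= rE tE big_cons.
apply: rpredD => //; apply/shiftP; exists v0, v1.
have cI i : c i *: u.1 \in I by rewrite -mul_mpolyC idealMr.
split; rewrite ?deg_partP ?v0E ?v1E //.
by rewrite rE hc sum_ord2 -!mul_mpolyC; ring.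
Qed.

Lemma prev_space_sub d : (prev_space d <= deg_part d)%VS.
Proof.
by apply/subvP => w /prev_spaceP /prev_part_S1_mem [wI _]; rewrite deg_partP.
Qed.

Lemma std_size B d : standard_basis I B ->
  (size [seq f <- B | f \is d.-homog] + \dim (prev_space d))%N = \dim (deg_part d).
Proof.
move=> hB; set Bd := filter _ _.
have BdP f : f \in Bd -> f \in B /\ f \is d.-homog by rewrite mem_filter => /andP [].
pose b := [seq (to_dhomog d f) | f <- Bd].
have bE f : f \in Bd -> mpoly_of_dhomog (to_dhomog d f) = f.
  by move=> /BdP [_ hf]; apply: to_dhomogE.
have sumb (c : S -> K) : mpoly_of_dhomog (\sum_(x <- b) c x *: x) = \sum_(f <- B | f \is d.-homog) c f *: f.
  rewrite big_map linear_sum -[RHS]big_filter; apply: eq_big_seq => f /bE fE.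
  by rewrite linearZ; congr (_ *: _); [rewrite fE | exact: fE].
have -> : size Bd = size b by rewrite size_map.
apply: complement_size.
- by move=> _ /mapP [f fB ->]; rewrite deg_partP bE //; apply: std_mem hB _ _; case: (BdP f fB).
- exact: prev_space_sub.
- rewrite map_inj_in_uniq ?filter_uniq ?(std_uniq hB) // => f g fB gB.
  by move=> /(congr1 (@mpoly_of_dhomog _ _ _)); rewrite !bE.
- move=> u; rewrite deg_partP => uI.
  have [c hc] := std_expand hB uI (dhomog_is_dhomog u); exists (fun x : D d => c (mpoly_of_dhomog x)).
  by apply/prev_spaceP; rewrite linearB /= sumb.
- move=> c /prev_spaceP hc _ /mapP [f fB ->].
  have [fB' hf] := BdP f fB.
  apply: (std_indep hB (d := d) (c := fun f => c (to_dhomog d f)) _ fB' hf).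
  move: hc; rewrite big_map linear_sum -[in X in _ -> X]big_filter.
  rewrite (eq_big_seq (fun f => c (to_dhomog d f) *: f)) // => g /bE gE.
  by rewrite linearZ; congr (_ *: _); exact: gE.
Qed.

Lemma size_by_degree B : standard_basis I B -> exists N0, forall N, (N0 <= N)%N ->
  size B = \sum_(d < N) size [seq f <- B | f \is d.-homog].
Proof.
move=> hB; have [N0 hN0] := count_by_degree predT hB; exists N0 => N /hN0.
rewrite count_predT => ->; apply: eq_bigr => d _; rewrite size_filter.
by apply: eq_count => f; rewrite andbT.
Qed.

Lemma deg_part_lt a d : alpha I a -> (d < a)%N -> deg_part d = 0%VS.
Proof.
move=> ha da; apply/eqP; rewrite -subv0; apply/subvP => u; rewrite deg_partP memv0 => uI.
by apply/eqP/dhomog_inj; rewrite (alpha_lt ha uI (dhomog_is_dhomog u) da).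
Qed.

Lemma deg_part_neq0 a d : alpha I a -> (a <= d)%N -> deg_part d != 0%VS.
Proof.
move=> [B hB [[f fB fa] _]] /subnKC <-; apply/negP => /eqP U0.
have hg : 'X_ord0 ^+ (d - a) * f \is (a + (d - a)).-homog.
  by rewrite mulrC; apply: dhomogM fa _; apply/dhomog1X/dhomogXU.
have [u uE] := dhomog_of hg.
have : u \in deg_part (a + (d - a)) by rewrite deg_partP uE idealMr // (std_mem hB).
rewrite U0 memv0 => /eqP u0; move: uE; rewrite u0 => /esym /eqP.
by rewrite mulf_eq0 expf_eq0 (negPf (mpolyX_neq0 _ _)) andbF (negPf (std_neq0 hB fB)).
Qed.

Section MaximalNumberOfGenerators.
Variables (a : nat) (ha : alpha I a) (hnu : nu I a.+1).

Lemma prev_space_dim d : (a <= d)%N -> (\dim (deg_part d) < \dim (prev_space d.+1))%N.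
Proof. by move=> ad; apply/dim_shift_gt/(deg_part_neq0 ha). Qed.

Lemma dim_deg_part_le d : (\dim (deg_part d) <= d.+1)%N.
Proof. by rewrite -(dim_dhomog K d); apply/dimvS/subvf. Qed.

(** The inequality dim I_d + 1 <= dim I_d S_1, summed over the degrees d >= a, bounds
    the number of generators by a + 1. As this number is attained, equality holds in
    every degree, and I_d is the space of all forms for large d. *)
Lemma deg_part_shift_full :
  (forall d, (a <= d)%N -> \dim (prev_space d.+1) = (\dim (deg_part d)).+1) /\
  (exists N, forall d, (N <= d)%N -> deg_part d = fullv).
Proof.
have [B hB sB] := hnu; have [N0 hN0] := size_by_degree hB.
pose b d := size [seq f <- B | f \is d.-homog].
pose T j := \sum_(d < (a + j).+1) b d.
have bw d : (b d + \dim (prev_space d))%N = \dim (deg_part d) by apply: std_size.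
have Tmax j : (N0 <= j)%N -> T j = a.+1.
  by move=> jN; rewrite -sB (hN0 (a + j).+1) // leqW // (leq_trans jN) // leq_addl.
have TS j : T j.+1 = (T j + b (a + j).+1)%N by rewrite /T addnS big_ord_recr.
have step j s : (T j + s <= \dim (deg_part (a + j)))%N ->
    (T j.+1 + s.+1 <= \dim (deg_part (a + j.+1)))%N.
  move=> h; have := prev_space_dim (leq_addr j a); have := bw (a + j).+1.
  rewrite TS (addnS a j); lia.
have T0 : (T 0 <= \dim (deg_part a))%N.
  rewrite /T addn0 big_ord_recr /= big1 => [|d _]; first by have := bw a; lia.
  by have := bw d; rewrite (deg_part_lt ha) // dimv0; lia.
have Tj j : (T j + j <= \dim (deg_part (a + j)))%N.
  by elim: j => [|j IH]; [rewrite !addn0 | apply: step].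
split=> [d ad|].
  apply/eqP; rewrite eqn_leq prev_space_dim // andbT leqNgt; apply/negP => hd.
  have ex j : (T (d - a + j).+1 + (d - a + j).+2 <= \dim (deg_part (a + (d - a + j).+1)))%N.
    elim: j => [|j IH]; last by rewrite (addnS (d - a)%N j); apply: step.
    rewrite (addn0 (d - a)%N) TS (addnS a) subnKC //; have := Tj (d - a)%N; have := bw d.+1.
    by rewrite subnKC //; lia.
  have := ex N0; rewrite Tmax; last by lia.
  by have := dim_deg_part_le (a + (d - a + N0).+1); lia.
exists (a + N0)%N => d dN; apply/eqP; rewrite eqEdim subvf dim_dhomog.
have := Tj (d - a)%N; rewrite Tmax ?subnKC; lia.
Qed.

Lemma deg_part_multiples d : (a <= d)%N ->
  exists e k p, [/\ (k + e)%N = d, p \is k.-homog, p != 0 & deg_part d = multiples p e d].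
Proof.
move=> ad; apply: small_shift (deg_part_neq0 ha ad) _.
by have [/(_ d ad) /= -> _] := deg_part_shift_full.
Qed.

End MaximalNumberOfGenerators.
End DegreeParts.

(** * An e-maximal basis adapted to points *)

Section BasisFromDegrees.
Variables (n : nat) (K : closedFieldType) (I : idealr {mpoly K[n]}).
Local Notation S := {mpoly K[n]}.
Implicit Types (B : seq S) (f g : S) (d e : nat).

Variables (L : nat -> seq S) (N : nat).
Hypotheses (Ihom : homogeneous I)
  (Luniq : forall d, uniq (L d))
  (Lmem : forall d f, f \in L d -> f \in I /\ f \is d.-homog)
  (Lgen : forall d g, g \in I -> g \is d.-homog -> exists c : S -> K,
     prev_part_S1 I d (g - \sum_(f <- L d) c f *: f))
  (Lind : forall d (c : S -> K), prev_part_S1 I d (\sum_(f <- L d) c f *: f) ->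
     forall f, f \in L d -> c f = 0)
  (Lnil : forall d, (N <= d)%N -> L d = [::]).

Definition degree_union : seq S := flatten [seq L d | d <- iota 0 N].

Lemma L_neq0 d f : f \in L d -> f != 0.
Proof.
move=> fL; apply/eqP => f0.
have h : prev_part_S1 I d (\sum_(g <- L d) ((g == 0)%:R : K) *: g).
  rewrite big1; first exact: prev_part_S1_0.
  by move=> g _; case: eqP => [->|_]; rewrite ?scaler0 ?scale0r.
by have /eqP := Lind h fL; rewrite f0 eqxx oner_eq0.
Qed.

Lemma L_degree d e f : f \in L e -> f \is d.-homog -> d = e.
Proof. by move=> fL fd; have [_ fe] := Lmem fL; apply: dhomog_uniq (L_neq0 fL) fd fe. Qed.

Lemma mem_degree_union f : f \in degree_union -> exists2 d, (d < N)%N & f \in L d.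
Proof.
move=> /flattenP [_ /mapP [d dN ->] fL]; exists d => //.
by move: dN; rewrite mem_iota.
Qed.

Lemma filter_degree_union d : [seq f <- degree_union | f \is d.-homog] = L d.
Proof.
have filterL e : [seq f <- L e | f \is d.-homog] = if e == d then L d else [::].
  case: eqP => [->|ed]; first by apply/all_filterP/allP => f /Lmem [].
  apply/eqP; rewrite -[_ == _]negbK -has_filter; apply/hasPn => f fL.
  by apply/negP => fd; case: ed; rewrite (L_degree fL fd).
rewrite /degree_union filter_flatten -map_comp (eq_map filterL).
case: (ltnP d N) => dN; last first.
  rewrite Lnil //; apply/eqP; rewrite -size_eq0 size_flatten /shape -map_comp.
  by rewrite sumnE big_map big1 // => e _ /=; rewrite if_same.
have -> : iota 0 N = iota 0 d ++ d :: iota d.+1 (N - d.+1).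
  by rewrite -[d in d :: _]add0n -[_ :: _]/(iota (0 + d) (N - d.+1).+1) -iotaD; congr iota; lia.
have nilF s : d \notin s -> flatten [seq (if e == d then L d else [::]) | e <- s] = [::].
  elim: s => [|e s IH] //; rewrite inE negb_or eq_sym => /andP [/negPf ed /IH /= ->].
  by rewrite ed.
by rewrite map_cat flatten_cat /= eqxx !nilF ?cats0 //; rewrite mem_iota ?ltnn //.
Qed.

Lemma degree_union_uniq : uniq degree_union.
Proof.
rewrite /degree_union; elim: N => [|M IH] //.
rewrite -{1}[M.+1]addn1 iotaD map_cat flatten_cat /= cats0 add0n cat_uniq IH Luniq andbT /=.
apply/hasPn => f fM; apply/negP => /flattenP [_ /mapP [d dN ->] fd].
have [_ hf] := Lmem fM; move: dN.
by rewrite mem_iota add0n -(L_degree fd hf) ltnn andbF.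
Qed.

Lemma degree_union_std : standard_basis I degree_union.
Proof.
have mem d f : f \in L d -> f \in degree_union.
  by rewrite -filter_degree_union mem_filter => /andP [].
split.
- exact: degree_union_uniq.
- by move=> f /mem_degree_union [d _ /Lmem [_ hf]]; exists d.
- move=> f; split; last first.
    apply: (ideal_gen_min (idealr_ideal_like I)) => g /mem_degree_union [d _ /Lmem []] //.
  have hJ := ideal_gen_ideal (fun g => g \in degree_union).
  have hom d g : g \in I -> g \is d.-homog -> ideal_gen (fun g => g \in degree_union) g.
    elim/ltn_ind: d g => d IH g gI hg; have [c hc] := Lgen gI hg.
    apply: (ideal_likeBr hJ).
      by apply: (prev_part_S1P hJ _ hc) => u e de; apply: IH; rewrite de.
    apply: (ideal_like_sum_seq hJ) => b bL _; rewrite -mul_mpolyC.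
    by apply: (ideal_likeMl hJ); apply: ideal_gen_mem; apply: mem bL.
  move=> fI; rewrite (pihomog_partitionE (leqnn (msize f))).
  apply: (ideal_like_sum hJ) => d _; apply: (hom d); last exact: pihomogP.
  exact: Ihom.
- move=> d g gI hg; have [c hc] := Lgen gI hg; exists c.
  by rewrite -big_filter filter_degree_union.
- move=> d c; rewrite -big_filter filter_degree_union => hc f fB hf.
  by apply: (Lind hc); rewrite -filter_degree_union mem_filter hf.
Qed.

End BasisFromDegrees.

Section AdaptedBasis.
Variables (K : closedFieldType) (I : idealr {mpoly K[2]}) (a N : nat).
Local Notation S := {mpoly K[2]}.
Local Notation D := (dhomog 2 K).
Local Notation pt := ('I_2 -> K).
Hypotheses (ha : alpha I a) (a_gt0 : (0 < a)%N) (Ihom : homogeneous I).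
Hypothesis (Ifull : forall d, (N <= d)%N -> deg_part I d = fullv).
Implicit Types (B : seq S) (f g : S) (d e r : nat) (v : pt).

Definition base_point d v : Prop :=
  forall f e, (e < d)%N -> f \in I -> f \is e.-homog -> f.@[v] = 0.

(** Points which leave the base locus of I in degree d, where they are separated by
    forms of I. The largest possible r turns out to be the largest number of
    essential elements of degree d in a standard basis. *)
Definition separated d r (P : nat -> pt) (F : nat -> S) : Prop :=
  [/\ forall i, (i < r)%N -> base_point d (P i),
      forall i, (i < r)%N -> F i \in I /\ F i \is d.-homog
    & forall i j, (i < r)%N -> (j < r)%N -> (F i).@[P j] = (i == j)%:R].

Definition admissible d r : Prop := exists P F, separated d r P F.

Lemma separated_le d r P F : separated d r P F -> (r <= d.+1)%N.
Proof.
move=> [_ hF FP]; pose t : r.-tuple (D d) := [tuple to_dhomog d (F i) | i < r].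
have tE (i : 'I_r) : mpoly_of_dhomog t`_i = F i.
  by rewrite -tnth_nth tnth_mktuple; apply: to_dhomogE; case: (hF i (ltn_ord i)).
have ft : free t.
  apply/freeP => k E i; have := congr1 (fun u : D d => (mpoly_of_dhomog u).@[P i]) E.
  have tk (j : 'I_r) : (mpoly_of_dhomog (k j *: t`_j)).@[P i] = k j * (j == i)%:R.
    rewrite -[mpoly_of_dhomog _]/(k j *: mpoly_of_dhomog t`_j) mevalZ tE FP //.
  rewrite meval0 linear_sum raddf_sum (bigD1 i) //= tk eqxx mulr1.
  by rewrite big1 ?addr0 // => j /negPf ji; rewrite tk ji mulr0.
by rewrite -(size_tuple t) -(eqP ft) -(dim_dhomog K d); apply/dimvS/subvf.
Qed.

Lemma form_vanishing f d : (N <= d)%N -> f \is d.-homog -> f \in I.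
Proof.
move=> Nd hf; have [u <-] := dhomog_of hf.
by rewrite -deg_partP Ifull // memvf.
Qed.

Lemma nonzero_not_base v : nonzero v -> exists2 f, f \in I & f.@[v] != 0.
Proof.
move=> [i vi]; exists ('X_i ^+ N); last by rewrite rmorphXn /= mevalXU expf_neq0.
by apply: (form_vanishing (leqnn N)); apply/dhomog1X/dhomogXU.
Qed.

(** Without a common zero the other elements would generate an ideal containing
    powers of both variables. Such a zero is not a zero of f, since I contains all
    forms of large degree. *)
Lemma essential_has_point B f : standard_basis I B -> f \in B -> essential B f ->
  exists v, f.@[v] != 0 /\ forall b, b \in B -> b <> f -> b.@[v] = 0.
Proof.
move=> hB fB ef; pose P b := b \in B /\ b <> f.
have [v [v0 vP]] : exists v, nonzero v /\ forall b, P b -> b.@[v] = 0.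
  apply: contrapT => H; apply: ef.
  have [|M hM] := @choice _ _ (fun i M => ideal_gen P ('X_i ^+ M)).
    apply: binary_nullstellensatz => [b [/(std_homog hB)] //|v v0].
    apply: contrapT => Hv; apply: H; exists v; split=> // b Pb.
    by apply/eqP/negPn/negP => bv; apply: Hv; exists b.
  apply: (@inessentialI _ _ _ _ (M ord0 + M ord_max)) => i.
  apply: (ideal_likeMl (ideal_gen_ideal _)).
  apply: (ideal_like_exp_le (ideal_gen_ideal _) _ (hM i)).
  by elim/ord2_cases: i; rewrite ?leq_addr ?leq_addl.
exists v; split; last by move=> b bB bf; apply: vP.
apply/negP => /eqP fv; have [g gI /negP] := nonzero_not_base v0; apply.
have hQ : ideal_like (fun g : S => g.@[v] = 0).
  by split=> [|g1 g2 h1 h2|g1 u h1]; rewrite ?meval0 ?mevalD ?mevalM ?h1 ?h2 ?addr0 ?mul0r.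
case: hB => _ _ hI _ _; move/hI: gI => /(ideal_gen_min hQ) -> // b bB.
by have [->|/eqP bf] := eqVneq b f; last exact: vP.
Qed.

Lemma num_essential_admissible B d : standard_basis I B -> admissible d (num_essential_deg B d).
Proof.
move=> hB; rewrite /num_essential_deg -size_filter; set E := [seq _ <- B | _].
have EP f : f \in E -> [/\ f \in B, f \is d.-homog & essential B f].
  by rewrite mem_filter => /andP [/andP [hf /asboolP ef] fB].
have [|P hP] := @choice _ _ (fun (f : S) (v : pt) => f \in E ->
    f.@[v] != 0 /\ forall b, b \in B -> b <> f -> b.@[v] = 0).
  move=> f; case: (boolP (f \in E)) => [fE|_]; last by exists (fun=> 0).
  have [fB _ ef] := EP f fE; have [v hv] := essential_has_point hB fB ef.
  by exists v.
exists (fun i => P (E`_i)), (fun i => ((E`_i).@[P (E`_i)])^-1 *: E`_i).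
have EnP i : (i < size E)%N -> E`_i \in E by apply: mem_nth.
split=> [i /EnP fE|i /EnP fE|i j iE jE].
- have [fB hf _] := EP _ fE; have [_ hv] := hP _ fE.
  have hQ : ideal_like (fun g : S => g.@[P (E`_i)] = 0).
    by split=> [|g1 g2 h1 h2|g1 u h1]; rewrite ?meval0 ?mevalD ?mevalM ?h1 ?h2 ?addr0 ?mul0r.
  move=> g e ed gI ge; apply: (std_lower hB hQ _ ed gI ge) => b k bB bk kd.
  apply: hv => // bf; move: kd; rewrite bf in bk.
  by rewrite (std_homog_uniq hB fB hf bk) ltnn.
- have [fB hf _] := EP _ fE; split; last exact: dhomogZ.
  by rewrite -mul_mpolyC idealMr // (std_mem hB).
- have [fv hv] := hP _ (EnP j jE); rewrite mevalZ; case: (eqVneq i j) => [->|ij].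
    by rewrite mulVf.
  have [fB _ _] := EP _ (EnP i iE); rewrite hv ?mulr0 //; apply/eqP.
  by rewrite nth_uniq // filter_uniq // (std_uniq hB).
Qed.

Lemma exists_max_admissible d : exists r, admissible d r /\ forall r', admissible d r' -> (r' <= r)%N.
Proof.
have exP : exists r, `[< admissible d r >].
  by exists 0%N; apply/asboolP; exists (fun _ _ => 0), (fun=> 0); split.
have maxP r : `[< admissible d r >] -> (r <= d.+1)%N.
  by move=> /asboolP [P [F]] /separated_le.
case: (ex_maxnP exP maxP) => r /asboolP hr rmax; exists r; split=> // r' hr'.
by apply: rmax; apply/asboolP.
Qed.

Lemma max_separated : exists (rk : nat -> nat) (P : nat -> nat -> pt) (F : nat -> nat -> S),
  (forall d, separated d (rk d) (P d) (F d)) /\ (forall d r, admissible d r -> (r <= rk d)%N).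
Proof.
have [rk hrk] := choice exists_max_admissible.
have [P hP] := choice (fun d => (hrk d).1); have [F hF] := choice hP.
by exists rk, P, F; split=> [//|d r]; case: (hrk d) => _; apply.
Qed.

Section WithPoints.
Variables (rk : nat -> nat) (P : nat -> nat -> pt) (F : nat -> nat -> S).
Hypothesis (hsep : forall d, separated d (rk d) (P d) (F d)).

Lemma rk_nonzero d i : (i < rk d)%N -> (0 < d)%N /\ nonzero (P d i).
Proof.
move=> ir; have [_ hF FP] := hsep d; have [FI Fd] := hF i ir; have Fi := FP i i ir ir.
rewrite eqxx in Fi.
have d0 : (0 < d)%N.
  rewrite lt0n; apply/eqP => d0; rewrite d0 in Fi FI Fd.
  by move: Fi; rewrite (alpha_lt ha FI Fd a_gt0) meval0 => /eqP; rewrite eq_sym oner_eq0.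
split=> //; apply: contrapT => H; case: d d0 ir Fd Fi H {hF FP FI} => // d _ ir Fd Fi H.
have P0 : P d.+1 i =1 fun=> 0.
  by move=> j; apply/eqP/negPn/negP => Pj; apply: H; exists j.
by move: Fi; rewrite (meval_eq _ P0) (dhomog_eval0 Fd) => /eqP; rewrite eq_sym oner_eq0.
Qed.

(** Passing from d to d + 1, a form which separates an old point is multiplied by a
    linear form equal to 1 there; the new points are base points in degree d, and
    the forms which separate them are corrected at the old points by the former. *)
Lemma interpolation d : exists G : nat -> nat -> S, forall e i, (e <= d)%N -> (i < rk e)%N ->
  [/\ G e i \in I, G e i \is d.-homog, ((e < d)%N -> prev_part_S1 I d (G e i)) &
      forall e' j, (e' <= d)%N -> (j < rk e')%N -> (G e i).@[P e' j] = ((e == e') && (i == j))%:R].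
Proof.
elim: d => [|d [G hG]].
  exists F => e i; rewrite leqn0 => /eqP -> ir; have [_ hF FP] := hsep 0%N.
  have [FI Fd] := hF i ir; split=> // e' j; rewrite leqn0 => /eqP -> jr.
  by rewrite FP // eqxx.
have [|h hh] := @choice _ _ (fun (p : nat * nat) (h : S) => (p.2 < rk p.1)%N ->
    h \is 1.-homog /\ h.@[P p.1 p.2] = 1).
  move=> [e i] /=; case: (boolP (i < rk e)%N) => [ir|_]; last by exists 0.
  have [_ [l Pl]] := rk_nonzero ir; exists ((P e i l)^-1 *: 'X_l) => _.
  by rewrite mevalZ mevalXU mulVf //; split=> //; apply/dhomogZ/dhomogXU.
pose G1 e i := G e i * h (e, i).
have hG1 e i : (e <= d)%N -> (i < rk e)%N -> [/\ G1 e i \in I, G1 e i \is d.+1.-homog,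
    prev_part_S1 I d.+1 (G1 e i) & forall e' j, (e' <= d.+1)%N -> (j < rk e')%N ->
      (G1 e i).@[P e' j] = ((e == e') && (i == j))%:R].
  move=> ed ir; have [GI Gd _ GP] := hG e i ed ir; have [h1 hP] := hh (e, i) ir.
  have G1p : prev_part_S1 I d.+1 (G1 e i).
    by have := prev_part_S1M GI Gd h1 isT; rewrite addn1.
  have [G1I G1d] := prev_part_S1_mem G1p.
  split=> // e' j; rewrite leq_eqVlt => /orP [/eqP -> jr|e'd jr].
    rewrite mevalM; have [base _ _] := hsep d.+1; rewrite (base j jr _ d) // mul0r.
    by rewrite ltn_eqF.
  rewrite mevalM GP //; case: (e =P e') => [ee|_] /=; last by rewrite mul0r.
  by case: (i =P j) => [ij|_] /=; rewrite ?mul0r // -ee -ij hP mulr1.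
pose Fd i : S := F d.+1 i - \sum_(e < d.+1) \sum_(j < rk e) (F d.+1 i).@[P e j] *: G1 e j.
exists (fun e i => if e == d.+1 then Fd i else G1 e i) => e i.
rewrite leq_eqVlt ltnS => /orP [/eqP ->|ed]; last first.
  move=> ir; rewrite ltn_eqF //; have [G1I G1d G1p G1P] := hG1 e i ed ir.
  by split.
rewrite eqxx => ir; have [base hF FP] := hsep d.+1; have [FI Fh] := hF i ir.
have val e1 e' j : (e1 <= d)%N -> (e' <= d.+1)%N -> (j < rk e')%N ->
    (\sum_(j1 < rk e1) (F d.+1 i).@[P e1 j1] *: G1 e1 j1).@[P e' j] =
    (e1 == e')%:R * (F d.+1 i).@[P e' j].
  move=> e1d e'd jr.
  transitivity (\sum_(j1 < rk e1) (F d.+1 i).@[P e1 j1] * ((e1 == e') && (j1 == j :> nat))%:R).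
    rewrite raddf_sum; apply: eq_bigr => j1 _; rewrite /= mevalZ.
    by have [_ _ _ ->] := hG1 e1 j1 e1d (ltn_ord j1).
  case: (e1 =P e') => [ee|_]; last by rewrite mul0r big1 // => j1 _; rewrite mulr0.
  move: jr; rewrite -ee => jr; rewrite mul1r (bigD1 (Ordinal jr)) //= eqxx mulr1 big1 ?addr0 //.
  by move=> j1; rewrite -val_eqE /= => /negPf ->; rewrite mulr0.
split; last first.
- move=> e' j e'd jr; rewrite mevalB [X in _ - X]raddf_sum /=.
  transitivity ((F d.+1 i).@[P e' j] - \sum_(e1 < d.+1) (e1 == e' :> nat)%:R * (F d.+1 i).@[P e' j]).
    by congr (_ - _); apply: eq_bigr => e1 _; apply: val => //; apply: leq_ord.
  move: e'd; rewrite leq_eqVlt => /orP [/eqP e'E|e'd].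
    move: jr; rewrite e'E => jr; rewrite FP // eqxx big1 ?subr0 // => e1 _.
    by rewrite ltn_eqF ?mul0r.
  rewrite [d.+1 == e']gtn_eqF // (bigD1 (Ordinal e'd)) //= eqxx mul1r big1 ?addr0 ?subrr //.
  by move=> e1; rewrite -val_eqE /= => /negPf ->; rewrite mul0r.
- by rewrite ltnn.
- apply: rpredB Fh _; apply: rpred_sum => e1 _; apply: rpred_sum => j1 _.
  by apply: dhomogZ; have [] := hG1 e1 j1 (leq_ord e1) (ltn_ord j1).
- apply: rpredB FI _; apply: rpred_sum => e1 _; apply: rpred_sum => j1 _.
  by rewrite -mul_mpolyC; apply: idealMr; have [] := hG1 e1 j1 (leq_ord e1) (ltn_ord j1).
Qed.

Lemma base_point_prev d v f : base_point d v -> prev_part_S1 I d f -> f.@[v] = 0.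
Proof.
move=> hv; apply: (@prev_part_S1P _ _ (fun f => f.@[v] = 0)).
  by split=> [|g1 g2 h1 h2|g1 u h1]; rewrite ?meval0 ?mevalD ?mevalM ?h1 ?h2 ?addr0 ?mul0r.
by move=> u e de uI ue; apply: (hv u e) => //; rewrite de.
Qed.

(** The forms dual to the points of degree d are completed to generators by forms
    vanishing at all the points of degree at most d; interpolation shows that these,
    together with I_(d-1) S_1, span I_d. *)
Lemma degree_list d : exists (L : seq S) (G : nat -> S),
  [/\ uniq L, forall f, f \in L -> f \in I /\ f \is d.-homog,
      forall g, g \in I -> g \is d.-homog ->
        exists c : S -> K, prev_part_S1 I d (g - \sum_(f <- L) c f *: f),
      forall c : S -> K, prev_part_S1 I d (\sum_(f <- L) c f *: f) ->
        forall f, f \in L -> c f = 0 &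
      [/\ forall i, (i < rk d)%N -> G i \in L,
          forall i j, (i < rk d)%N -> (j < rk d)%N -> (G i).@[P d j] = (i == j)%:R &
      forall f, f \in L -> forall e j, (e <= d)%N -> (j < rk e)%N ->
        f.@[P e j] = ((e == d) && (f == G j))%:R]].
Proof.
have [G0 hG] := interpolation d; pose G := G0 d.
have hGd i : (i < rk d)%N -> [/\ G i \in I, G i \is d.-homog & forall e j, (e <= d)%N ->
    (j < rk e)%N -> (G i).@[P e j] = ((e == d) && (i == j))%:R].
  move=> ir; have [GI Gd _ GP] := hG d i (leqnn d) ir.
  by split=> // e j ed jr; rewrite GP // [d == e]eq_sym.
pose s1 := [seq to_dhomog d (G i) | i <- iota 0 (rk d)].
have s1P x : x \in s1 -> exists2 i, (i < rk d)%N & mpoly_of_dhomog x = G i.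
  move=> /mapP [i]; rewrite mem_iota add0n => ir ->; exists i => //.
  by apply: to_dhomogE; have [] := hGd i ir.
have [||K0 hK0] := @vspace_of_closed _ (D d) (fun u => mpoly_of_dhomog u \in I /\
    forall e j, (e <= d)%N -> (j < rk e)%N -> (mpoly_of_dhomog u).@[P e j] = 0).
- by split=> [|e j _ _]; [apply: rpred0 | apply: meval0].
- move=> c u v [uI u0] [vI v0]; split=> [|e j ed jr].
    by rewrite linearP /= -mul_mpolyC; apply: rpredD => //; apply: idealMr.
  rewrite -[mpoly_of_dhomog _]/(c *: mpoly_of_dhomog u + mpoly_of_dhomog v).
  by rewrite mevalD mevalZ u0 // v0 // mulr0 addr0.
pose W := prev_space I d; pose s2 := (vbasis (K0 :\: (W + <<s1>>)) : seq (D d)).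
have s2K x : x \in s2 -> x \in K0.
  by move=> /vbasis_mem; apply/subvP/diffvSl.
have ev1 x e j : x \in s1 -> (e <= d)%N -> (j < rk e)%N ->
    (mpoly_of_dhomog x).@[P e j] = ((e == d) && (mpoly_of_dhomog x == G j))%:R.
  move=> /s1P [i ir ->] ed jr; have [_ _ GP] := hGd i ir; rewrite GP //.
  case: (e =P d) => //= ee; move: jr; rewrite ee => jr.
  congr (_%:R); case: (i =P j) => [->|ij]; first by rewrite eqxx.
  case: eqP => // /(congr1 (meval (P d j))); have [_ _ GPj] := hGd j jr.
  by rewrite GP // GPj // !eqxx /=; case: eqP => // _ /eqP; rewrite eq_sym oner_eq0.
have G1 j : (j < rk d)%N -> (G j).@[P d j] = 1.
  by move=> jr; have [_ _ GPj] := hGd j jr; rewrite GPj // !eqxx.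
have ev2 x e j : x \in s2 -> (e <= d)%N -> (j < rk e)%N ->
    (mpoly_of_dhomog x).@[P e j] = ((e == d) && (mpoly_of_dhomog x == G j))%:R.
  move=> /s2K /hK0 [_ x0] ed jr; rewrite x0 //; case: (e =P d) => //= ee; move: jr; rewrite ee => jr.
  case: eqP => // /(congr1 (meval (P d j))); by rewrite x0 // G1 // => /esym /eqP; rewrite oner_eq0.
have us1 : uniq s1.
  rewrite map_inj_in_uniq ?iota_uniq // => i j; rewrite !mem_iota !add0n => ir jr.
  have [_ hi GPi] := hGd i ir; have [_ hj _] := hGd j jr.
  move=> /(congr1 (@mpoly_of_dhomog _ _ _)); rewrite !to_dhomogE //.
  move=> /(congr1 (meval (P d j))); rewrite GPi // G1 // eqxx.
  by case: eqP => // _ /eqP; rewrite eq_sym oner_eq0.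
have us2 : uniq s2 by apply: free_uniq; apply: basis_free (vbasisP _).
have s12 x : x \in s1 -> x \notin s2.
  move=> xs1; apply/negP => xs2; have [i ir xE] := s1P x xs1.
  have [_ x0] := (hK0 x).1 (s2K x xs2).
  by have := x0 d i (leqnn d) ir; rewrite xE G1 // => /eqP; rewrite oner_eq0.
have us : uniq (s1 ++ s2).
  rewrite cat_uniq us1 us2 andbT; apply/hasPn => x xs2; apply/negP => xs1.
  by move: (s12 x xs1); rewrite xs2.
have Wev w j : w \in W -> (j < rk d)%N -> (mpoly_of_dhomog w).@[P d j] = 0.
  move=> /prev_spaceP wW jr; apply: base_point_prev wW; have [base _ _] := hsep d.
  exact: base.
have val_uniq : injective (@mpoly_of_dhomog 2 K d) by move=> x1 x2; apply: dhomog_inj.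
exists (map (@mpoly_of_dhomog 2 K d) (s1 ++ s2)), G.
have dE (x : D d) : to_dhomog d (mpoly_of_dhomog x) = x.
  by apply: dhomog_inj; apply/to_dhomogE/dhomog_is_dhomog.
have sumE (c : S -> K) : \sum_(f <- map (@mpoly_of_dhomog 2 K d) (s1 ++ s2)) c f *: f =
    mpoly_of_dhomog (\sum_(x <- s1 ++ s2) c (mpoly_of_dhomog x) *: x).
  by rewrite big_map linear_sum; apply: eq_bigr => x _; rewrite linearZ.
split.
- by rewrite map_inj_uniq.
- move=> _ /mapP [x xs ->]; split; last exact: dhomog_is_dhomog.
  move: xs; rewrite mem_cat => /orP [/s1P [i ir ->]|/s2K /hK0 [] //].
  by have [] := hGd i ir.
- move=> g gI hg; have [u uE] := dhomog_of hg.
  have : u \in ((W + <<s1>>) + (K0 :\: (W + <<s1>>)))%VS.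
    rewrite addvC addv_diff.
    pose t := \sum_(e < d.+1) \sum_(j < rk e) g.@[P e j] *: to_dhomog d (G0 e j).
    have tev e' j' : (e' <= d)%N -> (j' < rk e')%N -> (mpoly_of_dhomog t).@[P e' j'] = g.@[P e' j'].
      move=> e'd j'r; transitivity (\sum_(e < d.+1) \sum_(j < rk e)
          g.@[P e j] * ((e == e' :> nat) && (j == j' :> nat))%:R).
        rewrite linear_sum raddf_sum; apply: eq_bigr => e _.
        rewrite /= linear_sum raddf_sum; apply: eq_bigr => j _.
        have [GI Gd _ GP] := hG e j (leq_ord e) (ltn_ord j).
        transitivity (g.@[P e j] * (mpoly_of_dhomog (to_dhomog d (G0 e j))).@[P e' j']).
          exact: mevalZ.
        by rewrite to_dhomogE // GP.
      have e'd1 : (e' < d.+1)%N by [].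
      rewrite (bigD1 (Ordinal e'd1)) //= [X in _ + X]big1 ?addr0 => [|e].
        rewrite (bigD1 (Ordinal j'r)) //= !eqxx mulr1 big1 ?addr0 // => j.
        by rewrite -val_eqE /= => /negPf ->; rewrite mulr0.
      by rewrite -val_eqE /= => /negPf ->; rewrite big1 // => j _; rewrite mulr0.
    have tW : t \in (W + <<s1>>)%VS.
      apply: rpred_sum => e _; apply: rpred_sum => j _; apply: rpredZ.
      move: (nat_of_ord j) (ltn_ord j) => {}j; move: (nat_of_ord e) (leq_ord e) => {}e ed jr.
      have [GI Gd Gp _] := hG e j ed jr; move: ed; rewrite leq_eqVlt => /orP [/eqP ed|ed].
        apply/(subvP (addvSr _ _))/memv_span/mapP; exists j; rewrite ?mem_iota ?add0n -?ed //.
        by rewrite /G -ed.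
      by apply: (subvP (addvSl _ _)); apply/prev_spaceP; rewrite to_dhomogE //; apply: Gp.
    have WU : (W + <<s1>> <= deg_part I d)%VS.
      apply/subvP => _ /memv_addP [w wW [v vs ->]]; apply: rpredD.
        exact: (subvP (prev_space_sub I d)).
      move: v vs; apply/subvP/span_subvP => x /s1P [i ir xE].
      by rewrite deg_partP xE; have [] := hGd i ir.
    rewrite -[u](subrK t); apply: memv_add => //; apply/hK0; split.
      by rewrite linearB /= uE; apply: rpredB gI _; rewrite -deg_partP; apply: (subvP WU).
    move=> e j ed jr; transitivity ((mpoly_of_dhomog u).@[P e j] - (mpoly_of_dhomog t).@[P e j]).
      exact: mevalB.
    by rewrite tev // uE subrr.
  rewrite -addvA -(span_basis (vbasisP (K0 :\: (W + <<s1>>)))) -span_cat.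
  move=> /memv_addP [w wW [v /(span_seqP us) [c ->] uv]].
  exists (fun f => c (to_dhomog d f)); rewrite sumE -uE uv.
  have -> : \sum_(x <- s1 ++ s2) c (to_dhomog d (mpoly_of_dhomog x)) *: x = \sum_(x <- s1 ++ s2) c x *: x.
    by apply: eq_bigr => x _; rewrite dE.
  by rewrite -linearB /= addrK; apply/prev_spaceP.
- move=> c; rewrite sumE => /prev_spaceP; set t := \sum_(x <- _) _ => tW.
  have c1 x : x \in s1 -> c (mpoly_of_dhomog x) = 0.
    move=> xs1; have [i ir xE] := s1P x xs1.
    have tsum : (mpoly_of_dhomog t).@[P d i] =
        \sum_(y <- s1 ++ s2) c (mpoly_of_dhomog y) * (mpoly_of_dhomog y).@[P d i].
      by rewrite /t linear_sum raddf_sum; apply: eq_bigr => y _; apply: mevalZ.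
    have := Wev t i tW ir; rewrite tsum (bigD1_seq x) ?mem_cat ?xs1 //=.
    rewrite big_seq_cond big1 => [|y /andP [ys yx]]; first by rewrite addr0 xE G1 // mulr1.
    have -> : (mpoly_of_dhomog y).@[P d i] = ((d == d) && (mpoly_of_dhomog y == G i))%:R.
      by move: ys; rewrite mem_cat => /orP [ys|ys]; [apply: ev1 | apply: ev2].
    by rewrite -xE (inj_eq val_uniq) (negPf yx) andbF mulr0.
  have tE : t = \sum_(x <- s2) c (mpoly_of_dhomog x) *: x.
    by rewrite /t big_cat /= big_seq big1 ?add0r // => x /c1 ->; rewrite scale0r.
  have t0 : t = 0.
    apply/eqP; rewrite -memv0 -(capv_diff K0 (W + <<s1>>)) memv_cap; apply/andP; split.
      by rewrite tE big_seq; apply: rpred_sum => x xs; apply/rpredZ/vbasis_mem.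
    by apply: (subvP (addvSl _ _)).
  move=> _ /mapP [x + ->]; rewrite mem_cat => /orP [/c1 //|xs2].
  have fs2 : free s2 by apply: basis_free (vbasisP _).
  by move: tE; rewrite t0 => /esym /(free_seqP fs2) -> .
split=> [i ir|i j ir jr|_ /mapP [x xs ->] e j ed jr].
- have [GI Gd _] := hGd i ir; apply/mapP; exists (to_dhomog d (G i)); last by rewrite to_dhomogE.
  by rewrite mem_cat; apply/orP; left; apply/mapP; exists i; rewrite // mem_iota.
- by have [_ _ GPi] := hGd i ir; rewrite GPi // eqxx.
- by move: xs; rewrite mem_cat => /orP [xs|xs]; [apply: ev1 | apply: ev2].
Qed.

Lemma prev_space_full d : (N <= d)%N -> prev_space I d.+1 = fullv.
Proof.
move=> Nd; apply/eqP; rewrite eqEdim subvf dim_dhomog.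
have U0 : deg_part I d != 0%VS by rewrite -dimv_eq0 Ifull // dim_dhomog.
by have := dim_shift_gt U0; rewrite [X in \dim X]Ifull // dim_dhomog.
Qed.

Hypothesis hmax : forall d r, admissible d r -> (r <= rk d)%N.

(** The forms dual to the points are essential, as all other elements vanish at the
    corresponding point. So the number of essential elements is as large as possible
    in all degrees at the same time. *)
Lemma adapted_basis : exists2 B, e_maximal I B & forall d, (rk d <= num_essential_deg B d)%N.
Proof.
have [L hL] := choice degree_list; have [G hG] := choice hL.
have Luniq d : uniq (L d) by have [] := hG d.
have Lmem d f : f \in L d -> f \in I /\ f \is d.-homog by have [_ + _ _ _] := hG d; apply.
have Lgen d g : g \in I -> g \is d.-homog -> exists c : S -> K,
    prev_part_S1 I d (g - \sum_(f <- L d) c f *: f) by have [_ _ + _ _] := hG d; apply.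
have Lind d (c : S -> K) : prev_part_S1 I d (\sum_(f <- L d) c f *: f) ->
    forall f, f \in L d -> c f = 0 by have [_ _ _ + _] := hG d; apply.
have Lnil d : (N.+1 <= d)%N -> L d = [::].
  case: d => // d Nd; case E: (L d.+1) => [//|f s].
  have fL : f \in L d.+1 by rewrite E mem_head.
  have /Lind /(_ f fL) : prev_part_S1 I d.+1 (\sum_(g <- L d.+1) ((g == f)%:R : K) *: g).
    rewrite (bigD1_seq f) //= eqxx scale1r big1 ?addr0 => [|g /negPf ->]; last by rewrite scale0r.
    have [u <-] := dhomog_of (Lmem _ _ fL).2.
    by apply/prev_spaceP; rewrite prev_space_full ?memvf.
  by rewrite eqxx => /eqP; rewrite oner_eq0.
pose B := degree_union L N.+1.
have hB : standard_basis I B by apply: degree_union_std.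
have BL d : [seq f <- B | f \is d.-homog] = L d by apply: filter_degree_union Lmem Lind Lnil d.
have numB d : (rk d <= num_essential_deg B d)%N.
  have [_ _ _ _ [GL Gij GP]] := hG d.
  have Gev i : (i < rk d)%N -> (G d i).@[P d i] = 1.
    by move=> ir; rewrite Gij // eqxx.
  pose s := [seq G d i | i <- iota 0 (rk d)].
  have us : uniq s.
    rewrite map_inj_in_uniq ?iota_uniq // => i j; rewrite !mem_iota !add0n => ir jr.
    move=> /(congr1 (meval (P d j))); rewrite !Gij // eqxx.
    by case: eqP => // _ /eqP; rewrite eq_sym oner_eq0.
  have -> : rk d = size s by rewrite size_map size_iota.
  rewrite /num_essential_deg -size_filter; apply: uniq_leq_size => // _ /mapP [i + ->].
  rewrite mem_iota add0n => ir; have [d0 _] := rk_nonzero ir.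
  have GB : G d i \in B by move: (GL i ir); rewrite -BL mem_filter => /andP [].
  have [_ Gd] := Lmem _ _ (GL i ir); rewrite mem_filter GB Gd andbT /=; apply/asboolP.
  case: d d0 ir {us s} GL GP {Gij} Gev GB Gd => // d _ ir GL GP Gev GB Gd.
  apply: (essential_point (v := P d.+1 i) Gd); first by rewrite Gev // oner_neq0.
  move=> b /mem_degree_union [e _ be] bG.
  have [bI bd] := Lmem _ _ be; case: (ltngtP e d.+1) => ed.
  - by have [base _ _] := hsep d.+1; apply: (base i ir b e).
  - have [_ _ _ _ [_ _ GPe]] := hG e; rewrite (GPe b be) ?(ltnW ed) //.
    by rewrite ltn_eqF.
  - by move: be; rewrite ed => be; rewrite (GP b be) // (negPf bG) andbF.
exists B => //; split=> // d; split; first by exists B.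
move=> B' hB'; apply: leq_trans (numB d); apply: hmax; exact: num_essential_admissible.
Qed.

End WithPoints.

Lemma std_size_uniq B B' : standard_basis I B -> standard_basis I B' -> size B = size B'.
Proof.
move=> hB hB'; have [M hM] := size_by_degree hB; have [M' hM'] := size_by_degree hB'.
rewrite (hM (maxn M M')) ?leq_maxl // (hM' (maxn M M')) ?leq_maxr //.
by apply: eq_bigr => d _; apply/eqP; rewrite -(eqn_add2r (\dim (prev_space I d))) !std_size.
Qed.

(** In an adapted basis at least as many elements are essential as there are
    separated points, and essential elements are not strongly inessential. *)
Lemma admissible_bound s d1 d2 d3 r1 r2 r3 : nu I (s + 2) ->
  (forall B, e_maximal I B -> num_strongly_inessential I B = s) ->
  uniq [:: d1; d2; d3] -> admissible d1 r1 -> admissible d2 r2 -> admissible d3 r3 ->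
  (r1 + r2 + r3 <= 2)%N.
Proof.
move=> [B0 hB0 sB0] hsi ud a1 a2 a3.
have [rk [P [F [hsep hmax]]]] := max_separated.
have [B Bmax rkB] := adapted_basis hsep hmax; have [hB _] := Bmax.
have {a1} := leq_trans (hmax _ _ a1) (rkB d1); have {a2} := leq_trans (hmax _ _ a2) (rkB d2).
have {a3} := leq_trans (hmax _ _ a3) (rkB d3).
have sB : size B = (s + 2)%N by rewrite (std_size_uniq hB hB0).
have : (num_strongly_inessential I B + num_essential B <= size B)%N.
  rewrite /num_strongly_inessential /num_essential -count_predUI.
  rewrite [X in (_ + X)%N](_ : _ = 0%N) ?addn0 ?count_size //.
  apply/eqP; rewrite -leqn0 leqNgt -has_count; apply/hasPn => f fB /=.
  apply/negP => /andP [/asboolP [d [_ _ _ /(_ B hB fB) fi]] /asboolP]; exact.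
rewrite (hsi B Bmax) sB; have [M hM] := count_by_degree (fun f => `[< essential B f >]) hB.
pose M' := (M + d1 + d2 + d3).+1.
rewrite /num_essential (hM M'); last by rewrite /M'; lia.
have [m1 m2 m3] : [/\ (d1 < M')%N, (d2 < M')%N & (d3 < M')%N] by rewrite /M'; split; lia.
rewrite -/(num_essential_deg B _).
rewrite (bigD1 (Ordinal m1)) //= (bigD1 (Ordinal m2)) /=; last first.
  by move: ud; rewrite -val_eqE /= !inE; case: (d1 =P d2) => //; lia.
rewrite (bigD1 (Ordinal m3)) /=; last first.
  by move: ud; rewrite -!val_eqE /= !inE; lia.
rewrite /num_essential_deg; lia.
Qed.

End AdaptedBasis.

(** * The ideal is a chain of powers of one linear form *)

Section SingleLine.
Variables (K : closedFieldType) (I : idealr {mpoly K[2]}) (a : nat).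
Local Notation S := {mpoly K[2]}.
Local Notation D := (dhomog 2 K).
Local Notation pt := ('I_2 -> K).
Implicit Types (B : seq S) (f g : S) (d e r : nat) (v w : pt).

(** Choose greedily a form of U vanishing at the previous points, and a point where
    it does not vanish. *)
Lemma separated_dual d (U : {vspace D d}) r : (r <= \dim U)%N ->
  exists (P : nat -> pt) (F : nat -> S),
    (forall i, (i < r)%N -> exists2 u, u \in U & F i = mpoly_of_dhomog u) /\
    (forall i j, (i < r)%N -> (j < r)%N -> (F i).@[P j] = (i == j)%:R).
Proof.
elim: r => [|r IH] rU; first by exists (fun _ _ => 0), (fun=> 0).
have [P [F [FU FP]]] := IH (ltnW rU).
pose t : seq (D d) := [seq to_dhomog d (F i) | i <- iota 0 r].
have tE i : (i < r)%N -> mpoly_of_dhomog (to_dhomog d (F i)) = F i.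
  by move=> /FU [u uU ->]; apply/to_dhomogE/dhomog_is_dhomog.
have [u uU ut] : exists2 u, u \in U & u \notin <<t>>%VS.
  apply: contrapT => H; move: rU; rewrite ltnNge; apply/negP/negPn.
  apply: (@leq_trans (\dim <<t>>)); last by rewrite -[X in (_ <= X)%N](size_iota 0 r) -(size_map (fun i => to_dhomog d (F i))) dim_span.
  apply: dimvS; apply/subvP => u uU; apply: contraT => ut; case: H; by exists u.
pose f := mpoly_of_dhomog (u - \sum_(i < r) (mpoly_of_dhomog u).@[P i] *: to_dhomog d (F i)).
have f0 : f != 0.
  apply: contraNneq ut => f0; have /eqP : u - \sum_(i < r) (mpoly_of_dhomog u).@[P i] *: to_dhomog d (F i) = 0.
    exact: dhomog_inj.
  rewrite subr_eq0 => /eqP ->; apply: rpred_sum => i _; apply/rpredZ/memv_span/mapP.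
  by exists (i : nat); rewrite // mem_iota add0n ltn_ord.
have fP j : (j < r)%N -> f.@[P j] = 0.
  move=> jr; transitivity ((mpoly_of_dhomog u).@[P j] -
      \sum_(i < r) (mpoly_of_dhomog u).@[P i] * (i == j :> nat)%:R).
    transitivity ((mpoly_of_dhomog u).@[P j] - (mpoly_of_dhomog
        (\sum_(i < r) (mpoly_of_dhomog u).@[P i] *: to_dhomog d (F i))).@[P j]).
      exact: mevalB.
    congr (_ - _); rewrite linear_sum raddf_sum; apply: eq_bigr => i _.
    transitivity ((mpoly_of_dhomog u).@[P i] * (mpoly_of_dhomog (to_dhomog d (F i))).@[P j]).
      exact: mevalZ.
    by rewrite tE // FP.
  rewrite (bigD1 (Ordinal jr)) //= eqxx mulr1 big1 ?addr0 ?subrr // => i.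
  by rewrite -val_eqE /= => /negPf ->; rewrite mulr0.
have [w fw] := binary_nonroot (dhomog_is_dhomog _) f0; rewrite -/f in fw.
have fU : exists2 u, u \in U & f = mpoly_of_dhomog u.
  eexists; last by [].
  apply: rpredB => //; apply: rpred_sum => i _; apply: rpredZ.
  have [x xU Fx] := FU i (ltn_ord i); rewrite (_ : to_dhomog d _ = x) //.
  by apply: dhomog_inj; rewrite tE // Fx.
exists (fun i => if i == r then w else P i).
exists (fun i => if i == r then f.@[w]^-1 *: f else F i - ((F i).@[w] / f.@[w]) *: f).
split=> [i|i j]; rewrite ltnS leq_eqVlt => /orP [/eqP -> | ir].
- rewrite eqxx; have [x xU ->] := fU; exists ((mpoly_of_dhomog x).@[w]^-1 *: x).
    exact: rpredZ.
  by rewrite linearZ.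
- rewrite ltn_eqF //; have [x xU ->] := fU; have [y yU ->] := FU i ir.
  exists (y - ((mpoly_of_dhomog y).@[w] / (mpoly_of_dhomog x).@[w]) *: x).
    by apply: rpredB => //; apply: rpredZ.
  by rewrite linearB linearZ.
- rewrite eqxx ltnS leq_eqVlt => /orP [/eqP -> | jr].
    by rewrite !eqxx mevalZ mulVf.
  by rewrite ltn_eqF // mevalZ fP // mulr0 gtn_eqF.
rewrite [i == r]ltn_eqF // ltnS leq_eqVlt => /orP [/eqP -> | jr].
  by rewrite eqxx mevalB mevalZ -mulrA mulVf // mulr1 subrr ltn_eqF.
by rewrite [j == r]ltn_eqF // mevalB mevalZ fP // mulr0 subr0 FP.
Qed.

Lemma line_proportional v w : nonzero v -> nonzero w -> (line v).@[w] = 0 ->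
  exists c, line w = c *: line v.
Proof.
move=> hv hw; rewrite line_eval => /eqP; rewrite subr_eq0 => /eqP E.
have [v0|v0] := eqVneq (v ord0) 0.
  have v1 : v ord_max != 0 by case: hv => i; elim/ord2_cases: i => //; rewrite v0 eqxx.
  have w0 : w ord0 = 0.
    by move: E; rewrite v0 mul0r => /eqP; rewrite mulf_eq0 (negPf v1) => /eqP.
  by exists (w ord_max / v ord_max); rewrite /line v0 w0 !scale0r !subr0 scalerA divfK.
exists (w ord0 / v ord0); rewrite /line scalerBr !scalerA [_ / _ * v ord0]divfK //.
by congr (_ *: _ - _); apply: (mulfI v0); rewrite -E mulrA [v ord0 * _]mulrC divfK // mulrC.
Qed.

(** The line through a root of f is proportional to the given one; divide by it. *)
Lemma form_single_root v f d : nonzero v -> f \is d.-homog ->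
  (forall w, nonzero w -> f.@[w] = 0 -> (line v).@[w] = 0) -> exists c, f = c *: line v ^+ d.
Proof.
move=> hv; elim: d f => [|d IH] f hf fw.
  by have [c ->] := dhomog0_const hf; exists c; rewrite -mul_mpolyC mulr1.
have [w hw fw0] := binary_root hf.
have [c lw] := line_proportional hv hw (fw w hw fw0).
have [g hg fE] := line_factor hw hf fw0.
have [|c' gE] := IH g hg.
  by move=> w' hw' gw; apply: fw => //; rewrite fE mevalM gw mulr0.
exists (c * c'); rewrite fE gE lw exprS -!mul_mpolyC rmorphM /=; ring.
Qed.

Hypotheses (ha : alpha I a) (ha2 : (2 < a)%N) (Ihom : homogeneous I) (hnu : nu I a.+1).
Hypothesis hsi : forall B, e_maximal I B -> num_strongly_inessential I B = (a - 1)%N.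

Lemma bound3 d1 d2 d3 r1 r2 r3 : uniq [:: d1; d2; d3] ->
  admissible I d1 r1 -> admissible I d2 r2 -> admissible I d3 r3 -> (r1 + r2 + r3 <= 2)%N.
Proof.
have [_ [N Ifull]] := deg_part_shift_full ha hnu.
have a0 : (0 < a)%N by lia.
apply: (admissible_bound ha a0 Ihom Ifull _ hsi).
by rewrite (_ : (a - 1 + 2 = a.+1)%N) //; lia.
Qed.

Lemma admissible0 d : admissible I d 0.
Proof. by exists (fun _ _ => 0), (fun=> 0); split. Qed.

Lemma admissible_initial : admissible I a (\dim (deg_part I a)).
Proof.
have [P [F [FU FP]]] := separated_dual (leqnn (\dim (deg_part I a))).
exists P, F; split=> [i _ f e ea fI fe|i /FU [u uU ->]|//].
  by rewrite (alpha_lt ha fI fe ea) meval0.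
by rewrite -deg_partP; split=> //; apply: dhomog_is_dhomog.
Qed.

Lemma leaves v : nonzero v -> exists d, [/\ base_point I d v, admissible I d 1 &
  exists f, [/\ f \in I, f \is d.-homog & f.@[v] != 0]].
Proof.
move=> hv; have [_ [N Ifull]] := deg_part_shift_full ha hnu.
have exP : exists d, `[< exists f, [/\ f \in I, f \is d.-homog & f.@[v] != 0] >].
  case: hv => i vi; exists N; apply/asboolP; exists ('X_i ^+ N); split.
  - by apply: (form_vanishing Ifull (leqnn N)); apply/dhomog1X/dhomogXU.
  - by apply/dhomog1X/dhomogXU.
  - by rewrite rmorphXn /= mevalXU expf_neq0.
case: (ex_minnP exP) => d /asboolP [f [fI fd fv]] dmin.
have bv : base_point I d v.
  move=> g e ed gI ge; apply/eqP/negPn/negP => gv; move: ed; rewrite ltnNge => /negP; apply.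
  by apply: dmin; apply/asboolP; exists g.
exists d; split=> //; last by exists f.
exists (fun=> v), (fun=> f.@[v]^-1 *: f); split=> // i; last first.
  by move=> j; rewrite !ltnS !leqn0 => /eqP -> /eqP ->; rewrite mevalZ mulVf.
by move=> _; split; [rewrite -mul_mpolyC idealMr | apply: dhomogZ].
Qed.

Lemma leaves_after v d : (exists f, [/\ f \in I, f \is d.-homog & f.@[v] != 0]) ->
  (forall f, f \in I -> f \is (a).-homog -> f.@[v] = 0) -> (a < d)%N.
Proof.
move=> [f [fI fd fv]] h; case: (ltngtP a d) => // da.
  by case/eqP: fv; rewrite (alpha_lt ha fI fd da) meval0.
by case/eqP: fv; apply: h; rewrite // da.
Qed.

(** Only two points can be separated in all: one is spent in degree a, so I_a is
    spanned by one form p, and the roots of p leave the base locus in one and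
    the same degree, where they would be separated if they were distinct. *)
Lemma initial_form : exists (v : pt) (p : S), [/\ nonzero v, p \is (a).-homog, p != 0,
  deg_part I a = multiples p 0 a & forall w, nonzero w -> p.@[w] = 0 -> (line v).@[w] = 0].
Proof.
have [e [k [p [ke hp p0 Ia]]]] := deg_part_multiples ha hnu (leqnn a).
have dimIa : \dim (deg_part I a) = e.+1 by rewrite Ia (dim_multiples hp).
have adma := admissible_initial; rewrite dimIa in adma.
have inIa f : f \in I -> f \is (a).-homog -> exists g, f = p * g.
  move=> fI fa; have [u uE] := dhomog_of fa.
  have : u \in deg_part I a by rewrite deg_partP uE.
  by rewrite Ia => /(multiplesP _ hp ke) [g gE]; exists (mpoly_of_dhomog g); rewrite -uE gE.
have root_leaves v : nonzero v -> p.@[v] = 0 -> exists d, [/\ (a < d)%N, base_point I d v,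
    admissible I d 1 & exists f, [/\ f \in I, f \is d.-homog & f.@[v] != 0]].
  move=> hv pv; have [d [bv adm hf]] := leaves hv; exists d; split=> //.
  by apply: (leaves_after hf) => f fI fa; have [g ->] := inIa f fI fa; rewrite mevalM pv mul0r.
case: k hp ke => [|k] hp ke.
  have h1 : uniq [:: a; a.+1; a.+2] by rewrite /= !inE; lia.
  have := bound3 h1 adma (admissible0 _) (admissible0 _).
  by rewrite !addn0; lia.
have [v hv pv] := binary_root hp.
have [d [ad bv adm1 hfv]] := root_leaves v hv pv.
have e0 : e = 0%N.
  have h1 : uniq [:: a; d; d.+1] by rewrite /= !inE; lia.
  have := bound3 h1 adma adm1 (admissible0 _); lia.
have ka : k.+1 = a by rewrite -ke e0 addn0.
rewrite ka in hp; rewrite e0 in Ia adma.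
exists v, p; split=> // w hw pw; apply/eqP/negPn/negP => vw.
have [d' [ad' bw adm1' hfw]] := root_leaves w hw pw.
have [dd|dd] := eqVneq d d'; last first.
  have h1 : uniq [:: a; d; d'] by rewrite /= !inE; move: dd; lia.
  by have := bound3 h1 adma adm1 adm1'.
rewrite -{d'}dd in ad' bw adm1' hfw.
have [e1 [k1 [q [ke1 hq q0 Id]]]] := deg_part_multiples ha hnu (ltnW ad).
have inId f : f \in I -> f \is d.-homog -> exists g, f = q * g.
  move=> fI fd; have [u uE] := dhomog_of fd.
  have : u \in deg_part I d by rewrite deg_partP uE.
  by rewrite Id => /(multiplesP _ hq ke1) [g gE]; exists (mpoly_of_dhomog g); rewrite -uE gE.
have qv : q.@[v] != 0.
  by case: hfv => f [fI fd fv]; have [g fE] := inId f fI fd; move: fv; rewrite fE mevalM mulf_eq0 => /norP [].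
have qw : q.@[w] != 0.
  by case: hfw => f [fI fd fw]; have [g fE] := inId f fI fd; move: fw; rewrite fE mevalM mulf_eq0 => /norP [].
have e1_gt0 : (0 < e1)%N.
  have : (1 < \dim (deg_part I d))%N; last by rewrite Id (dim_multiples hq).
  case: d ad {bv adm1 hfv bw adm1' hfw ad' ke1 Id inId} => // d ad.
  apply: leq_trans (dimvS (prev_space_sub I d.+1)).
  apply: leq_ltn_trans (prev_space_dim ha ad).
  by rewrite lt0n dimv_eq0 (deg_part_neq0 ha).
have lw : (line w).@[v] != 0.
  by rewrite line_eval -oppr_eq0 opprB [w ord0 * _]mulrC [w ord_max * _]mulrC -line_eval.
have lww : (line w).@[w] = 0 by rewrite line_eval mulrC subrr.
have lvv : (line v).@[v] = 0 by rewrite line_eval mulrC subrr.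
pose G u : S := q * line u ^+ e1.
have GI u : G u \in I /\ G u \is d.-homog.
  have hG : G u \is d.-homog by rewrite -ke1; apply: dhomogM hq _; apply/dhomog1X/line_homog.
  split=> //; have [x xE] := dhomog_of hG; have [t tE] := dhomog_of (dhomog1X e1 (line_homog u)).
  by rewrite -xE -deg_partP Id; apply/(multiplesP _ hq ke1); exists t; rewrite xE tE.
have adm2 : admissible I d 2.
  exists (fun i => if i == 0%N then v else w).
  exists (fun i => if i == 0%N then (G w).@[v]^-1 *: G w else (G v).@[w]^-1 *: G v); split.
  - by move=> i _; case: ifP.
  - by move=> i _; case: ifP => _; rewrite -mul_mpolyC; split;
      try (by apply: idealMr; case: (GI w)); try (by apply: idealMr; case: (GI v));
      rewrite mul_mpolyC; apply: dhomogZ; [case: (GI w)|case: (GI v)].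
  - have Gwv : (G w).@[v] != 0 by rewrite mevalM rmorphXn /= mulf_neq0 ?expf_neq0.
    have Gvw : (G v).@[w] != 0 by rewrite mevalM rmorphXn /= mulf_neq0 ?expf_neq0.
    have Gww : (G w).@[w] = 0 by rewrite mevalM rmorphXn /= lww expr0n gtn_eqF ?mulr0.
    have Gvv : (G v).@[v] = 0 by rewrite mevalM rmorphXn /= lvv expr0n gtn_eqF ?mulr0.
    move=> [|[|//]] [|[|//]] _ _ /=; rewrite mevalZ ?mulVf //.
      by rewrite Gww mulr0.
    by rewrite Gvv mulr0.
have h1 : uniq [:: a; d; d.+1] by rewrite /= !inE; lia.
by have := bound3 h1 adma adm2 (admissible0 _).
Qed.

(** For d >= a the space I_d consists of all multiples of one form. As I_d contains
    the a-th power of the line times all forms, this form has no other root than v. *)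
Lemma single_line : exists v, nonzero v /\ forall d, (a <= d)%N ->
  exists k, [/\ (k <= d)%N, d = a -> k = a & forall f, f \is d.-homog ->
    (f \in I <-> exists2 g, g \is (d - k).-homog & f = line v ^+ k * g)].
Proof.
have [v [p [hv hp p0 Ia pw]]] := initial_form; exists v; split=> // d ad.
have [c pE] := form_single_root hv hp pw.
have c0 : c != 0 by apply: contraNneq p0 => c0; rewrite pE c0 scale0r.
have lI : line v ^+ a \in I.
  have [u uE] := dhomog_of hp.
  have uI : p \in I.
    rewrite -uE -deg_partP Ia; apply/(multiplesP _ hp (addn0 a)).
    by have [t tE] := dhomog_of (@dhomog1 2 K mdeg); exists t; rewrite uE tE mulr1.
  rewrite -[_ ^+ a]scale1r -(mulVf c0) -scalerA -pE -mul_mpolyC; exact: idealMr.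
have [e [k [q [ke hq q0 Id]]]] := deg_part_multiples ha hnu ad.
have inId f : f \is d.-homog -> (f \in I <-> exists2 g, g \is e.-homog & f = q * g).
  move=> fd; have [u uE] := dhomog_of fd; rewrite -uE -deg_partP Id.
  split=> [/(multiplesP _ hq ke) [g gE]|[g hg gE]].
    by exists (mpoly_of_dhomog g) => //; apply: dhomog_is_dhomog.
  by apply/(multiplesP _ hq ke); have [t tE] := dhomog_of hg; exists t; rewrite tE.
have [w hw|c' qE] := form_single_root hv hq.
  move=> qw; have [i wi] := hw; pose f := line v ^+ a * 'X_i ^+ (d - a).
  have fd : f \is d.-homog.
    by rewrite -(subnKC ad); apply: dhomogM; [apply/dhomog1X/line_homog|apply/dhomog1X/dhomogXU].
  have /(inId f fd) [g _ fE] : f \in I by rewrite /f mulrC idealMr.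
  have := congr1 (meval w) fE; rewrite !mevalM qw mul0r !rmorphXn /= mevalXU => /eqP.
  by rewrite mulf_eq0 !expf_eq0 (negPf wi) andbF orbF => /andP [_ /eqP].
have c'0 : c' != 0 by apply: contraNneq q0 => c0'; rewrite qE c0' scale0r.
have kd : (k <= d)%N by rewrite -ke leq_addr.
have ekd : (d - k)%N = e by rewrite -ke addKn.
exists k; rewrite ekd; split=> // [da|f fd].
  have := dim_multiples hq ke q0; rewrite -Id da Ia (dim_multiples hp (addn0 a)) // => -[e0].
  by rewrite -da -ke -e0 addn0.
split=> [/(inId f fd) [g hg ->]|[g hg fE]].
  by exists (c' *: g); [apply: dhomogZ|rewrite qE -!mul_mpolyC; ring].
apply/(inId f fd); exists (c'^-1 *: g); first exact: dhomogZ.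
by rewrite fE qE -scalerAl -scalerAr scalerA divff // scale1r.
Qed.

End SingleLine.

(** * Lifting the chain of powers *)

Section ReductionModZ.
Variables (K : closedFieldType) (a b a' b' : K) (c : nat -> nat).
Hypothesis c_gt0 : forall j, (0 < c j.+1)%N.
Local Notation S2 := {mpoly K[2]}.
Local Notation S3 := {mpoly K[3]}.

Definition binx : S2 := a *: 'X_ord0 + b *: 'X_ord_max.
Definition biny : S2 := - b' *: 'X_ord0 + a' *: 'X_ord_max.

Lemma mod_Z_is_zmod_morphism : zmod_morphism (@mod_Z K).
Proof. by move=> f g; rewrite /mod_Z rmorphB. Qed.

Lemma mod_Z_is_monoid_morphism : monoid_morphism (@mod_Z K).
Proof. by split=> [|f g]; rewrite /mod_Z ?rmorph1 ?rmorphM. Qed.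

HB.instance Definition _ := GRing.isZmodMorphism.Build S3 S2 (@mod_Z K) mod_Z_is_zmod_morphism.
HB.instance Definition _ := GRing.isMonoidMorphism.Build S3 S2 (@mod_Z K) mod_Z_is_monoid_morphism.

Lemma mod_Z_scale (u : K) f : mod_Z (u *: f) = u *: mod_Z f.
Proof. exact: comp_mpolyZ. Qed.

Lemma mod_Z_linx : mod_Z (linx a b) = binx.
Proof. by rewrite rmorphD /= !mod_Z_scale /mod_Z !comp_mpolyXU. Qed.

Lemma mod_Z_liny : mod_Z (liny a' b') = biny.
Proof. by rewrite rmorphD /= !mod_Z_scale /mod_Z !comp_mpolyXU. Qed.

Lemma mod_Z_linz : mod_Z (linz K) = 0.
Proof. by rewrite /mod_Z comp_mpolyXU. Qed.

Lemma mod_Z_surj (g : S2) : exists f, mod_Z f = g.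
Proof.
have QM (g1 g2 : S2) : (exists f, mod_Z f = g1) -> (exists f, mod_Z f = g2) ->
    exists f, mod_Z f = g1 * g2.
  by move=> [f1 <-] [f2 <-]; exists (f1 * f2); rewrite rmorphM.
have Q1 : exists f : S3, mod_Z f = 1 by exists 1; rewrite rmorph1.
have QX (i : 'I_2) : exists f : S3, mod_Z f = 'X_i.
  by elim/ord2_cases: i; [exists 'X_ord0 | exists 'X_(lift ord0 ord0)]; rewrite /mod_Z comp_mpolyXU.
elim/mpolyind: g => [|u m g _ _ [f <-]]; first by exists 0; rewrite rmorph0.
suff [f1 f1E] : exists f : S3, mod_Z f = 'X_[m].
  by exists (u *: f1 + f); rewrite rmorphD /= mod_Z_scale f1E.
rewrite mpolyXE_id; elim/big_ind: _ => [//||i _]; first exact: QM.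
by elim: (m i) => [//|k IH]; rewrite exprS; apply: QM.
Qed.

Lemma mod_Z_contin j : mod_Z (contin a b a' b' c j) = biny ^+ csum c j.
Proof.
elim/nat_ind2: j => [||j h0 h1].
- by rewrite rmorph1 csum0.
- by rewrite rmorphXn /= mod_Z_liny csumS csum0.
- rewrite continSS rmorphD !rmorphM !rmorphXn /= mod_Z_linz expr0n gtn_eqF ?zexp_gt0 //.
  by rewrite mulr0 mul0r addr0 mod_Z_liny h1 -exprD addnC -csumS.
Qed.

Lemma mod_Z_gener k j : mod_Z (gener a b a' b' c k j) = binx ^+ (k - j) * biny ^+ csum c j.
Proof. by rewrite /gener rmorphM rmorphXn /= mod_Z_linx mod_Z_contin. Qed.

End ReductionModZ.

Section BinaryCoordinates.
Variables (K : closedFieldType) (a b a' b' : K).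
Hypothesis hab : a * a' + b * b' = 1.
Local Notation S := {mpoly K[2]}.
Local Notation l := (binx a b).
Local Notation m := (biny a' b').

Lemma bin_homog : l \is 1.-homog /\ m \is 1.-homog.
Proof. by split; apply: dhomogD; apply: dhomogZ; apply: dhomogXU. Qed.

Lemma binX i : exists u v : K, 'X_i = u%:MP * l + v%:MP * m :> S.
Proof.
have habS : a%:MP * a'%:MP + b%:MP * b'%:MP = 1 :> S by rewrite -!rmorphM -rmorphD /= hab mpolyC1.
elim/ord2_cases: i.
- exists a', (- b); rewrite /binx /biny -!mul_mpolyC !rmorphN /= -{1}['X_ord0]mul1r -habS; ring.
- exists b', a; rewrite /binx /biny -!mul_mpolyC !rmorphN /= -{1}['X_ord_max]mul1r -habS; ring.
Qed.

(** The monomials in l and m span the forms; the extra factor l^k m^u serves the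
    induction. *)
Lemma bin_span (J : S -> Prop) e k u g : ideal_like J -> g \is e.-homog ->
  (forall s t, (s + t)%N = e -> J (l ^+ (k + s) * m ^+ (u + t))) -> J (l ^+ k * m ^+ u * g).
Proof.
move=> hJ; elim: e k u g => [|e IH] k u g hg H.
  by apply: ideal_likeMr => //; have := H 0%N 0%N erefl; rewrite !addn0.
have [h hh ->] := dhomogS_split hg; rewrite mulr_sumr.
apply: (ideal_like_sum hJ) => i _; have [u1 [v1 ->]] := binX i.
have -> : l ^+ k * m ^+ u * ((u1%:MP * l + v1%:MP * m) * h i) =
    u1%:MP * (l ^+ k.+1 * m ^+ u * h i) + v1%:MP * (l ^+ k * m ^+ u.+1 * h i).
  by rewrite !exprS; ring.
apply: (ideal_likeD hJ); apply: (ideal_likeMl hJ); apply: IH => // s t st.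
  by rewrite addSnnS; apply: H; rewrite addSn st.
by rewrite [(u.+1 + t)%N]addSnnS; apply: H; rewrite addnS st.
Qed.

End BinaryCoordinates.

(** In coordinates (l, m), with l the line provided by the previous part, the ideal
    is monomial and l^i m^n belongs to it when i >= kd (i + n). Its generators are
    the l^(a-j) m^(C j) with C j as small as possible. The sequence C is strictly
    increasing because membership depends only on i in a given degree, and C 1 > 1
    because l^a spans the forms of degree a of the ideal. *)
Lemma monomial_exponents (K : closedFieldType) (I : idealr {mpoly K[2]}) (a : nat) :
  calF I -> alpha I a -> (2 < a)%N ->
  (forall B, e_maximal I B -> num_strongly_inessential I B = (a - 1)%N) ->
  exists (u v u' v' : K) (c : nat -> nat),
    [/\ u * u' + v * v' = 1, forall j, (0 < c j.+1)%N, (1 < c 1)%N,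
        forall j, (j <= a)%N -> binx u v ^+ (a - j) * biny u' v' ^+ csum c j \in I
      & forall (J : {mpoly K[2]} -> Prop), ideal_like J ->
          (forall j, (j <= a)%N -> J (binx u v ^+ (a - j) * biny u' v' ^+ csum c j)) ->
          forall f, f \in I -> J f].
Proof.
move=> [Ihom _ _ [a1 ha1 hnu1]] ha ha2 hsi.
have hnu : nu I a.+1 by rewrite (alpha_uniq ha ha1).
have [w [hw hline]] := single_line ha ha2 Ihom hnu hsi.
have [u' [v' hab]] := nonzero_bezout hw.
pose u := w ord_max; pose v := - w ord0; pose l := binx u v; pose m := biny u' v'.
have lE : line w = l by rewrite /l /binx /u /v scaleNr.
have [hl hm] := bin_homog u v u' v'.
have lw : l.@[w] = 0 by rewrite -lE line_eval mulrC subrr.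
have mw : m.@[w] = 1.
  by rewrite mevalD !mevalZ !mevalXU -hab mulNr mulNr addrC mulrC [v' * _]mulrC.
have l0 : l != 0 by rewrite -lE line_neq0.
have m0 : m != 0 by apply: contraTneq isT => m0; move: mw; rewrite m0 meval0 => /eqP; rewrite eq_sym oner_eq0.
have hM i j : l ^+ i * m ^+ j \is (i + j).-homog by apply: dhomogM; apply: dhomog1X.
have M0 i j : l ^+ i * m ^+ j != 0 by rewrite mulf_neq0 ?expf_neq0.
have Mdeg i j : l ^+ i * m ^+ j \in I -> (a <= i + j)%N.
  move=> MI; rewrite leqNgt; apply/negP => ij.
  by case/eqP: (M0 i j); apply: alpha_lt ha MI (hM i j) ij.
have [|kd hkd] := @choice _ _ (fun d k => (a <= d)%N -> [/\ (k <= d)%N, d = a -> k = a &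
    forall f, f \is d.-homog -> (f \in I <-> exists2 g, g \is (d - k).-homog & f = l ^+ k * g)]).
  move=> d; case: (leqP a d) => ad; last by exists 0%N.
  by have [k hk] := hline d ad; exists k => _; rewrite -lE.
have MI i j : (a <= i + j)%N -> (l ^+ i * m ^+ j \in I) = (kd (i + j)%N <= i)%N.
  move=> aij; have [kij _ hk] := hkd _ aij; apply/idP/idP => [/(hk _ (hM i j)) [g _ E]|ki].
    rewrite leqNgt; apply/negP => ik.
    have {}E : m ^+ j = l ^+ (kd (i + j)%N - i) * g.
      by apply: (mulfI (expf_neq0 i l0)); rewrite mulrA -exprD subnKC // ltnW.
    have := congr1 (meval w) E; rewrite rmorphM !rmorphXn /= mw lw expr1n expr0n.
    by rewrite subn_eq0 leqNgt ik mul0r => /eqP; rewrite oner_eq0.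
  apply/(hk _ (hM i j)); exists (l ^+ (i - kd (i + j)%N) * m ^+ j).
    by rewrite -addnBAC //; apply: hM.
  by rewrite mulrA -exprD subnKC.
have [_ [N Ifull]] := deg_part_shift_full ha hnu.
have [|C hC] := @choice _ _ (fun j n => l ^+ (a - j) * m ^+ n \in I /\
    forall n', l ^+ (a - j) * m ^+ n' \in I -> (n <= n')%N).
  move=> j; have exn : exists n, l ^+ (a - j) * m ^+ n \in I.
    by exists N; apply: (form_vanishing Ifull (leq_addl _ _) (hM _ _)).
  by exists (ex_minn exn); case: ex_minnP.
have [_ /(_ erefl) ka hka] := hkd a (leqnn a).
have C0 : C 0 = 0%N.
  by apply/eqP; rewrite -leqn0; apply: (hC 0%N).2; rewrite subn0 MI addn0 // ka.
have CS j : (j < a)%N -> (C j < C j.+1)%N.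
  move=> ja; have [CI _] := hC j.+1; have deg := Mdeg _ _ CI.
  have : (kd (a - j.+1 + C j.+1)%N <= a - j.+1)%N by rewrite -MI.
  case E : (C j.+1) deg => [|n] deg; first by move: deg; rewrite addn0; lia.
  move=> kn; rewrite ltnS; apply: (hC j).2.
  have dE : (a - j + n = a - j.+1 + n.+1)%N by lia.
  by rewrite MI dE //; apply: leq_trans kn _; lia.
pose c j := if j is i.+1 then (if (i < a)%N then C i.+1 - C i else 1)%N else 0%N.
have csumC j : (j <= a)%N -> csum c j = C j.
  elim: j => [|j IH] ja; first by rewrite csum0 C0.
  by rewrite csumS IH ?(ltnW ja) // /c ja subnKC // ltnW // CS.
exists u, v, u', v', c; split=> //.
- by move=> j; rewrite /c; case: ifP => // ja; rewrite subn_gt0 CS.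
- rewrite /c (ltnW (ltnW ha2)) C0 subn0; have := CS 0%N (ltnW (ltnW ha2)); rewrite C0.
  case E : (C 1%N) => [|[|n]] // _; have [CI _] := hC 1%N; move: CI.
  by rewrite E MI subnK ?(ltnW (ltnW ha2)) // ka; lia.
- by move=> j ja; rewrite csumC //; case: (hC j).
move=> J hJ JC.
have JM i n : l ^+ i * m ^+ n \in I -> J (l ^+ i * m ^+ n).
  move=> MIn; case: (leqP a i) => ai.
    have := JC 0%N (leq0n a); rewrite subn0 csum0 mulr1 => Jl.
    by rewrite -(subnK ai) exprD mulrAC; apply: ideal_likeMl.
  have Ci : (C (a - i) <= n)%N by apply: (hC _).2; rewrite subKn // ltnW.
  have := JC (a - i)%N (leq_subr _ _); rewrite csumC ?leq_subr // subKn ?(ltnW ai) // => Jl.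
  by rewrite -(subnK Ci) exprD mulrCA; apply: ideal_likeMl.
have Jhom f d : f \in I -> f \is d.-homog -> J f.
  move=> fI fd; case: (ltnP d a) => da.
    by rewrite (alpha_lt ha fI fd da); apply: ideal_like0.
  have [kdd _ hk] := hkd d da; have [g hg ->] := (hk f fd).1 fI.
  rewrite -[l ^+ _]mulr1 -(expr0 m); apply: (bin_span hab hJ hg) => s t st.
  apply: JM; have dE : (kd d + s + t = d)%N by rewrite -addnA st subnKC.
  by rewrite add0n MI dE // leq_addr.
move=> f fI; rewrite (pihomog_partitionE (leqnn (msize f))).
by apply: (ideal_like_sum hJ) => d _; apply: (Jhom _ d (Ihom f d fI)); apply: pihomogP.
Qed.

Theorem proposition5p4 (K : closedFieldType) (Ibar : idealr {mpoly K[2]})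
    (a : nat) (hF : calF Ibar) (ha : alpha Ibar a) (ha2 : (2 < a)%N)
    (hsi : forall B : seq {mpoly K[2]}, e_maximal Ibar B ->
       num_strongly_inessential Ibar B = (a - 1)%N) :
  exists I : idealr {mpoly K[3]}, calS I /\ lifting I Ibar.
Proof.
have [u [v [u' [v' [c [hab c0 c1 Igen Imin]]]]]] := monomial_exponents hF ha ha2 hsi.
have [I hI] := ideal_like_idealr (lifted_ideal u v u' v' c a) (lifted_N1 c0 c1 ha2).
exists I; split.
  split; last by exists a; first exact: (lifted_alpha hab c0 c1 ha2 hI).
    split.
    - exact: (lifted_homogeneous c0 hI).
    - exact: (lifted_height hab c0 ha2 hI).
    - exact: (lifted_pdim hab c1 ha2 hI).
    - by exists a; [apply: (lifted_alpha hab c0 c1 ha2 hI) | apply: (lifted_nu hab c0 hI)].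
  exact: (lifted_nu_e hab c0 c1 ha2 hI).
split; first exact: (lifted_nzd_quot hab hI).
move=> g; split=> [|[f /hI [h ->] <-]]; last first.
  rewrite raddf_sum; apply: rpred_sum => j _; rewrite /= rmorphM /= (mod_Z_gener _ _ _ _ c0).
  by apply: idealMr; apply: Igen; apply: leq_ord.
apply: (Imin (fun g => exists2 f, f \in I & mod_Z f = g)).
  split.
  - by exists 0; rewrite ?rmorph0 ?rpred0.
  - by move=> _ _ [f fI <-] [f' fI' <-]; exists (f + f'); rewrite ?rmorphD ?rpredD.
  - move=> _ s [f fI <-]; have [t <-] := mod_Z_surj s.
    by exists (t * f); rewrite ?idealMr // rmorphM mulrC.
move=> j ja; exists (gener u v u' v' c a j); last exact: mod_Z_gener.
exact: (gen_mem hI ja).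
Qed.
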